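(* Let $d\geq 1$ be an integer, $n$ a real number with $n>d/2$, and $2<r<\infty$. Then the sharp imbedding constant $S_{r,n,d}$ satisfies $S_{r,n,d}\geq S^{-}_{r,n,d}$, where $$S^{-}_{r,n,d}:=\left(\frac{\Gamma(d/2)}{2\pi^{d/2}}\right)^{1/2-1/r}\frac{I_{r,n,d}^{1/r}}{2^{n-1}\,\Gamma(n)\,\sqrt{\Phi_{r,n,d}}},$$ $$I_{r,n,d}:=\int_0^{+\infty}t^{d-1}\left(t^{n-d/2}K_{n-d/2}(t)\right)^r dt,$$ $$\Phi_{r,n,d}:=\inf_{\lambda>0}\varphi_{r,n,d}(\lambda),\qquad \varphi_{r,n,d}(\lambda):=\frac{1}{\lambda^{d-2d/r}}\int_0^{+\infty}s^{d-1}\frac{(1+\lambda^2s^2)^n}{(1+s^2)^{2n}}\,ds.$$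
   Context: The Fourier transform $\mathcal F$ on $\mathcal S'(\mathbf R^d,\mathbf C)$ is normalized so that $\mathcal F f(k)=(2\pi)^{-d/2}\int_{\mathbf R^d}e^{-ik\cdot x}f(x)\,dx$ for $f\in L^1(\mathbf R^d,\mathbf C)$. For real $n\geq 0$, the Sobolev (Bessel potential) space is $H^n(\mathbf R^d,\mathbf C):=\{f\in\mathcal S'(\mathbf R^d,\mathbf C) : (1+|k|^2)^{n/2}\mathcal F f\in L^2(\mathbf R^d,\mathbf C)\}$, with norm $\|f\|_{H^n}:=\|(1+|k|^2)^{n/2}\mathcal F f\|_{L^2}$, where $k$ is the Fourier variable and $|k|$ its Euclidean norm. The sharp imbedding constant is $$S_{r,n,d}:=\inf\{S\geq 0 : \|f\|_{L^r}\leq S\,\|f\|_{H^n}\ \text{for all } f\in H^n(\mathbf R^d,\mathbf C)\}.$$ $\Gamma$ is the Gamma function and $K_{\mu}$ denotes the modified Bessel function of the third kind (Macdonald function) of order $\mu$. *)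

(* Defs.v *)
From HB Require Import structures.
From mathcomp Require Import all_boot all_order all_algebra.
From mathcomp Require Import complex.
From mathcomp Require Import all_classical all_reals all_analysis.
Set Implicit Arguments.
Unset Strict Implicit.
Unset Printing Implicit Defensive.
Import Order.TTheory GRing.Theory Num.Theory.
Import numFieldNormedType.Exports.
Local Open Scope classical_set_scope.
Local Open Scope ring_scope.


Definition rV_display : measure_display.
Proof. exact: default_measure_display. Qed.

Section measurable_rV.
Context {R : realType} (d : nat).

Let coors : 'I_d -> 'rV[R]_d -> measurableTypeR R := fun i x => x ord0 i.

Let rV_set0 : g_sigma_preimage coors set0.
Proof. exact: sigma_algebra0. Qed.

Let rV_setC A : g_sigma_preimage coors A -> g_sigma_preimage coors (~` A).
Proof. exact: sigma_algebraC. Qed.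

Let rV_bigcup (F : _^nat) : (forall i, g_sigma_preimage coors (F i)) ->
  g_sigma_preimage coors (\bigcup_i (F i)).
Proof. exact: sigma_algebra_bigcup. Qed.

HB.instance Definition _ := @isMeasurable.Build rV_display
  'rV[R]_d (g_sigma_preimage coors) rV_set0 rV_setC rV_bigcup.

End measurable_rV.

Section rV_measurability.
Context {R : realType}.

Lemma measurable_coord d (i : 'I_d) :
  measurable_fun [set: 'rV[R]_d] (fun x : 'rV[R]_d => x ord0 i).
Proof.
move=> _ Y mY; rewrite setTI; apply: sub_sigma_algebra => /=.
rewrite -bigcup_seq/=; exists i => /=; first by rewrite mem_index_enum.
by exists Y => //; rewrite setTI.
Qed.

Lemma measurable_fun_rV disp (T : measurableType disp) d (f : T -> 'rV[R]_d) :
  (forall i, measurable_fun setT (fun x => f x ord0 i)) ->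
  measurable_fun setT f.
Proof.
move=> mf; apply: (@measurability _ _ _ _ _ f (\big[setU/set0]_(i < d)
  preimage_set_system [set: 'rV[R]_d]
    (fun x : 'rV[R]_d => x ord0 i : measurableTypeR R) measurable)) => //.
move=> _ [A + <-]; rewrite -bigcup_seq => -[i _ [B mB <-]].
by rewrite !setTI; have := mf i measurableT _ mB; rewrite setTI.
Qed.

Definition consrV d (p : measurableTypeR R * 'rV[R]_d) : 'rV[R]_d.+1 := row_mx p.1%:M p.2.

Lemma consrV0 d (p : measurableTypeR R * 'rV[R]_d) :
  consrV p ord0 ord0 = p.1.
Proof.
case: p => t y; transitivity (row_mx (t%:M : 'M[R]_1) y ord0 (lshift d ord0)).
  by rewrite /consrV; congr (row_mx _ _ _ _); exact: val_inj.
by rewrite row_mxEl mxE.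
Qed.

Lemma consrVS d (p : measurableTypeR R * 'rV[R]_d) j :
  consrV p ord0 (lift ord0 j) = p.2 ord0 j.
Proof.
case: p => t y; transitivity (row_mx (t%:M : 'M[R]_1) y ord0 (rshift 1 j)).
  by rewrite /consrV; congr (row_mx _ _ _ _); exact: val_inj.
by rewrite row_mxEr.
Qed.

Lemma measurable_consrV d :
  measurable_fun [set: measurableTypeR R * 'rV[R]_d] (@consrV d).
Proof.
apply: measurable_fun_rV => i; case: (@split_ordP 1 d i) => j ->.
- suff -> : (fun p => consrV p ord0 (lshift d j)) = fst by exact: measurable_fst.
  by apply/funext => -[t y]; rewrite /consrV (row_mxEl t%:M y) (ord1 j) mxE.
- rewrite (_ : (fun _ => _) = (fun x : 'rV[R]_d => x ord0 j) \o snd).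
    exact: (measurableT_comp (measurable_coord j) measurable_snd).
  by apply/funext => -[t y]; rewrite /consrV /= (row_mxEr t%:M y).
Qed.

HB.instance Definition _ d := isMeasurableFun.Build _ _ _ _ (@consrV d)
  (@measurable_consrV d).

End rV_measurability.

Section lebesgue_rV_step.
Context {R : realType} (d : nat).
Variable mu : {sigma_finite_measure set 'rV[R]_d -> \bar R}.

Definition lebesgue_rVS : set 'rV[R]_d.+1 -> \bar R :=
  pushforward (product_measure1 (@lebesgue_measure R) mu) (@consrV R d).

Let lebS0 : lebesgue_rVS set0 = 0%E.
Proof. exact: measure0. Qed.

Let lebS_ge0 A : (0 <= lebesgue_rVS A)%E.
Proof. exact: measure_ge0. Qed.

Let lebS_sigma_additive : semi_sigma_additive lebesgue_rVS.
Proof. exact: measure_semi_sigma_additive. Qed.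

HB.instance Definition _ := isMeasure.Build _ _ _ lebesgue_rVS
  lebS0 lebS_ge0 lebS_sigma_additive.

Let lebS_sigma_finite : sigma_finite setT lebesgue_rVS.
Proof.
have [F [TF ndF Foo]] :=
  (sigma_finiteP _ _).1 (sigma_finiteT (@lebesgue_measure R)).
have [G [TG ndG Goo]] := (sigma_finiteP _ _).1 (sigma_finiteT mu).
pose u (x : 'rV[R]_d.+1) : measurableTypeR R * 'rV[R]_d :=
  (x ord0 ord0, \row_j x ord0 (lift ord0 j)).
have uK p : u (consrV p) = p.
  rewrite /u consrV0; case: p => t y; congr pair.
  by apply/rowP => j; rewrite mxE consrVS.
have mu_ : measurable_fun setT u.
  apply/measurable_fun_pairP; split; first exact: measurable_coord.
  apply: measurable_fun_rV => i.
  rewrite (_ : (fun _ => _) = (fun x : 'rV[R]_d.+1 => x ord0 (lift ord0 i))).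
    exact: measurable_coord.
  by apply/funext => x; rewrite /= mxE.
exists (fun k => u @^-1` (F k `*` G k)).
  apply/esym; rewrite -subTset => x _.
  have : (\bigcup_i F i) (u x).1 by rewrite -TF.
  have : (\bigcup_i G i) (u x).2 by rewrite -TG.
  move=> [j _ Gj] [i _ Fi]; exists (maxn i j) => //; split.
    by move: Fi; apply/subsetPset/ndF/leq_maxl.
  by move: Gj; apply/subsetPset/ndG/leq_maxr.
move=> k; have [mF Fk] := Foo k; have [mG Gk] := Goo k; split.
  by rewrite -[X in measurable X]setTI; apply: mu_ => //; exact: measurableX.
rewrite /lebesgue_rVS /pushforward.
rewrite (_ : _ @^-1` _ = F k `*` G k); last first.
  by apply/seteqP; split => p; rewrite /preimage /mkset (uK p).
by rewrite product_measure1E// lte_mul_pinfty// ge0_fin_numE.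
Qed.

HB.instance Definition _ := Measure_isSigmaFinite.Build _ _ _ lebesgue_rVS
  lebS_sigma_finite.

End lebesgue_rV_step.

Fixpoint lebesgue_rV {R : realType} (d : nat) :
    {sigma_finite_measure set 'rV[R]_d -> \bar R} :=
  match d with
  | 0 => [the {sigma_finite_measure set 'rV[R]_0 -> \bar R} of
      \d_(0 : 'rV[R]_0)]
  | d'.+1 => [the {sigma_finite_measure set 'rV[R]_d'.+1 -> \bar R} of
      lebesgue_rVS (lebesgue_rV d')]
  end.

Lemma lebesgue_rV_box {R : realType} (d : nat) (A : 'I_d -> set R) :
  (forall i, measurable (A i)) ->
  lebesgue_rV d [set x : 'rV[R]_d | forall i, A i (x ord0 i)] =
  (\prod_(i < d) lebesgue_measure (A i))%E.
Proof.
elim: d A => [|d IH] A mA /=.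
  rewrite big_ord0 diracE (_ : [set _ | _] = setT) ?in_setT//.
  by rewrite -subTset => x _ [].
rewrite big_ord_recl -(IH (fun i => A (lift ord0 i)))//.
rewrite /lebesgue_rVS /pushforward (_ : _ @^-1` _ = A ord0 `*`
  [set x : 'rV[R]_d | forall i, A (lift ord0 i) (x ord0 i)]); last first.
  apply/seteqP; split => p /=.
    move=> h; split; first by rewrite -consrV0.
    by move=> i; rewrite -consrVS.
  move=> [h0 hS] i; case: (unliftP ord0 i) => [j|] ->; last by rewrite consrV0.
  by rewrite consrVS.
rewrite product_measure1E//; first exact: mA.
rewrite (_ : [set _ | _] = \bigcap_(i in [set: 'I_d])
  ((fun x : 'rV[R]_d => x ord0 i) @^-1` A (lift ord0 i))).
  apply: fin_bigcap_measurable => // i _.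
  by rewrite -[X in measurable X]setTI; exact: measurable_coord.
by apply/seteqP; split => x /= h i => [_|]; exact: h.
Qed.

Section fourier_sobolev.
Context {R : realType} {d : nat}.
Local Notation Rd := 'rV[R]_d.
Local Notation C := R[i].
Local Notation mu := (@lebesgue_rV R d).
Local Notation cRe := (@complex.Re R).
Local Notation cIm := (@complex.Im R).
Local Notation cmod := ComplexField.Normc.normc.
Implicit Types (x k : Rd) (g phi psi : Rd -> C) (u : (Rd -> C) -> C).

Definition dotp x k : R := \sum_(i < d) x ord0 i * k ord0 i.

(* The norm `|x| that the library puts on 'rV is the sup norm. *)
Definition enorm x : R := Num.sqrt (dotp x x).

Definition partial (s : seq 'I_d) (f : Rd -> R) : Rd -> R :=
  foldr (fun i h x => 'D_(delta_mx ord0 i : Rd) h x) f s.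

Definition smooth (f : Rd -> R) : Prop :=
  forall s, continuous (partial s f) /\
    forall i x, derivable (partial s f) x (delta_mx ord0 i : Rd).

Definition cpartial (s : seq 'I_d) phi : Rd -> C :=
  fun x => (partial s (fun y => cRe (phi y)) x
            +i* partial s (fun y => cIm (phi y)) x)%C.

Definition schwartz_seminorm (N : nat) phi : \bar R :=
  ereal_sup [set e | exists x (s : seq 'I_d), (size s <= N)%N /\
    e = ((1 + enorm x) ^+ N * cmod (cpartial s phi x))%:E].

Definition schwartz phi : Prop :=
  smooth (fun x => cRe (phi x)) /\ smooth (fun x => cIm (phi x)) /\
  forall N, (schwartz_seminorm N phi < +oo)%E.

(* Tempered distributions are encoded as functionals on all functions Rd -> C,
   of which only the restriction to Schwartz functions is ever constrained or
   used; two functionals agreeing on Schwartz functions are the same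
   distribution. *)
Definition tempered u : Prop :=
  (forall (a : C) phi psi, schwartz phi -> schwartz psi ->
     u (fun x => a * phi x + psi x) = a * u phi + u psi) /\
  exists (c : R) (N : nat), forall phi, schwartz phi ->
    ((cmod (u phi))%:E <= c%:E * schwartz_seminorm N phi)%E.

Definition cintegrable g : Prop :=
  mu.-integrable setT (fun x => (cRe (g x))%:E) /\
  mu.-integrable setT (fun x => (cIm (g x))%:E).

Definition cintegral g : C :=
  ((\int[mu]_x cRe (g x)) +i* (\int[mu]_x cIm (g x)))%C.

Definition cis (t : R) : C := (cos t +i* sin t)%C.

Definition fourier phi : Rd -> C := fun k =>
  ((2 * pi) `^ (- (d%:R / 2)))%:C%C
  * cintegral (fun x => cis (- dotp k x) * phi x).

Definition dist_fourier u : (Rd -> C) -> C := fun phi => u (fourier phi).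

Definition dist_mul (m : Rd -> R) u : (Rd -> C) -> C :=
  fun phi => u (fun k => (m k)%:C%C * phi k).

Definition represents u g : Prop :=
  measurable_fun setT (fun x => cRe (g x)) /\
  measurable_fun setT (fun x => cIm (g x)) /\
  forall phi, schwartz phi ->
    cintegrable (fun x => g x * phi x) /\
    u phi = cintegral (fun x => g x * phi x).

Definition Lpnorm (p : R) g : \bar R :=
  Lnorm mu p%:E (fun x => (cmod (g x))%:E).

(* The functions representing a distribution are equal almost everywhere, so
   this is an infimum over a single value, or +oo if there is no such
   function. *)
Definition dist_Lpnorm (p : R) u : \bar R :=
  ereal_inf [set Lpnorm p g | g in represents u].

Definition dist_in_Lp (p : R) u : Prop :=
  exists g, represents u g /\ (Lpnorm p g < +oo)%E.

Definition bessel_fourier (n : R) u : (Rd -> C) -> C :=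
  dist_mul (fun k => (1 + enorm k ^+ 2) `^ (n / 2)) (dist_fourier u).

Definition sobolev (n : R) u : Prop :=
  tempered u /\ dist_in_Lp 2 (bessel_fourier n u).

Definition sobolev_norm (n : R) u : \bar R := dist_Lpnorm 2 (bessel_fourier n u).

End fourier_sobolev.

Section constants.
Context {R : realType}.
Local Notation leb := (@lebesgue_measure R).

Definition sharp_constant (r n : R) (d : nat) : \bar R :=
  ereal_inf [set S%:E | S in [set S : R | 0 <= S /\
    forall f : ('rV[R]_d -> R[i]) -> R[i], sobolev n f ->
      (dist_Lpnorm r f <= S%:E * sobolev_norm n f)%E]].

Definition Gamma (x : R) : R :=
  \int[leb]_(t in `]0, +oo[) (t `^ (x - 1) * expR (- t)).

Definition cosh (x : R) : R := (expR x + expR (- x)) / 2.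

(* For t > 0, K_nu(t) is the integral of exp(- t cosh s) cosh(nu s) over
   s > 0 (Watson, Theory of Bessel functions, 6.22; DLMF 10.32.9). *)
Definition besselK (nu t : R) : R :=
  \int[leb]_(s in `]0, +oo[) (expR (- t * cosh s) * cosh (nu * s)).

(* I_const and phi_fun are integrals of nonnegative functions that are finite
   when n > d / 2, r > 0 and l > 0. *)
Definition I_const (r n : R) (d : nat) : R :=
  \int[leb]_(t in `]0, +oo[)
    (t ^+ d.-1 * (t `^ (n - d%:R / 2) * besselK (n - d%:R / 2) t) `^ r).

Definition phi_fun (r n : R) (d : nat) (l : R) : R :=
  (l `^ (d%:R - 2 * d%:R / r))^-1 *
  \int[leb]_(s in `]0, +oo[)
    (s ^+ d.-1 * ((1 + l ^+ 2 * s ^+ 2) `^ n / (1 + s ^+ 2) `^ (2 * n))).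

Definition Phi_const (r n : R) (d : nat) : R :=
  inf [set phi_fun r n d l | l in [set l : R | 0 < l]].

Definition lower_constant (r n : R) (d : nat) : R :=
  (Gamma (d%:R / 2) / (2 * pi `^ (d%:R / 2))) `^ (1 / 2 - 1 / r) *
  (I_const r n d `^ (1 / r)
   / (2 `^ (n - 1) * Gamma n * Num.sqrt (Phi_const r n d))).

End constants.

(* Main.v *)
(** For l > 0 let f_l(x) = |l x|^nu K_nu(|l x|) / (2^(n-1) Gamma(n)) with
    nu = n - d/2. Its Fourier transform is l^(-d) (1 + |k|^2/l^2)^(-n), so in
    polar coordinates its L^r norm is expressed by I_{r,n,d} and its H^n norm by
    phi_{r,n,d}(l); taking the infimum over l of the ratio gives the bound.

    f_l is a Gaussian mixture, int w(s) exp(-e^(-s) l^2 |x|^2 / 4) ds, so its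
    Fourier transform and its integrals follow from Tonelli's theorem and the
    one-dimensional integral of e^(-t^2) cos(kt). The duality defining the Fourier
    transform of a distribution is Fubini's theorem for f_l(x) a(k) cos(x.k + th).

    The L^r norm of a distribution is an infimum over all functions g
    representing it. Testing g against normalized Gaussians centred at y bounds
    the convolution of f_l with a Gaussian by that of |g|; by Jensen's inequality
    and monotone convergence, the L^r norm of f_l is at most that of g.

    Finiteness of the integrals need not be proved: a divergent one makes
    [I_const] or [phi_fun] take the junk value 0, and then [lower_constant] is 0. *)

Require Import Defs.
From HB Require Import structures.
From mathcomp Require Import all_boot all_order all_algebra.
From mathcomp Require Import complex.
From mathcomp Require Import all_classical all_reals all_analysis measurable_realfun.
From mathcomp Require Import ring lra.
Import Order.TTheory GRing.Theory Num.Theory.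
Import numFieldNormedType.Exports.
Local Open Scope classical_set_scope.
Local Open Scope ring_scope.
Set Implicit Arguments.
Unset Strict Implicit.
Unset Printing Implicit Defensive.

(** * Lebesgue measure on the line and on R^d *)

(** Why this family: up to a constant, f(0) is the L^2 pairing of (1+|k|^2)^(n/2) F f with
    (1+|k|^2)^(-n/2), so for r = infinity the Cauchy-Schwarz extremal has transform (1+|k|^2)^(-n).
    For finite r it serves as a trial function, and its dilations supply l. Why a mixture: Gamma(n)
    (1+q)^(-n) is the integral of u^(n-1) e^(-u) e^(-qu) du, and e^(-u|k|^2) is the transform of a
    multiple of a Gaussian. The variable is u = e^s, so that scalings become translations of the
    whole line. Both the substitution t = e^s and polar coordinates come from one exchange of
    integrals that uses only how the measure scales; the sphere constant is read off from a
    Gaussian. Obstacle: cosines change sign, while Tonelli wants nonnegative integrands. Cosines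
    therefore enter as 1 + B cos with 0 <= B <= 1, and the 1 is removed at the end by shifting the
    phase by pi. The free phase [th] in each formula covers real and imaginary parts together. *)

Section lebesgue_line.
Context {R : realType}.
Local Notation leb := (@lebesgue_measure R).
Local Open Scope ereal_scope.

Definition affine (c b : R) : measurableTypeR R -> measurableTypeR R :=
  fun x => (c * x + b)%R.

Let measurable_affine c b : measurable_fun setT (affine c b).
Proof.
by apply: measurable_funD => //; apply: measurable_funM.
Qed.

HB.instance Definition _ c b :=
  isMeasurableFun.Build _ _ _ _ (affine c b) (measurable_affine c b).

(** By uniqueness of Lebesgue measure it suffices to compare both sides on half-open intervals,
    where the preimage is again such an interval, shorter by the factor [c]. *)
Lemma lebesgue_measure_affine (c b : R) (A : set R) : (0 < c)%R -> measurable A ->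
  leb A = c%:E * pushforward leb (affine c b) A.
Proof.
move=> c0 mA.
pose m : {measure set (measurableTypeR R) -> \bar R} :=
  mscale (NngNum (ltW c0)) (measure_function_pushforward__canonical__measure_function_Measure leb (measurable_affine c b)).
transitivity (m A); last by [].
apply: lebesgue_measure_unique mA => _ [[u v] _ <-] /=.
rewrite /m /mscale /= /pushforward.
rewrite (_ : _ @^-1` _ = `](u - b) / c, (v - b) / c]%classic)%R; last first.
  apply/seteqP; split => x /=;
  by rewrite /affine !in_itv/= ltr_pdivrMr// ler_pdivlMr// ltrBlDr lerBrDr mulrC.
rewrite !lebesgue_measure_itv/= !lte_fin ltr_pM2r ?invr_gt0// ltrD2r.
case: ifP => _; last by rewrite mule0.
by rewrite -!EFinB -EFinM; congr EFin; field; rewrite gt_eqF.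
Qed.

Lemma ge0_integral_affine (c b : R) (f : R -> \bar R) : (0 < c)%R ->
  measurable_fun setT f -> (forall x, 0 <= f x) ->
  \int[leb]_x f x = c%:E * \int[leb]_x f (c * x + b)%R.
Proof.
move=> c0 mf f0.
rewrite -[in RHS](preimage_setT (affine c b)).
rewrite -(ge0_integral_pushforward (measurable_affine c b))//.
pose p := measure_function_pushforward__canonical__measure_function_Measure leb
  (measurable_affine c b).
rewrite -(@ge0_integral_mscale _ _ R p setT measurableT (NngNum (ltW c0)) f)//.
by apply: eq_measure_integral => A mA _; exact: lebesgue_measure_affine.
Qed.

Lemma ge0_integral_shift (b : R) (f : R -> \bar R) :
  measurable_fun setT f -> (forall x, 0 <= f x) ->
  \int[leb]_x f (x + b)%R = \int[leb]_x f x.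
Proof.
move=> mf f0; rewrite [RHS](@ge0_integral_affine 1 b)// mul1e.
by apply: eq_integral => x _; rewrite mul1r.
Qed.

Lemma ge0_integral_scale (c : R) (f : R -> \bar R) : (0 < c)%R ->
  measurable_fun setT f -> (forall x, 0 <= f x) ->
  \int[leb]_x f (c * x)%R = (c^-1)%:E * \int[leb]_x f x.
Proof.
move=> c0 mf f0; rewrite [in RHS](@ge0_integral_affine c 0)// muleA -EFinM.
rewrite mulVf ?gt_eqF// mul1e; apply: eq_integral => x _; by rewrite addr0.
Qed.

Lemma ge0_integral_opp (f : R -> \bar R) :
  measurable_fun setT f -> (forall x, 0 <= f x) ->
  \int[leb]_x f (- x)%R = \int[leb]_x f x.
Proof.
move=> mf f0; have mN : measurable_fun setT (-%R : measurableTypeR R -> measurableTypeR R).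
  exact: oppr_measurable.
rewrite -[in LHS](preimage_setT (-%R : measurableTypeR R -> measurableTypeR R)).
rewrite -(ge0_integral_pushforward mN)//.
by apply: eq_measure_integral => A mA _; exact: lebesgue_measureN.
Qed.

End lebesgue_line.

Section lebesgue_space.
Context {R : realType}.
Local Notation leb := (@lebesgue_measure R).
Local Notation mu d := (@lebesgue_rV R d).

Lemma measurable_enorm d : measurable_fun setT (@enorm R d).
Proof.
apply: measurableT_comp; first exact: measurable_funTS (continuous_measurable_fun (@sqrt_continuous R)).
rewrite (_ : (fun x => _) = (fun x : 'rV[R]_d => \sum_(i < d) x ord0 i * x ord0 i)) //.
by apply: measurable_sum => i; apply: measurable_funM; exact: measurable_coord.
Qed.

Lemma measurable_dotp d (disp : measure_display) (T : measurableType disp) (f g : T -> 'rV[R]_d) :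
  measurable_fun setT f -> measurable_fun setT g ->
  measurable_fun setT (fun t => dotp (f t) (g t)).
Proof.
move=> mf mg; rewrite /dotp; apply: measurable_sum => i.
by apply: measurable_funM; apply: (measurableT_comp (measurable_coord i)).
Qed.

Lemma integral_rV0 (f : 'rV[R]_0 -> \bar R) : (\int[mu 0]_x f x = f 0%R)%E.
Proof.
rewrite /= integral_dirac//; last first.
  move=> _ Y mY; rewrite setTI.
  have [Y0|Y0] := pselect (Y (f 0)).
    rewrite (_ : _ @^-1` _ = setT)//; apply/seteqP; split => // x _.
    by rewrite /preimage /= (_ : x = 0)//; apply/rowP => -[].
  rewrite (_ : _ @^-1` _ = set0)//; apply/seteqP; split => // x.
  by rewrite /preimage /= (_ : x = 0)//; apply/rowP => -[].
by rewrite diracE in_setT mul1e.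
Qed.

Lemma ge0_integral_rVS d (f : 'rV[R]_d.+1 -> \bar R) :
  measurable_fun setT f -> (forall x, 0 <= f x)%E ->
  (\int[mu d.+1]_x f x = \int[leb]_t \int[mu d]_y f (consrV (t, y)))%E.
Proof.
move=> mf f0; rewrite /= /lebesgue_rVS.
rewrite (ge0_integral_pushforward (@measurable_consrV R d))// preimage_setT.
rewrite (fubini_tonelli1 (f \o (@consrV R d)))//; last by move=> p; exact: f0.
by apply: measurableT_comp => //; exact: measurable_consrV.
Qed.

Lemma measurable_consrV_snd d (f : 'rV[R]_d.+1 -> \bar R) t :
  measurable_fun setT f -> measurable_fun setT (fun y => f (consrV (t, y))).
Proof.
move=> mf; apply: measurableT_comp => //.
apply: (measurableT_comp (@measurable_consrV R d)).
exact: measurable_pair1.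
Qed.

Lemma measurable_fubini_rV d (f : 'rV[R]_d.+1 -> \bar R) :
  measurable_fun setT f -> (forall x, 0 <= f x)%E ->
  measurable_fun setT (fun t => \int[mu d]_y f (consrV (t, y)))%E.
Proof.
move=> mf f0.
apply: (measurable_fun_fubini_tonelli_F (f \o (@consrV R d))) => //; last by move=> p; exact: f0.
by apply: measurableT_comp => //; exact: measurable_consrV.
Qed.

Lemma ge0_integral_rV_prod d (g : 'I_d -> R -> R) (c : 'I_d -> R) :
  (forall i, measurable_fun setT (g i)) -> (forall i t, 0 <= g i t) ->
  (forall i, \int[leb]_t (g i t)%:E = (c i)%:E)%E ->
  (\int[mu d]_x (\prod_(i < d) g i (x ord0 i))%:E = (\prod_(i < d) c i)%:E)%E.
Proof.
elim: d g c => [|d IH] g c mg g0 gc; first by rewrite integral_rV0 !big_ord0.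
have mprod m (h : 'I_m -> R -> R) : (forall i, measurable_fun setT (h i)) ->
    measurable_fun setT (fun x : 'rV[R]_m => \prod_(i < m) h i (x ord0 i)).
  by move=> mh; apply: measurable_prod => i _; apply: measurableT_comp => //; exact: measurable_coord.
rewrite ge0_integral_rVS; last 2 first.
- by apply/measurable_EFinP; apply: mprod.
- by move=> x; rewrite lee_fin; exact: prodr_ge0.
transitivity (\int[leb]_t ((g ord0 t)%:E * (\prod_(i < d) c (lift ord0 i))%:E))%E.
  apply: eq_integral => t _.
  rewrite -(IH (fun i => g (lift ord0 i)))// -ge0_integralZl//.
  - apply: eq_integral => y _; rewrite big_ord_recl consrV0/= -EFinM.
    by congr (_ * _)%:E; apply: eq_bigr => i _; rewrite consrVS.
  - by apply/measurable_EFinP; exact: (mprod _ (fun i => g (lift ord0 i))).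
  - by move=> y _; rewrite lee_fin; exact: prodr_ge0.
  - by rewrite lee_fin.
have ge0 : 0 <= \prod_(i < d) c (lift ord0 i).
  apply: prodr_ge0 => i _; rewrite -lee_fin -gc; apply: integral_ge0 => x _.
  by rewrite lee_fin.
rewrite ge0_integralZr//; first by rewrite gc big_ord_recl EFinM.
- by apply/measurable_EFinP; exact: mg.
- by move=> t _; rewrite lee_fin.
Qed.

Lemma consrVZ d (c : R) (t : R) (y : 'rV[R]_d) : c *: consrV (t, y) = consrV (c * t, c *: y).
Proof.
apply/rowP => i; rewrite mxE; case: (unliftP ord0 i) => [j|] ->.
  by rewrite !consrVS/= mxE.
by rewrite !consrV0.
Qed.

Lemma measurable_scalerV d (c : R) : measurable_fun setT (fun x : 'rV[R]_d => c *: x).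
Proof.
apply: measurable_fun_rV => i; under eq_fun => x do rewrite mxE.
by apply: measurable_funM => //; exact: measurable_coord.
Qed.

Lemma ge0_integral_rV_scale d (c : R) (f : 'rV[R]_d -> \bar R) : 0 < c ->
  measurable_fun setT f -> (forall x, 0 <= f x)%E ->
  (\int[mu d]_x f (c *: x) = (c ^- d)%:E * \int[mu d]_x f x)%E.
Proof.
move=> c0; elim: d f => [|d IH] f mf f0.
  by rewrite !integral_rV0 scaler0 expr0 invr1 mul1e.
rewrite !ge0_integral_rVS//; last first.
  by apply: (measurableT_comp mf); exact: measurable_scalerV.
transitivity (\int[leb]_t ((c ^- d)%:E * \int[mu d]_y f (consrV (c * t, y)%R)))%E.
  apply: eq_integral => t _.
  transitivity (\int[mu d]_y f (consrV (c * t, c *: y)%R))%E.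
    by apply: eq_integral => y _; rewrite consrVZ.
  by rewrite (IH (fun y => f (consrV (c * t, y))))//; exact: measurable_consrV_snd.
pose G (t : R) := (\int[mu d]_y f (consrV (t, y)))%E.
have mG : measurable_fun setT G := measurable_fubini_rV mf f0.
have G0 t : (0 <= G t)%E by exact: integral_ge0.
change ((\int[leb]_t ((c ^- d)%:E * G (c * t)%R) = (c ^- d.+1)%:E * \int[leb]_t G t)%E).
clearbody G.
transitivity ((c ^- d)%:E * \int[leb]_t G (c * t)%R)%E.
  apply: ge0_integralZl => //; last by rewrite lee_fin invr_ge0 exprn_ge0// ltW.
  by apply: (measurableT_comp mG); exact: mulrl_measurable.
by rewrite (ge0_integral_scale c0 mG G0) muleA -EFinM exprSr invfM.
Qed.

Lemma enormZ d (c : R) (x : 'rV[R]_d) : 0 <= c -> enorm (c *: x) = c * enorm x.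
Proof.
move=> c0; rewrite /enorm.
have -> : dotp (c *: x) (c *: x) = c ^+ 2 * dotp x x.
  by rewrite /dotp mulr_sumr; apply: eq_bigr => i _; rewrite !mxE; ring.
by rewrite sqrtrM ?sqr_ge0// sqrtr_sqr ger0_norm.
Qed.

Lemma dotp_ge0 d (x : 'rV[R]_d) : 0 <= dotp x x.
Proof. by apply: sumr_ge0 => i _; rewrite -expr2 sqr_ge0. Qed.

Lemma enorm_sqr d (x : 'rV[R]_d) : enorm x ^+ 2 = dotp x x.
Proof. by rewrite /enorm sqr_sqrtr// dotp_ge0. Qed.

Lemma dotp_consrV d (x y : R) (u v : 'rV[R]_d) :
  dotp (consrV (x, u)) (consrV (y, v)) = x * y + dotp u v.
Proof.
rewrite /dotp big_ord_recl !consrV0; congr (_ + _).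
by apply: eq_bigr => i _; rewrite !consrVS.
Qed.

Lemma consrV_eta d (x : 'rV[R]_d.+1) : x = consrV (x ord0 ord0, \row_i x ord0 (lift ord0 i)).
Proof.
apply/rowP => i; case: (unliftP ord0 i) => [j|] ->; first by rewrite consrVS mxE.
by rewrite consrV0.
Qed.

(** The exceptional set is the box with all sides {0}, of measure zero as soon as there is one
    coordinate; in dimension 0 the measure is the Dirac mass at the origin. *)
Lemma enorm_gt0_ae d : (0 < d)%N -> {ae mu d, forall x, 0 < enorm x}.
Proof.
case: d => // d _; exists [set x : 'rV[R]_d.+1 | forall i, [set 0] (x ord0 i)]; split.
- rewrite (_ : [set x | _] = \bigcap_(i in [set: 'I_d.+1])
      ((fun x : 'rV[R]_d.+1 => x ord0 i) @^-1` [set 0])); last first.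
    by apply/seteqP; split => x /= h i => [_|]; exact: h.
  apply: fin_bigcap_measurable => // i _; rewrite -[X in measurable X]setTI.
  exact: measurable_coord.
- rewrite (lebesgue_rV_box (A := fun=> [set 0]))// big_ord_recl.
  by rewrite lebesgue_measure_set1 mul0e.
- move=> x /= /negP; rewrite -leNgt => x0 i.
  have : dotp x x <= 0 by rewrite -sqrtr_eq0 eq_le sqrtr_ge0 andbT; exact: x0.
  have -> : dotp x x = \sum_i x ord0 i ^+ 2 by apply: eq_bigr => j _; rewrite expr2.
  move=> s0.
  have : \sum_i x ord0 i ^+ 2 == 0 by rewrite eq_le s0 sumr_ge0// => j _; rewrite sqr_ge0.
  rewrite psumr_eq0 => [/allP /(_ i)|j _]; last exact: sqr_ge0.
  by rewrite mem_index_enum => /(_ isT); rewrite sqrf_eq0 => /eqP.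
Qed.

End lebesgue_space.

(** * Polar coordinates *)

Section log_coordinates.
Context {R : realType}.
Local Notation leb := (@lebesgue_measure R).

(* Evaluate the double integral of F (N x * e^s) * e^(d s) * H (N x) * (N x)^d
   in both orders: only the homogeneity of N under the measure is used. *)
Lemma homogeneous_integral_exchange (disp : measure_display) (T : measurableType disp)
    (m : {sigma_finite_measure set T -> \bar R}) (N : T -> R) (d : nat) (F H : R -> R) :
  measurable_fun setT N ->
  (forall c (H : R -> R), 0 < c -> measurable_fun setT H -> (forall t, 0 <= H t) ->
    (\int[m]_x (H (c * N x)%R)%:E = (c ^- d)%:E * \int[m]_x (H (N x))%:E)%E) ->
  measurable_fun setT F -> measurable_fun setT H ->
  (forall t, 0 <= F t) -> (forall t, 0 <= H t) ->
  (forall t, t <= 0 -> F t = 0) -> (forall t, t <= 0 -> H t = 0) ->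
  (\int[m]_x (F (N x))%:E * \int[leb]_s (H (expR s) * expR (d%:R * s))%:E =
   \int[leb]_s (F (expR s) * expR (d%:R * s))%:E * \int[m]_x (H (N x))%:E)%E.
Proof.
move=> mN hN mF mH F0 H0 Fneg Hneg.
under [X in (_ * X)%E]eq_integral => s _ do rewrite expRM_natl.
pose G t := H t * t ^+ d.
rewrite -[X in (_ * X)%E]/(\int[leb]_s (G (expR s))%:E)%E.
have Gneg t : t <= 0 -> G t = 0 by move=> /Hneg; rewrite /G => ->; rewrite mul0r.
have G0 t : 0 <= G t.
  have [/Gneg ->//|t0] := leP t 0; by rewrite mulr_ge0// exprn_ge0// ltW.
have mG : measurable_fun setT G by apply: measurable_funM.
have mNS : measurable_fun setT (fun z : T * R => N z.1).
  by apply: (measurableT_comp mN); exact: measurable_fst.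
have mE (a : R) : measurable_fun setT (fun z : T * R => expR (a * z.2)).
  apply: (measurableT_comp (@measurable_expR R)).
  by apply: measurable_funM => //; exact: measurable_snd.
(* Integrating [K] first in s, the translation by ln (N x) separates the integral of F(e^s) e^(ds)
   from the factor H(N x). *)
pose K (z : T * R) := (F (N z.1 * expR (1 * z.2)) * expR (d%:R * z.2) * G (N z.1))%:E.
have mK : measurable_fun setT K.
  apply/measurable_EFinP; apply: measurable_funM; last exact: (measurableT_comp mG).
  apply: measurable_funM; last exact: mE.
  by apply: (measurableT_comp mF); apply: measurable_funM => //; exact: mE.
have K0 z : (0 <= K z)%E by rewrite lee_fin mulr_ge0// mulr_ge0 ?expR_ge0//.
(* For fixed s, [L] is what [K] becomes under the dilation by e^(-s); the Jacobian e^(-ds) cancels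
   the factor e^(ds). Integrating [L] first in s, a reflection and a translation then separate the
   two functions the other way. *)
pose L (z : T * R) := (F (N z.1) * G (expR (- 1 * z.2) * N z.1))%:E.
have mL : measurable_fun setT L.
  apply/measurable_EFinP; apply: measurable_funM; first exact: (measurableT_comp mF).
  by apply: (measurableT_comp mG); apply: measurable_funM => //; exact: mE.
have L0 z : (0 <= L z)%E by rewrite lee_fin mulr_ge0.
have mexp a : measurable_fun setT (fun s : R => expR (a * s)).
  by apply: (measurableT_comp (@measurable_expR R)); exact: mulrl_measurable.
have mFe : measurable_fun setT (fun s => F (expR s) * expR (d%:R * s)).
  apply: measurable_funM => //; apply: (measurableT_comp mF); exact: measurable_expR.
have mGe : measurable_fun setT (fun s => G (expR s)).
  by apply: (measurableT_comp mG); exact: measurable_expR.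
transitivity (\int[m]_x \int[leb]_s K (x, s))%E; last first.
  rewrite -ge0_integralZl//; last 3 first.
  - by apply/measurable_EFinP; exact: (measurableT_comp mH).
  - by move=> x _; rewrite lee_fin.
  - by apply: integral_ge0 => s _; rewrite lee_fin mulr_ge0 ?expR_ge0//.
  apply: eq_integral => x _; have [x0|x0] := leP (N x) 0.
    rewrite Hneg// mule0 integral0_eq// => s _.
    by rewrite /K/= Gneg// mulr0.
  rewrite -(@ge0_integral_shift _ (ln (N x)) (fun s => (F (expR s) * expR (d%:R * s))%:E))//; last 2 first.
  - exact/measurable_EFinP.
  - by move=> s; rewrite lee_fin mulr_ge0 ?expR_ge0//.
  rewrite -ge0_integralZr//; last 3 first.
  - apply/measurable_EFinP; apply: (measurableT_comp mFe); exact: measurable_funD.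
  - by move=> s _; rewrite lee_fin mulr_ge0 ?expR_ge0//.
  - by rewrite lee_fin.
  apply: eq_integral => s _; rewrite /K/= mul1r -EFinM; congr EFin.
  rewrite expRD lnK ?posrE// mulrDr expRD (expRM_natl _ (ln _)) lnK ?posrE// (mulrC (N x)).
  by rewrite /G; ring.
rewrite fubini_tonelli//.
transitivity (\int[leb]_s \int[m]_x L (x, s))%E; last first.
  apply: eq_integral => s _.
  have := hN (expR s) (fun t => F t * G (expR (- s) * t)) (expR_gt0 s).
  move=> /(_ _ _)/esym h; rewrite /L/=.
  rewrite (eq_integral (fun x => (F (N x) * G (expR (- s) * N x))%:E)); last first.
    by move=> x _; rewrite mulN1r.
  have -> : (\int[m]_x (F (N x) * G (expR (- s) * N x))%:E = (expR s ^+ d)%:E *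
      ((expR s ^- d)%:E * \int[m]_x (F (N x) * G (expR (- s) * N x))%:E))%E.
    by rewrite muleA -EFinM mulfV ?mul1e// expf_eq0 expR_eq0 andbF.
  rewrite h; last 2 first.
  - apply: measurable_funM => //; apply: (measurableT_comp mG); exact: mulrl_measurable.
  - by move=> t; rewrite mulr_ge0.
  rewrite -ge0_integralZl//; last 2 first.
  - apply/measurable_EFinP; apply: measurable_funM.
      by apply: (measurableT_comp mF); exact: measurable_funM.
    by apply: (measurableT_comp mG); do 2 (apply: measurable_funM => //).
  - by move=> x _; rewrite lee_fin mulr_ge0.
  apply: eq_integral => x _; rewrite /K/= -EFinM; congr EFin.
  rewrite mulrA (mulrA (expR (- s))) -expRD addNr expR0 !mul1r expRM_natl (mulrC (expR s)).
  by ring.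
rewrite -fubini_tonelli//.
rewrite -ge0_integralZr//; last 3 first.
- by apply/measurable_EFinP; exact: (measurableT_comp mF).
- by move=> x _; rewrite lee_fin.
- by apply: integral_ge0 => s _; rewrite lee_fin.
apply: eq_integral => x _; have [x0|x0] := leP (N x) 0.
  rewrite Fneg// mul0e integral0_eq// => s _.
  by rewrite /L/= Fneg// mul0r.
rewrite -(@ge0_integral_shift _ (ln (N x)) (fun s => (G (expR s))%:E))//; last 2 first.
- exact/measurable_EFinP.
- by move=> s; rewrite lee_fin.
rewrite -ge0_integral_opp//; last 2 first.
- apply/measurable_EFinP; apply: (measurableT_comp mGe); exact: measurable_funD.
- by move=> s; rewrite lee_fin.
rewrite -ge0_integralZl//; last 3 first.
- apply/measurable_EFinP; apply: (measurableT_comp mGe); exact: measurable_funD.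
- by move=> s _; rewrite lee_fin.
- by rewrite lee_fin.
apply: eq_integral => s _; rewrite /L/= -EFinM; congr EFin.
by rewrite expRD lnK ?posrE// mulN1r.
Qed.

End log_coordinates.

Section gamma_polar.
Context {R : realType}.
Local Notation leb := (@lebesgue_measure R).
Local Notation mu d := (@lebesgue_rV R d).

Lemma patch_itv0yE (F : R -> R) t : 0 < t -> (F \_ `]0, +oo[) t = F t.
Proof. by move=> t0; rewrite patchE mem_set//= in_itv/= t0. Qed.

Lemma patch_itv0y0 (F : R -> R) t : t <= 0 -> (F \_ `]0, +oo[) t = 0.
Proof.
move=> t0; rewrite patchE; case: ifPn => //.
by rewrite inE/= in_itv/= andbT ltNge t0.
Qed.

Lemma patch_itv0y_ge0 (F : R -> R) : (forall t, 0 < t -> 0 <= F t) ->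
  forall t, 0 <= (F \_ `]0, +oo[) t.
Proof.
move=> F0 t; have [t0|t0] := leP t 0; first by rewrite patch_itv0y0.
by rewrite patch_itv0yE// F0.
Qed.

Lemma measurable_patch_itv0y (F : R -> R) : measurable_fun setT F ->
  measurable_fun setT (F \_ `]0, +oo[).
Proof. by move=> mF; apply/measurable_restrict => //; exact: measurable_funTS. Qed.

Lemma integral_exponential_right (a : R) : 0 < a ->
  (\int[leb]_s (exponential_pdf a (- s))%:E = 1)%E.
Proof.
move=> a0; rewrite (@ge0_integral_opp _ (fun s => (exponential_pdf a s)%:E)).
- exact: integral_exponential_pdf.
- by apply/measurable_EFinP; exact: measurable_exponential_pdf.
- by move=> s; rewrite lee_fin exponential_pdf_ge0// ltW.
Qed.

(** The substitution t = e^s, obtained from the exchange lemma on the line with N the identity and d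
    = 1. The companion function is the indicator of ]0, 1], for which both integrals equal 1. *)
Lemma ge0_integral_expR (F : R -> R) : measurable_fun setT F ->
  (forall t, 0 < t -> 0 <= F t) ->
  (\int[leb]_(t in `]0%R, +oo[) (F t)%:E = \int[leb]_s (F (expR s) * expR s)%:E)%E.
Proof.
move=> mF F0; pose H := (cst (1 : R)) \_ `]0, 1] : R -> R.
have H0 t : 0 <= H t by apply: restrict_ge0.
have mH : measurable_fun setT H by apply/measurable_restrict.
have Hneg t : t <= 0 -> H t = 0.
  by move=> t0; rewrite /H patchE; case: ifPn => //; rewrite inE/= in_itv/= ltNge t0.
have := @homogeneous_integral_exchange _ _ _ leb id 1 _ _ _ _
  (measurable_patch_itv0y mF) mH (patch_itv0y_ge0 F0) H0 (patch_itv0y0 F) Hneg.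
move=> /(_ (@measurable_id _ _ _)) h.
rewrite integral_mkcond.
transitivity (\int[leb]_t ((F \_ `]0, +oo[) t)%:E)%E.
  by apply: eq_integral => t _; rewrite restrict_EFin.
have intH : (\int[leb]_t (H t)%:E = 1)%E.
  transitivity (\int[leb]_(t in `]0%R, 1%R]) (cst 1) t)%E.
    by rewrite [RHS]integral_mkcond; apply: eq_integral => t _; rewrite /H restrict_EFin.
  by rewrite integral_cst//= lebesgue_measure_itv/= lte_fin ltr01 mul1e oppr0 adde0.
have intHe : (\int[leb]_s (H (expR s) * expR (1%:R * s))%:E = 1)%E.
  rewrite -(@integral_exponential_right 1)//; apply: eq_integral => s _; congr EFin.
  rewrite mul1r /H patchE; have [s0|s0] := leP s 0.
    rewrite mem_set/= ?in_itv/= ?expR_gt0 ?expR_le1//.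
    by rewrite exponential_pdfE ?oppr_ge0// !mul1r mulNr mul1r opprK.
  rewrite memNset/= ?mul0r ?lt0_exponential_pdf ?oppr_lt0//.
  by apply/negP; rewrite in_itv/= expR_gt0/= expR_le1 -ltNge.
move: h; rewrite intH intHe !mule1 => ->.
  by apply: eq_integral => s _; rewrite patch_itv0yE ?expR_gt0// mul1r.
by move=> c G c0 mG G0; rewrite expr1 (@ge0_integral_scale _ c (fun t => (G t)%:E))//; exact/measurable_EFinP.
Qed.

(** Euler's integral after t = e^s, kept as an extended real so that it can appear before its
    finiteness is known. *)
Definition log_gamma_integral (x : R) : \bar R := (\int[leb]_s (expR (x * s - expR s))%:E)%E.

Let measurable_gamma (x : R) : measurable_fun setT (fun s : R => expR (x * s - expR s)).
Proof.
by apply: (measurableT_comp (@measurable_expR R)); apply: measurable_funB.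
Qed.

Lemma GammaE (x : R) : Gamma x = fine (log_gamma_integral x).
Proof.
rewrite /Gamma /Rintegral ge0_integral_expR.
- congr fine; apply: eq_integral => s _; congr EFin.
  rewrite -expRM -mulrA -expRD -expRD; congr expR; ring.
- apply: measurable_funM; first exact: measurable_powR.
  by apply: (measurableT_comp (@measurable_expR R)); exact: oppr_measurable.
- by move=> t t0; rewrite mulr_ge0 ?powR_ge0 ?expR_ge0.
Qed.

(** Combines e^s >= 1 + s^2/2 with (x + 1 - s)^2 >= 0; it bounds the integrand by a multiple of
    e^(-s) on the right half-line. *)
Lemma log_gamma_exponent_le (x s : R) : 0 <= s ->
  x * s - expR s <= (x + 1) ^+ 2 / 2 + - 1 * s.
Proof.
move=> s0; have := expR_ge1Dxn 1 s0; rewrite (_ : 2`! = 2)%N// => h.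
by have := sqr_ge0 (x + 1 - s); lra.
Qed.

(** The integrand is at most C e^(-s) for s >= 0 and at most e^(xs) for s < 0. Both bounds are
    multiples of exponential probability densities, the second one reflected, so the majorant has
    integral C + 1/x. *)
Lemma log_gamma_integral_lty (x : R) : 0 < x -> (log_gamma_integral x < +oo)%E.
Proof.
move=> x0; pose C := expR ((x + 1) ^+ 2 / 2).
pose B (s : R) := C * exponential_pdf 1 s + x^-1 * exponential_pdf x (- s).
have x1 : 0 <= x^-1 by rewrite invr_ge0 ltW.
have mpdf a : measurable_fun setT (fun s : R => exponential_pdf a (- s)).
  by apply: (measurableT_comp (measurable_exponential_pdf a)); exact: oppr_measurable.
have p1 s : 0 <= C * exponential_pdf 1 s by rewrite mulr_ge0 ?expR_ge0 ?exponential_pdf_ge0.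
have p2 s : 0 <= x^-1 * exponential_pdf x (- s) by rewrite mulr_ge0// exponential_pdf_ge0// ltW.
apply: (@le_lt_trans _ _ (\int[leb]_s (B s)%:E)%E).
  apply: ge0_le_integral => //.
  - by apply/measurable_EFinP; exact: measurable_gamma.
  - apply/measurable_EFinP; apply: measurable_funD; apply: measurable_funM => //.
      exact: measurable_exponential_pdf.
    exact: mpdf.
  move=> s _; rewrite lee_fin /B; have [s0|s0] := leP 0 s.
    apply: ler_wpDr => //; rewrite exponential_pdfE// mul1r -expRD ler_expR.
    exact: log_gamma_exponent_le.
  apply: ler_wpDl => //; rewrite exponential_pdfE ?oppr_ge0 ?(ltW s0)//.
  rewrite mulrA mulVf ?gt_eqF// mul1r ler_expR mulrNN.
  by rewrite gerBl expR_ge0.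
under eq_integral => s _ do rewrite EFinD !EFinM.
rewrite ge0_integralD//=; last 4 first.
- by move=> s _; rewrite -EFinM lee_fin.
- by apply/measurable_EFinP; apply: measurable_funM => //; exact: measurable_exponential_pdf.
- by move=> s _; rewrite -EFinM lee_fin.
- by apply/measurable_EFinP; apply: measurable_funM => //; exact: mpdf.
rewrite ge0_integralZl//; last 3 first.
- by apply/measurable_EFinP; exact: measurable_exponential_pdf.
- by move=> s _; rewrite lee_fin exponential_pdf_ge0.
- by rewrite lee_fin expR_ge0.
rewrite ge0_integralZl//; last 2 first.
- by apply/measurable_EFinP; exact: mpdf.
- by move=> s _; rewrite lee_fin exponential_pdf_ge0// ltW.
by rewrite integral_exponential_pdf// integral_exponential_right// !mule1 -EFinD ltry.
Qed.

Lemma log_gamma_integral_gt0 (x : R) : 0 < x -> (0 < log_gamma_integral x)%E.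
Proof.
move=> x0; apply: (@lt_le_trans _ _ (\int[leb]_(s in `[0%R, 1%R]) (cst (expR (- expR 1))%:E) s)%E).
  rewrite integral_cst//= lebesgue_measure_itv/= lte_fin ltr01 oppr0 adde0 mule1.
  by rewrite lte_fin expR_gt0.
apply: (@le_trans _ _ (\int[leb]_(s in `[0%R, 1%R]) (expR (x * s - expR s))%:E)%E).
  apply: ge0_le_integral => //.
  - by move=> s _; rewrite lee_fin expR_ge0.
  - by apply/measurable_EFinP; apply: measurable_funTS; exact: measurable_gamma.
  - move=> s /=; rewrite in_itv/= => /andP[s0 s1]; rewrite lee_fin ler_expR.
    by apply: ler_wpDl; [apply: mulr_ge0 => //; exact: ltW|rewrite lerN2 ler_expR].
by apply: ge0_subset_integral => //; apply/measurable_EFinP; exact: measurable_gamma.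
Qed.

Lemma log_gamma_integralE (x : R) : 0 < x -> log_gamma_integral x = (Gamma x)%:E.
Proof.
move=> x0; rewrite GammaE fineK// ge0_fin_numE ?log_gamma_integral_lty//.
exact/ltW/log_gamma_integral_gt0.
Qed.

Lemma Gamma_gt0 (x : R) : 0 < x -> 0 < Gamma x.
Proof. by move=> x0; rewrite -lte_fin -log_gamma_integralE// log_gamma_integral_gt0. Qed.

Lemma integral_gauss_scaled (a : R) : 0 < a ->
  (\int[leb]_t (expR (- a * t ^+ 2))%:E = (Num.sqrt (pi / a))%:E)%E.
Proof.
move=> a0.
transitivity (\int[leb]_t (gauss_fun (Num.sqrt a * t))%:E)%E.
  apply: eq_integral => t _; rewrite /gauss_fun exprMn sqr_sqrtr ?ltW//.
  by rewrite mulNr.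
rewrite (@ge0_integral_scale _ _ (fun t => (gauss_fun t)%:E)) ?sqrtr_gt0//.
- by rewrite integralT_gauss -EFinM sqrtrM ?pi_ge0// sqrtrV ?ltW// mulrC.
- by apply/measurable_EFinP; exact: measurable_gauss_fun.
- by move=> t; rewrite lee_fin gauss_fun_ge0.
Qed.

Lemma measurable_gauss (a : R) : measurable_fun setT (fun t : R => expR (- a * t ^+ 2)).
Proof.
apply: (measurableT_comp (@measurable_expR R)); apply: measurable_funM => //.
Qed.

Lemma integral_gauss_rV d (a : R) : 0 < a ->
  (\int[mu d]_x (expR (- a * dotp x x))%:E = (Num.sqrt (pi / a) ^+ d)%:E)%E.
Proof.
move=> a0; rewrite -[in RHS](card_ord d) -prodr_const.
rewrite -(@ge0_integral_rV_prod _ d (fun _ t => expR (- a * t ^+ 2)))//.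
- apply: eq_integral => x _; rewrite -expR_sum; congr (expR _)%:E.
  by rewrite /dotp mulr_sumr; apply: eq_bigr => i _; rewrite expr2.
- by move=> _; exact: measurable_gauss.
- by move=> _; exact: integral_gauss_scaled.
Qed.

Lemma sqrt_expr_powR (a : R) d : 0 <= a -> Num.sqrt a ^+ d = a `^ (d%:R / 2).
Proof.
by move=> a0; rewrite -powR12_sqrt// -powR_mulrn ?powR_ge0// -powRrM mulrC.
Qed.

(** The exchange lemma says that the ratio of the two integrals does not depend on [F]. Testing with
    e^(-t^2) fixes it: the integral over R^d is pi^(d/2), and the one over s is Gamma(d/2)/2. *)
Lemma ge0_integral_polar d (F : R -> R) : (0 < d)%N -> measurable_fun setT F ->
  (forall t, 0 <= F t) ->
  (\int[mu d]_x (F (enorm x))%:E =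
   (2 * pi `^ (d%:R / 2) / Gamma (d%:R / 2))%:E *
   \int[leb]_s (F (expR s) * expR (d%:R * s))%:E)%E.
Proof.
move=> d0 mF F0.
have d2 : 0 < d%:R / 2 :> R by rewrite divr_gt0// ltr0n.
pose g (t : R) := expR (- 1 * t ^+ 2).
have mg : measurable_fun setT g by exact: measurable_gauss.
have g0 t : 0 <= g t by exact: expR_ge0.
(* The exchange lemma wants functions vanishing for t <= 0. Truncating them there changes no
   integral, since the Euclidean norm is positive almost everywhere. *)
have aeE (G : R -> R) : measurable_fun setT G -> (forall t, 0 <= G t) ->
    (\int[mu d]_x ((G \_ `]0, +oo[) (enorm x))%:E = \int[mu d]_x (G (enorm x))%:E)%E.
  move=> mG G0; apply: ge0_ae_eq_integral => //.
  - apply/measurable_EFinP; apply: (measurableT_comp (measurable_patch_itv0y mG)).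
    exact: measurable_enorm.
  - by apply/measurable_EFinP; apply: (measurableT_comp mG); exact: measurable_enorm.
  - by move=> x _; rewrite lee_fin; exact: patch_itv0y_ge0.
  - by move=> x _; rewrite lee_fin.
  - have := @enorm_gt0_ae R d d0; apply: filterS => x x0 _.
    by rewrite patch_itv0yE.
have logE (G : R -> R) : (\int[leb]_s ((G \_ `]0, +oo[) (expR s) * expR (d%:R * s))%:E =
    \int[leb]_s (G (expR s) * expR (d%:R * s))%:E)%E.
  by apply: eq_integral => s _; rewrite patch_itv0yE// expR_gt0.
have hscale c (H : R -> R) : 0 < c -> measurable_fun setT H -> (forall t, 0 <= H t) ->
    (\int[mu d]_x (H (c * enorm x)%R)%:E = (c ^- d)%:E * \int[mu d]_x (H (enorm x))%:E)%E.
  move=> c0 mH H0.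
  rewrite -(@ge0_integral_rV_scale _ d c (fun x => (H (enorm x))%:E))//.
  - by apply: eq_integral => x _; rewrite enormZ// ltW.
  - by apply/measurable_EFinP; apply: (measurableT_comp mH); exact: measurable_enorm.
  - by move=> x; rewrite lee_fin.
have := @homogeneous_integral_exchange _ _ _ (mu d) (@enorm R d) d _ _ (@measurable_enorm R d) _
  (measurable_patch_itv0y mF) (measurable_patch_itv0y mg)
  (patch_itv0y_ge0 (fun t _ => F0 t)) (patch_itv0y_ge0 (fun t _ => g0 t))
  (patch_itv0y0 F) (patch_itv0y0 g).
rewrite !aeE// !logE => /(_ hscale).
have -> : (\int[mu d]_x (g (enorm x))%:E = (pi `^ (d%:R / 2))%:E)%E.
  rewrite -sqrt_expr_powR ?pi_ge0// -[pi in RHS]divr1 -integral_gauss_rV//.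
  by apply: eq_integral => x _; rewrite /g enorm_sqr.
have -> : (\int[leb]_s (g (expR s) * expR (d%:R * s))%:E = (2^-1 * Gamma (d%:R / 2))%:E)%E.
  rewrite EFinM -log_gamma_integralE//.
  rewrite -(@ge0_integral_scale _ 2 (fun s => (expR (d%:R / 2 * s - expR s))%:E))//.
  - apply: eq_integral => s _; rewrite /g -expRD; congr (expR _)%:E.
    by rewrite mulN1r -expRM_natl; field.
  - by apply/measurable_EFinP; exact: measurable_gamma.
have G0 := Gamma_gt0 d2.
move=> h.
transitivity ((2 / Gamma (d%:R / 2))%:E *
    (\int[mu d]_x (F (enorm x))%:E * (2^-1 * Gamma (d%:R / 2))%:E))%E.
  rewrite muleCA -EFinM (_ : 2 / _ * _ = 1) ?mule1//.
  by field; rewrite gt_eqF.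
by rewrite h muleCA -EFinM muleC mulrAC.
Qed.

End gamma_polar.

(** * Fourier integrals of Gaussians *)

Section gauss_cosine.
Context {R : realType}.
Local Notation leb := (@lebesgue_measure R).

Lemma integrable_gauss_dominated (f : R -> R) (C a : R) : 0 < a ->
  measurable_fun setT f -> (forall t, `|f t| <= C * expR (- a * t ^+ 2)) ->
  leb.-integrable setT (EFin \o f).
Proof.
move=> a0 mf fC.
have ig : leb.-integrable setT (fun t => (C%:E * (expR (- a * t ^+ 2))%:E)%E).
  apply: integrableZl => //; apply/integrableP; split.
    by apply/measurable_EFinP; exact: measurable_gauss.
  under eq_integral => t _ do rewrite gee0_abs ?lee_fin ?expR_ge0//.
  by rewrite integral_gauss_scaled// ltry.
apply: le_integrable ig => //; first by apply/measurable_EFinP.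
move=> t _; rewrite lee_fin; apply: (le_trans (fC t)).
by rewrite ler_norm.
Qed.

Lemma integrableZl_EFin (disp : measure_display) (T : measurableType disp)
    (m : {measure set T -> \bar R}) (c : R) (f : T -> R) :
  m.-integrable setT (EFin \o f) -> m.-integrable setT (EFin \o (fun x => c * f x)).
Proof.
move=> h; have := integrableZl measurableT c h.
by apply: eq_integrable => // x _.
Qed.

Lemma Rintegral_shift (f : R -> R) (b : R) : measurable_fun setT f ->
  \int[leb]_t f (t + b) = \int[leb]_t f t.
Proof.
move=> mf; rewrite /Rintegral; congr fine.
have mE : measurable_fun setT (EFin \o f) by exact/measurable_EFinP.
rewrite [LHS]integralE [RHS]integralE; congr (_ - _)%E.
- rewrite -(@ge0_integral_shift _ b ((EFin \o f)^\+)%E)//; last exact: measurable_funepos mE.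
  by apply: eq_integral => t _; rewrite !funeposE.
- rewrite -(@ge0_integral_shift _ b ((EFin \o f)^\-)%E)//; last exact: measurable_funeneg mE.
  by apply: eq_integral => t _; rewrite !funenegE.
Qed.

Lemma norm_le_expR_sqr (t : R) : `|t| <= expR (t ^+ 2 / 2).
Proof.
apply: le_trans (expR_ge1Dx _); rewrite -real_normK ?num_real//.
by have := sqr_ge0 (`|t| - 1); lra.
Qed.

Lemma is_derive_affine (k th t : R) : is_derive t 1 (fun t : R => k * t + th) k.
Proof. by apply: is_derive_eq; rewrite /GRing.scale/= mulr1 addr0. Qed.

Lemma is_derive_gauss (t : R) :
  is_derive t 1 (fun t : R => expR (- 1 * t ^+ 2)) (- 2 * t * expR (- 1 * t ^+ 2)).
Proof.
have h : is_derive t 1 (fun t : R => - 1 * t ^+ 2) (- 2 * t).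
  by apply: is_derive_eq; rewrite /GRing.scale/=; ring.
have h' := @is_derive1_comp R expR _ t _ _ (is_derive_expR _) h.
by apply: (is_derive_eq h'); ring.
Qed.

(** A majorant uniform in the shift: half of the Gaussian exponent absorbs the growth of [v], and
    (t+b)^2/2 >= t^2/4 - 1/2 for |b| <= 1, because (t+2b)^2 >= 0. *)
Lemma gauss_shift_le (K v t b : R) : `|b| <= 1 -> 0 <= K ->
  `|v| <= K * expR ((t + b) ^+ 2 / 2) ->
  `|expR (- 1 * (t + b) ^+ 2) * v| <= K * expR (1 / 2) * expR (- (1 / 4) * t ^+ 2).
Proof.
move=> b1 K0 vK; rewrite normrM ger0_norm ?expR_ge0//.
apply: (le_trans (ler_wpM2l (expR_ge0 _) vK)).
rewrite mulrCA -mulrA ler_wpM2l// -!expRD ler_expR.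
have b2 : b ^+ 2 <= 1 by rewrite -real_normK ?num_real// expr_le1.
by have := sqr_ge0 (t + 2 * b); lra.
Qed.

(* The derivative under the integral of the constant map
   b |-> int e^(-(t+b)^2) sin (k (t+b) + th) vanishes. *)
Lemma gauss_sine_by_parts (k th : R) :
  \int[leb]_t (expR (- 1 * t ^+ 2) * (k * cos (k * t + th) - 2 * t * sin (k * t + th))) = 0.
Proof.
pose g (t : R) := expR (- 1 * t ^+ 2) * sin (k * t + th).
pose dg (t : R) := expR (- 1 * t ^+ 2) * (k * cos (k * t + th) - 2 * t * sin (k * t + th)).
have isd (t : R) : is_derive t 1 g (dg t).
  have h2 := @is_derive1_comp R sin _ t _ _ (is_derive_sin _) (is_derive_affine k th t).
  apply: (is_derive_eq (is_deriveM (is_derive_gauss t) h2)).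
  by rewrite /dg /GRing.scale/=; ring.
have mg : measurable_fun setT g.
  by apply: continuous_measurable_fun => t; apply/differentiable_continuous/derivable1_diffP; exact: ex_derive.
pose f (b t : R) := g (t + b).
have isf (t b : R) : is_derive b 1 (f ^~ t) (dg (t + b)).
  have h : is_derive b 1 (fun b : R => t + b) 1.
    rewrite (_ : (fun b : R => _) = (fun b : R => 1 * b + t)); first exact: is_derive_affine.
    by apply/funext => x; rewrite mul1r addrC.
  have := @is_derive1_comp R g _ b _ _ (isd (t + b)) h.
  by move=> h'; apply: (is_derive_eq h'); rewrite mulr1.
pose C := (`|k| + 2) * expR (1 / 2).
have expge1 (s : R) : 1 <= expR (s ^+ 2 / 2).
  by rewrite -[leLHS]expR0 ler_expR divr_ge0// sqr_ge0.
have gle (b t : R) : `|b| <= 1 -> `|g (t + b)| <= C * expR (- (1 / 4) * t ^+ 2).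
  move=> b1; apply: gauss_shift_le => //.
  apply: (le_trans (sin_max _)); apply: (le_trans (expge1 (t + b))).
  by rewrite ler_peMl ?expR_ge0//; have := normr_ge0 k; lra.
have dgle (b t : R) : `|b| <= 1 -> `|dg (t + b)| <= C * expR (- (1 / 4) * t ^+ 2).
  move=> b1; apply: gauss_shift_le => //.
  apply: (le_trans (ler_normB _ _)); rewrite !normrM mulrDl lerD//.
    by apply: ler_pM => //; exact: le_trans (cos_max _) (expge1 _).
  rewrite ger0_norm// -mulrA ler_wpM2l// -[leRHS]mulr1 ler_pM//.
    exact: norm_le_expR_sqr.
  exact: sin_max.
have C0 : 0 <= C by rewrite mulr_ge0 ?expR_ge0.
have quarter : 0 < 1 / 4 :> R by lra.
have I01 (b : R) : (`]-1, 1[%classic : set R) b -> `|b| <= 1.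
  by rewrite /= in_itv/= -ltr_norml => /ltW.
have mgb (b : R) : measurable_fun setT (f b).
  by apply: (measurableT_comp mg); exact: measurable_funD.
have := @differentiation_under_integral R _ _ leb f setT measurableT 0 (-1) 1 _ _ _
  (fun t => C * expR (- (1 / 4) * t ^+ 2)) _ _ _.
have -> : (fun b => \int[leb]_(t in setT) f b t) = cst (\int[leb]_(t in setT) g t).
  by apply/funext => b; rewrite /f Rintegral_shift.
rewrite derive1_cst => /(_ _ _ _ _ _ _)/esym h.
transitivity (\int[leb]_t partial1of2 f 0 t).
  apply: eq_Rintegral => t _; rewrite partial1of2E.
  by have [_ ->] := isf t 0; rewrite addr0.
apply: h.
- by rewrite /= in_itv/= ltrN10 ltr01.
- by move=> b /I01 b1; apply: (@integrable_gauss_dominated _ C (1 / 4)) => // t; exact: gle.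
- by move=> b t _ _; have [] := isf t b.
- by move=> t; rewrite mulr_ge0 ?expR_ge0.
- apply: (@integrable_gauss_dominated _ C (1 / 4)) => //.
    by apply: measurable_funM => //; exact: measurable_gauss.
  by move=> t; rewrite ger0_norm// mulr_ge0 ?expR_ge0.
- move=> b t /I01 b1 _; rewrite partial1of2E.
  by have [_ ->] := isf t b; exact: dgle.
Qed.

(** As a function of [k] the integral solves P' = -(k/2) P, so P(k) e^(k^2/4) is constant and equals
    its value at 0. *)
Lemma Rintegral_gauss_cos (k th : R) :
  \int[leb]_t (expR (- 1 * t ^+ 2) * cos (k * t + th)) =
  Num.sqrt pi * expR (- (k ^+ 2 / 4)) * cos th.
Proof.
pose f (k t : R) := expR (- 1 * t ^+ 2) * cos (k * t + th).
pose df (k t : R) := expR (- 1 * t ^+ 2) * (- (t * sin (k * t + th))).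
have isf (t b : R) : is_derive b 1 (f ^~ t) (df b t).
  have h : is_derive b 1 (fun b : R => b * t + th) t.
    by apply: is_derive_eq; rewrite /GRing.scale/=; ring.
  have h2 := @is_derive1_comp R cos _ b _ _ (is_derive_cos _) h.
  apply: (is_derive_eq (is_deriveM (is_derive_cst (expR (- 1 * t ^+ 2)) b 1) h2)).
  by rewrite /df /GRing.scale/=; ring.
have isdt (b t : R) : is_derive t 1 (f b)
    (expR (- 1 * t ^+ 2) * (- 2 * t * cos (b * t + th) - b * sin (b * t + th))).
  have h2 := @is_derive1_comp R cos _ t _ _ (is_derive_cos _) (is_derive_affine b th t).
  apply: (is_derive_eq (is_deriveM (is_derive_gauss t) h2)).
  by rewrite /GRing.scale/=; ring.
have mf b : measurable_fun setT (f b).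
  by apply: continuous_measurable_fun => t; apply/differentiable_continuous/derivable1_diffP; exact: ex_derive.
have mtrig (F : R -> R) b : measurable_fun setT F -> measurable_fun setT (fun t : R => F (b * t + th)).
  by move=> mF; apply: (measurableT_comp mF); apply: measurable_funD => //.
have msin b : measurable_fun setT (fun t : R => sin (b * t + th)).
  by apply: mtrig; apply: continuous_measurable_fun; exact: continuous_sin.
have fle b t : `|f b t| <= 1 * expR (- 1 * t ^+ 2).
  by rewrite /f normrM ger0_norm ?expR_ge0// mulrC ler_wpM2r ?expR_ge0// cos_max.
have fint b : leb.-integrable setT (EFin \o f b).
  by apply: (@integrable_gauss_dominated _ 1 1) => // t; exact: fle.
have dfle b t : `|df b t| <= 1 * expR (- (1 / 2) * t ^+ 2).
  rewrite /df normrM ger0_norm ?expR_ge0// normrN normrM mul1r.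
  apply: (@le_trans _ _ (expR (- 1 * t ^+ 2) * (expR (t ^+ 2 / 2) * 1))).
    rewrite ler_wpM2l ?expR_ge0// ler_pM//; first exact: norm_le_expR_sqr.
    exact: sin_max.
  by rewrite mulr1 -expRD ler_expR; lra.
have half : 0 < 1 / 2 :> R by lra.
have dfint b : leb.-integrable setT (EFin \o df b).
  apply: (@integrable_gauss_dominated _ 1 (1 / 2)) => //.
  apply: measurable_funM; first exact: measurable_gauss.
  by apply: measurable_funN; exact: measurable_funM.
pose P b := \int[leb]_(t in setT) f b t.
have isP (b : R) : is_derive b 1 P (- (b / 2) * P b).
  have hI : (`]b - 1, b + 1[%classic : set R) b by rewrite /= in_itv/=; apply/andP; split; lra.
  have intG : leb.-integrable setT (EFin \o (fun t => 1 * expR (- (1 / 2) * t ^+ 2))).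
    apply: (@integrable_gauss_dominated _ 1 (1 / 2)) => //.
      by apply: measurable_funM => //; exact: measurable_gauss.
    by move=> t; rewrite ger0_norm// mul1r expR_ge0.
  have hu x t : (`]b - 1, b + 1[%classic : set R) x -> setT t ->
      `|partial1of2 f x t| <= 1 * expR (- (1 / 2) * t ^+ 2).
    by move=> _ _; rewrite partial1of2E; have [_ ->] := isf t x; exact: dfle.
  have hd x t : (`]b - 1, b + 1[%classic : set R) x -> setT t -> derivable (f^~ t) x 1.
    by move=> _ _; have [] := isf t x.
  have hG (t : R) : 0 <= 1 * expR (- (1 / 2) * t ^+ 2) by rewrite mul1r expR_ge0.
  have D := @derivable_under_integral R _ _ leb f setT measurableT b (b - 1) (b + 1) hI
    (fun x _ => fint x) hd _ hG intG hu.
  have E := @differentiation_under_integral R _ _ leb f setT measurableT b (b - 1) (b + 1) hI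
    (fun x _ => fint x) hd _ hG intG hu.
  apply: DeriveDef => //; rewrite -derive1E E.
  transitivity (\int[leb]_t df b t).
    by apply: eq_Rintegral => t _; rewrite partial1of2E; have [_ ->] := isf t b.
  (* The integrand of that identity is b f + 2 df, so it reads b P(b) + 2 P'(b) = 0. *)
  have := gauss_sine_by_parts b th.
  rewrite (@eq_Rintegral _ _ _ leb setT (fun t => b * f b t + 2 * df b t)); last first.
    by move=> t _; rewrite /f /df; ring.
  rewrite RintegralD//; last 2 first.
  - exact: integrableZl_EFin.
  - exact: integrableZl_EFin.
  rewrite !RintegralZl// -/(P b) => h; lra.
pose Q b := P b * expR (b ^+ 2 / 4).
have QE : forall b, Q b = Q 0.
  move=> b; apply: is_derive_0_is_cst => {}b.
  have h : is_derive b 1 (fun b : R => b ^+ 2 / 4) (b / 2).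
    by apply: is_derive_eq; rewrite /GRing.scale/=; field.
  have h2 := @is_derive1_comp R expR _ b _ _ (is_derive_expR _) h.
  apply: (is_derive_eq (is_deriveM (isP b) h2)).
  by rewrite /GRing.scale/=; ring.
have P0 : P 0 = Num.sqrt pi * cos th.
  rewrite /P (@eq_Rintegral _ _ _ leb setT (fun t => cos th * expR (- 1 * t ^+ 2))); last first.
    by move=> t _; rewrite /f mul0r add0r mulrC.
  rewrite RintegralZl//; last first.
    apply: (@integrable_gauss_dominated _ 1 1) => //; first exact: measurable_gauss.
    by move=> t; rewrite mul1r ger0_norm ?expR_ge0.
  by rewrite /Rintegral integral_gauss_scaled// divr1 mulrC.
have := QE k; rewrite /Q P0 expr0n/= mul0r expR0 mulr1 => h.
rewrite -/(P k) expRN mulrAC -h -mulrA mulfV ?mulr1//.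
by rewrite gt_eqF// expR_gt0.
Qed.

End gauss_cosine.

Section gauss_rV.
Context {R : realType}.
Local Notation leb := (@lebesgue_measure R).
Local Notation mu d := (@lebesgue_rV R d).

Lemma one_plus_cos_ge0 (B t : R) : 0 <= B <= 1 -> 0 <= 1 + B * cos t.
Proof.
move=> /andP[B0 B1]; have := ler_wpM2l B0 (cos_geN1 t); lra.
Qed.

(** Bounding [B] by 1 keeps the integrand nonnegative, so that the formula can be iterated over
    coordinates by Tonelli alone. *)
Lemma integral_gauss_cos (a B k th : R) : 0 < a -> 0 <= B <= 1 ->
  (\int[leb]_t (expR (- a * t ^+ 2) * (1 + B * cos (k * t + th)))%:E =
   (Num.sqrt (pi / a) * (1 + B * expR (- (k ^+ 2 / (4 * a))) * cos th))%:E)%E.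
Proof.
move=> a0 B01; have a1 : 0 < Num.sqrt a by rewrite sqrtr_gt0.
pose k' := k / Num.sqrt a.
have mcos : measurable_fun setT (fun t : R => cos (k' * t + th)).
  apply: (measurableT_comp (continuous_measurable_fun (@continuous_cos R))).
  by apply: measurable_funD.
have igauss : leb.-integrable setT (EFin \o (fun t => expR (- 1 * t ^+ 2))).
  apply: (@integrable_gauss_dominated _ _ 1 1) => //; first exact: measurable_gauss.
  by move=> t; rewrite mul1r ger0_norm ?expR_ge0.
have icos : leb.-integrable setT (EFin \o (fun t => expR (- 1 * t ^+ 2) * cos (k' * t + th))).
  apply: (@integrable_gauss_dominated _ _ 1 1) => //.
    by apply: measurable_funM => //; exact: measurable_gauss.
  by move=> t; rewrite normrM ger0_norm ?expR_ge0// mulrC ler_wpM2r ?expR_ge0// cos_max.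
have main : (\int[leb]_t (expR (- 1 * t ^+ 2) * (1 + B * cos (k' * t + th)))%:E =
   (Num.sqrt pi * (1 + B * expR (- (k' ^+ 2 / 4)) * cos th))%:E)%E.
  have h : leb.-integrable setT (EFin \o (fun t => expR (- 1 * t ^+ 2) * (1 + B * cos (k' * t + th)))).
    have := integrableD measurableT igauss (integrableZl_EFin B icos).
    by apply: eq_integrable => // t _ /=; rewrite -EFinD; congr EFin; ring.
  rewrite -(fineK (integrable_fin_num measurableT h)); congr EFin.
  transitivity (\int[leb]_t (expR (- 1 * t ^+ 2) + B * (expR (- 1 * t ^+ 2) * cos (k' * t + th)))).
    by apply: eq_Rintegral => t _; ring.
  rewrite RintegralD//; last exact: integrableZl_EFin.
  rewrite RintegralZl// Rintegral_gauss_cos /Rintegral integral_gauss_scaled//= divr1.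
  ring.
pose G (t : R) := (expR (- 1 * t ^+ 2) * (1 + B * cos (k' * t + th)))%:E.
transitivity (\int[leb]_t G (Num.sqrt a * t)%R)%E.
  apply: eq_integral => t _; congr EFin; rewrite exprMn sqr_sqrtr ?ltW//.
  rewrite mulN1r mulNr (_ : k' * _ = k * t)//.
  by rewrite /k'; field; rewrite gt_eqF.
rewrite (@ge0_integral_scale _ _ G)//; last 2 first.
- apply/measurable_EFinP; apply: measurable_funM; first exact: measurable_gauss.
  by apply: measurable_funD => //; exact: measurable_funM.
- by move=> t; rewrite lee_fin mulr_ge0 ?expR_ge0// one_plus_cos_ge0.
rewrite main -EFinM; congr EFin.
rewrite mulrA sqrtrM ?pi_ge0// sqrtrV ?ltW// [in RHS](mulrC _ (_^-1)).
congr (_ * (1 + _ * expR (- _) * _)).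
by rewrite /k' exprMn exprVn sqr_sqrtr ?ltW//; field; rewrite gt_eqF.
Qed.

Lemma measurable_gauss_rV d (a : R) :
  measurable_fun setT (fun x : 'rV[R]_d => expR (- a * dotp x x)).
Proof.
apply: (measurableT_comp (@measurable_expR R)); apply: measurable_funM => //.
exact: measurable_dotp.
Qed.

Lemma measurable_cos_dotp d (k : 'rV[R]_d) (th : R) :
  measurable_fun setT (fun x : 'rV[R]_d => cos (dotp x k + th)).
Proof.
apply: (measurableT_comp (continuous_measurable_fun (@continuous_cos R))).
by apply: measurable_funD => //; exact: measurable_dotp.
Qed.

(** The induction needs a general amplitude and phase: integrating out all but one coordinate
    multiplies [B] by a Gaussian factor at most 1, while the remaining coordinate adds k0 t to the
    phase. *)
Lemma integral_gauss_cos_rV d (a B th : R) (k : 'rV[R]_d) : 0 < a -> 0 <= B <= 1 ->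
  (\int[mu d]_x (expR (- a * dotp x x) * (1 + B * cos (dotp x k + th)))%:E =
   (Num.sqrt (pi / a) ^+ d * (1 + B * expR (- (dotp k k / (4 * a))) * cos th))%:E)%E.
Proof.
move=> a0; elim: d B th k => [|d IH] B th k B01.
  rewrite integral_rV0 /dotp !big_ord0 mulr0 expR0 expr0 add0r mul0r oppr0 expR0.
  by rewrite mulr1.
rewrite ge0_integral_rVS; last 2 first.
- apply/measurable_EFinP; apply: measurable_funM; first exact: measurable_gauss_rV.
  by apply: measurable_funD => //; apply: measurable_funM => //; exact: measurable_cos_dotp.
- by move=> x; rewrite lee_fin mulr_ge0 ?expR_ge0// one_plus_cos_ge0.
rewrite (consrV_eta k); move: (k ord0 ord0) (\row_i _) => k0 k'.
pose B' := B * expR (- (dotp k' k' / (4 * a))).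
have B'01 : 0 <= B' <= 1.
  move: B01 => /andP[B0 B1]; rewrite /B' mulr_ge0 ?expR_ge0//= mulr_ile1 ?expR_ge0//.
  by rewrite expR_le1 oppr_le0 divr_ge0 ?dotp_ge0// mulr_ge0// ltW.
transitivity (\int[leb]_t ((Num.sqrt (pi / a) ^+ d)%:E *
    (expR (- a * t ^+ 2) * (1 + B' * cos (k0 * t + th)))%:E))%E.
  apply: eq_integral => t _.
  transitivity ((expR (- a * t ^+ 2))%:E *
    \int[mu d]_y (expR (- a * dotp y y) * (1 + B * cos (dotp y k' + (k0 * t + th))))%:E)%E.
    rewrite -ge0_integralZl//; last 2 first.
    - apply/measurable_EFinP; apply: measurable_funM; first exact: measurable_gauss_rV.
      by apply: measurable_funD => //; apply: measurable_funM => //; exact: measurable_cos_dotp.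
    - by move=> x _; rewrite lee_fin mulr_ge0 ?expR_ge0// one_plus_cos_ge0.
    apply: eq_integral => y _; rewrite !dotp_consrV -EFinM mulrA -expRD; congr (expR _ * _)%:E.
      by ring.
    by congr (1 + _ * cos _); ring.
  by rewrite IH// -!EFinM; congr EFin; rewrite /B'; ring.
rewrite ge0_integralZl//; last 2 first.
- apply/measurable_EFinP; apply: measurable_funM; first exact: measurable_gauss.
  apply: measurable_funD => //; apply: measurable_funM => //.
  apply: (measurableT_comp (continuous_measurable_fun (@continuous_cos R))).
  exact: measurable_funD.
- by move=> t _; rewrite lee_fin mulr_ge0 ?expR_ge0// one_plus_cos_ge0.
rewrite integral_gauss_cos// -EFinM; congr EFin.
rewrite mulrA; congr (_ * (1 + _ * _)); first by rewrite -exprSr.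
rewrite /B' -mulrA -expRD; congr (_ * expR _).
by rewrite dotp_consrV; field; rewrite gt_eqF.
Qed.

Lemma gauss_square_completion (a m t y : R) : 0 <= a -> 0 < m ->
  a * t ^+ 2 + m * (t - y) ^+ 2 =
  (a + m) * (t - m * y / (a + m)) ^+ 2 + a * m / (a + m) * y ^+ 2.
Proof. by move=> a0 m0; field; rewrite gt_eqF// ltr_wpDl. Qed.

(** Both Gaussians factor over the coordinates, and completing the square treats each factor. The
    case a = 0 is included because it yields the total mass of a shifted Gaussian. *)
Lemma integral_gauss_convolution d (a m : R) (y : 'rV[R]_d) : 0 <= a -> 0 < m ->
  (\int[mu d]_x (expR (- a * dotp x x) * expR (- m * dotp (x - y) (x - y)))%:E =
   (Num.sqrt (pi / (a + m)) ^+ d * expR (- (a * m / (a + m)) * dotp y y))%:E)%E.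
Proof.
move=> a0 m0; have am0 : 0 < a + m by rewrite ltr_wpDl.
pose g (i : 'I_d) t := expR (- a * t ^+ 2) * expR (- m * (t - y ord0 i) ^+ 2).
pose c (i : 'I_d) := Num.sqrt (pi / (a + m)) * expR (- (a * m / (a + m)) * y ord0 i ^+ 2).
have mg i : measurable_fun setT (g i).
  apply: measurable_funM; first exact: measurable_gauss.
  apply: (measurableT_comp (measurable_gauss m)).
  exact: measurable_funB.
transitivity (\int[mu d]_x (\prod_(i < d) g i (x ord0 i))%:E)%E.
  apply: eq_integral => x _; rewrite /g big_split/= -!expR_sum; congr (expR _ * expR _)%:E.
    by rewrite /dotp mulr_sumr; apply: eq_bigr => i _; rewrite expr2.
  by rewrite /dotp mulr_sumr; apply: eq_bigr => i _; rewrite !mxE expr2.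
rewrite (@ge0_integral_rV_prod _ _ g c)//; last first.
- move=> i; rewrite /g /c.
  transitivity (\int[leb]_t ((expR (- (a * m / (a + m)) * y ord0 i ^+ 2))%:E *
      (expR (- (a + m) * (t + - (m * y ord0 i / (a + m))) ^+ 2))%:E))%E.
    apply: eq_integral => t _; rewrite -EFinM -!expRD; congr (expR _)%:E.
    rewrite !mulNr -opprD gauss_square_completion// -opprD; congr (- _).
    by rewrite addrC.
  rewrite ge0_integralZl//.
    rewrite (@ge0_integral_shift _ _ (fun t => (expR (- (a + m) * t ^+ 2))%:E))//.
      by rewrite integral_gauss_scaled// -EFinM mulrC.
    by apply/measurable_EFinP; exact: measurable_gauss.
  apply/measurable_EFinP; apply: (measurableT_comp (measurable_gauss (a + m))).
  exact: measurable_funD.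
- by move=> i t; rewrite mulr_ge0 ?expR_ge0.
congr EFin; rewrite /c big_split/= prodr_const card_ord; congr (_ * _).
rewrite -expR_sum; congr expR; rewrite /dotp mulr_sumr.
by apply: eq_bigr => i _; rewrite expr2.
Qed.

End gauss_rV.

(** * Schwartz functions *)

Section gaussian_schwartz.
Context {R : realType} (d : nat).
Local Notation Rd := 'rV[R]_d.

Lemma is_derive_line (F : Rd -> R) (x v : Rd) (df : R) :
  is_derive (0 : R) 1 (fun h : R => F (h *: v + x)) df -> is_derive x v F df.
Proof.
have E : (fun h : R => h^-1 *: (F (h *: v + x) - F x)) =
    (fun h : R => h^-1 *: (F ((h *: (1 : R) + 0) *: v + x) - F (0 *: v + x))).
  by apply/funext => h; rewrite addr0 scale0r add0r /GRing.scale/= mulr1.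
by move=> [h1 h2]; split; [rewrite /derivable E|rewrite /derive E].
Qed.

Variables (m : R) (y : Rd).
Hypothesis m0 : 0 < m.

(** A class containing the Gaussian and stable under partial derivatives. Keeping one polynomial per
    coordinate makes a derivative change a single factor, by q' - 2mXq. *)
Definition poly_gauss (q : 'I_d -> {poly R}) (x : Rd) : R :=
  \prod_(i < d) ((q i).[x ord0 i - y ord0 i] * expR (- m * (x ord0 i - y ord0 i) ^+ 2)).

Definition poly_gauss_diff (i : 'I_d) (q : 'I_d -> {poly R}) (j : 'I_d) : {poly R} :=
  if j == i then (q i)^`() - (2 * m)%:P * 'X * q i else q j.

Lemma is_derive_poly_gauss1 (p : {poly R}) (c t : R) :
  is_derive t 1 (fun t => p.[t - c] * expR (- m * (t - c) ^+ 2))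
    ((p^`() - (2 * m)%:P * 'X * p).[t - c] * expR (- m * (t - c) ^+ 2)).
Proof.
have h1 : is_derive t 1 (fun t => t - c) 1 by apply: is_derive_eq; rewrite subr0.
have h2 := @is_derive1_comp R _ _ t _ _ (is_derive_poly p (t - c)) h1.
have h3 : is_derive t 1 (fun t => - m * (t - c) ^+ 2) (- m * (2 * (t - c))).
  by apply: is_derive_eq; rewrite /GRing.scale/=; ring.
have h4 := @is_derive1_comp R expR _ t _ _ (is_derive_expR _) h3.
apply: (is_derive_eq (is_deriveM h2 h4)).
rewrite /GRing.scale/= hornerD hornerN !hornerM hornerC hornerX.
set e := expR _; set u := p.[_]; set v := p^`().[_].
by ring.
Qed.

Lemma is_derive_poly_gauss (i : 'I_d) (q : 'I_d -> {poly R}) (x : Rd) :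
  is_derive x (delta_mx ord0 i : Rd) (poly_gauss q) (poly_gauss (poly_gauss_diff i q) x).
Proof.
apply: is_derive_line.
pose K := \prod_(j < d | j != i) ((q j).[x ord0 j - y ord0 j] * expR (- m * (x ord0 j - y ord0 j) ^+ 2)).
pose g t := (q i).[t - y ord0 i] * expR (- m * (t - y ord0 i) ^+ 2).
have -> : (fun h : R => poly_gauss q (h *: (delta_mx ord0 i : Rd) + x)) =
    (fun h : R => g (1 * h + x ord0 i) * K).
  apply/funext => h; rewrite /poly_gauss (bigD1 i)//= /g; congr (_ * _).
    by rewrite !mxE !eqxx mulr1 mul1r.
  by apply: eq_bigr => j ji; rewrite !mxE (negbTE ji) andbF mulr0 add0r.
have h1 := is_derive_affine 1 (x ord0 i) 0.
have h2 := @is_derive1_comp R g _ 0 _ _ (is_derive_poly_gauss1 _ _ _) h1.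
have h3 := is_deriveM h2 (is_derive_cst K (0 : R) (1 : R)).
apply: (is_derive_eq h3).
rewrite /poly_gauss (bigD1 i)//= {1}/poly_gauss_diff eqxx.
rewrite /GRing.scale/= mulr0 add0r mulr1 mulrC mulr0 add0r; congr (_ * _).
by apply: eq_bigr => j ji; rewrite /poly_gauss_diff (negbTE ji).
Qed.

Lemma continuous_poly_gauss (q : 'I_d -> {poly R}) : continuous (poly_gauss q).
Proof.
have cprod (r : seq 'I_d) (f : 'I_d -> Rd -> R) : (forall i, continuous (f i)) ->
    continuous (fun x => \prod_(i <- r) f i x).
  move=> cf; elim: r => [|i r IH] x.
    rewrite (_ : (fun _ => _) = cst 1); first exact: cst_continuous.
    by apply/funext => z; rewrite big_nil.
  rewrite (_ : (fun _ => _) = f i \* (fun x => \prod_(j <- r) f j x)).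
    by apply: continuousM; [exact: cf|exact: IH].
  by apply/funext => z; rewrite big_cons.
apply: cprod => i x.
have c1 : {for x, continuous (fun x : Rd => x ord0 i)} by exact: coord_continuous.
have [d1 _] := is_derive_poly_gauss1 (q i) (y ord0 i) (x ord0 i).
pose g t := (q i).[t - y ord0 i] * expR (- m * (t - y ord0 i) ^+ 2).
have cg : {for x ord0 i, continuous g}.
  by apply: differentiable_continuous; exact/derivable1_diffP.
exact: (@continuous_comp _ _ _ (fun x : Rd => x ord0 i) g x c1 cg).
Qed.

Lemma partial_poly_gauss (s : seq 'I_d) (q : 'I_d -> {poly R}) :
  exists q', partial s (poly_gauss q) = poly_gauss q'.
Proof.
elim: s => [|i s [q' IH]]; first by exists q.
exists (poly_gauss_diff i q'); rewrite /partial/= -/(partial s _) IH.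
by apply/funext => x; have [_ ->] := is_derive_poly_gauss i q' x.
Qed.

Lemma smooth_poly_gauss (q : 'I_d -> {poly R}) : smooth (poly_gauss q).
Proof.
move=> s; have [q' ->] := partial_poly_gauss s q; split; first exact: continuous_poly_gauss.
by move=> i x; have [] := is_derive_poly_gauss i q' x.
Qed.

(** Induction on the polynomial in Horner form pX + a: the factor t - c costs one more power of 1 +
    |t|, so [N] has to vary in the induction. *)
Lemma poly_gauss1_bound (c : R) (p : {poly R}) (N : nat) : exists2 C, 0 <= C &
  forall t, (1 + `|t|) ^+ N * `|p.[t - c] * expR (- m * (t - c) ^+ 2)| <= C.
Proof.
have base M : exists2 C, 0 <= C &
    forall t, (1 + `|t|) ^+ M * expR (- m * (t - c) ^+ 2) <= C.
  (* From (1+|t|)^(M+1) <= (M+1)! e^(1+|t|), |t| <= |c| + |t-c|, and |t-c| - m (t-c)^2 <= 1/(4m),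
     the maximum of a parabola in |t-c|. *)
  exists (M.+1`!%:R * expR (1 + `|c| + (4 * m)^-1)); first by rewrite mulr_ge0 ?expR_ge0.
  move=> t; have t0 : 0 <= 1 + `|t| by rewrite addr_ge0.
  have := expR_ge1Dxn M t0; set f := M.+1`!%:R => h.
  have f0 : 0 < f by rewrite ltr0n fact_gt0.
  have h1 : (1 + `|t|) ^+ M.+1 <= f * expR (1 + `|t|).
    by rewrite mulrC -ler_pdivrMr//; lra.
  have h2 : (1 + `|t|) ^+ M <= (1 + `|t|) ^+ M.+1.
    by rewrite exprS ler_peMl ?exprn_ge0// lerDl.
  apply: (@le_trans _ _ (f * expR (1 + `|t|) * expR (- m * (t - c) ^+ 2))).
    by rewrite ler_wpM2r ?expR_ge0// (le_trans h2).
  rewrite -mulrA -expRD; apply: ler_wpM2l; [exact: ltW|rewrite ler_expR].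
  have h3 : `|t| <= `|c| + `|t - c| by rewrite -{1}(subrK c t) addrC ler_normD.
  have h4 : `|t - c| - m * (t - c) ^+ 2 <= (4 * m)^-1.
    have -> : `|t - c| - m * (t - c) ^+ 2 = (4 * m)^-1 - m * (`|t - c| - (2 * m)^-1) ^+ 2.
      by rewrite -real_normK ?num_real//; field; rewrite gt_eqF.
    by rewrite gerBl mulr_ge0 ?sqr_ge0// ltW.
  lra.
elim/poly_ind: p N => [|p a IH] N.
  by exists 0 => // t; rewrite horner0 mul0r normr0 mulr0.
have [C1 C10 h1] := IH N.+1; have [C2 C20 h2] := base N.
exists ((1 + `|c|) * C1 + `|a| * C2); first by rewrite addr_ge0// mulr_ge0// addr_ge0.
move=> t; rewrite hornerD hornerM hornerX hornerC normrM (ger0_norm (expR_ge0 _)).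
have h3 : `|p.[t - c] * (t - c) + a| <= `|p.[t - c]| * ((1 + `|c|) * (1 + `|t|)) + `|a|.
  apply: (le_trans (ler_normD _ _)); rewrite lerD2r normrM ler_wpM2l//.
  apply: (le_trans (ler_normB _ _)).
  by have := normr_ge0 t; have := normr_ge0 c; have := mulr_ge0 (normr_ge0 t) (normr_ge0 c); lra.
apply: (@le_trans _ _ ((1 + `|t|) ^+ N *
    ((`|p.[t - c]| * ((1 + `|c|) * (1 + `|t|)) + `|a|) * expR (- m * (t - c) ^+ 2)))).
  apply: ler_wpM2l; first by rewrite exprn_ge0 ?addr_ge0.
  by apply: ler_wpM2r; first exact: expR_ge0.
have -> : (1 + `|t|) ^+ N *
    ((`|p.[t - c]| * ((1 + `|c|) * (1 + `|t|)) + `|a|) * expR (- m * (t - c) ^+ 2)) =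
  (1 + `|c|) * ((1 + `|t|) ^+ N.+1 * `|p.[t - c] * expR (- m * (t - c) ^+ 2)|) +
  `|a| * ((1 + `|t|) ^+ N * expR (- m * (t - c) ^+ 2)).
  rewrite normrM (ger0_norm (expR_ge0 _)) (exprS _ N).
  by move: (expR _) `|p.[_]| `|t| `|c| `|a| => e u v w z; ring.
by apply: lerD; apply: ler_wpM2l => //; rewrite addr_ge0.
Qed.

(** Splits the polynomial weight over the coordinates, so that the one-dimensional bounds can be
    multiplied. *)
Lemma enorm_le_prod (x : Rd) : 1 + enorm x <= \prod_(i < d) (1 + `|x ord0 i|).
Proof.
have enorm_le : enorm x <= \sum_(i < d) `|x ord0 i|.
  have s0 : 0 <= \sum_(i < d) `|x ord0 i| by exact: sumr_ge0.
  rewrite -(ger0_norm s0) -sqrtr_sqr ler_wsqrtr// /dotp expr2 mulr_suml.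
  apply: ler_sum => i _; rewrite -expr2 -real_normK ?num_real// expr2 ler_wpM2l//.
  by rewrite (bigD1 i)//= lerDl sumr_ge0.
apply: (@le_trans _ _ (1 + \sum_(i < d) `|x ord0 i|)); first by rewrite lerD2l.
elim: (index_enum 'I_d) => [|i r IH]; first by rewrite !big_nil addr0.
rewrite !big_cons; have p1 : 1 <= \prod_(j <- r) (1 + `|x ord0 j|).
  by apply: le_trans IH; rewrite lerDl sumr_ge0.
rewrite mulrDl mul1r; have := ler_wpM2l (normr_ge0 (x ord0 i)) p1.
by rewrite mulr1; lra.
Qed.

Lemma enorm_ge0 (x : Rd) : 0 <= enorm x. Proof. exact: sqrtr_ge0. Qed.

Lemma poly_gauss_bound0 (N : nat) (q : 'I_d -> {poly R}) : exists2 C, 0 <= C &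
  forall x, (1 + enorm x) ^+ N * `|poly_gauss q x| <= C.
Proof.
have /choice[C hC] : forall i : 'I_d, exists c : R, 0 <= c /\ forall t, (1 + `|t|) ^+ N *
    `|(q i).[t - y ord0 i] * expR (- m * (t - y ord0 i) ^+ 2)| <= c.
  by move=> i; have [c c0 hc] := poly_gauss1_bound (y ord0 i) (q i) N; exists c.
exists (\prod_i C i) => [|x]; first by apply: prodr_ge0 => i _; have [] := hC i.
rewrite normr_prod.
apply: (@le_trans _ _ ((\prod_(i < d) (1 + `|x ord0 i|)) ^+ N * \prod_(i < d)
    `|(q i).[x ord0 i - y ord0 i] * expR (- m * (x ord0 i - y ord0 i) ^+ 2)|)).
  rewrite ler_wpM2r ?prodr_ge0// lerXn2r ?nnegrE ?addr_ge0 ?enorm_ge0//.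
    by apply: prodr_ge0 => i _; rewrite addr_ge0.
  exact: enorm_le_prod.
rewrite -prodrXl -big_split/=; apply: ler_prod => i _.
rewrite mulr_ge0 ?exprn_ge0 ?addr_ge0//=.
by have [_ ->] := hC i.
Qed.

Lemma poly_gauss_bound (N k : nat) (q : 'I_d -> {poly R}) : exists2 C, 0 <= C &
  forall s, (size s <= k)%N -> forall x, (1 + enorm x) ^+ N * `|partial s (poly_gauss q) x| <= C.
Proof.
elim: k q => [|k IH] q; have [C0 C00 h0] := poly_gauss_bound0 N q.
  by exists C0 => // -[].
have /choice[C hC] : forall i : 'I_d, exists c : R, 0 <= c /\ forall s, (size s <= k)%N ->
    forall x, (1 + enorm x) ^+ N * `|partial s (poly_gauss (poly_gauss_diff i q)) x| <= c.
  by move=> i; have [c c0 hc] := IH (poly_gauss_diff i q); exists c.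
have C_ge0 i : 0 <= C i by have [] := hC i.
exists (C0 + \sum_i C i) => [|s]; first by rewrite addr_ge0// sumr_ge0.
(* [partial] is a [foldr], so the last index of [s] is differentiated first and turns the function
   into another [poly_gauss], to which the shorter list applies. The bound adds up the cases of an
   empty list and of each last index. *)
case/lastP: s => [_ x|s i]; first by apply: (le_trans (h0 x)); rewrite lerDl sumr_ge0.
rewrite size_rcons ltnS => sk x; rewrite /partial foldr_rcons -/(partial _ _).
have -> : (fun x => 'D_(delta_mx ord0 i : Rd) (poly_gauss q) x) = poly_gauss (poly_gauss_diff i q).
  by apply/funext => z; have [_ ->] := is_derive_poly_gauss i q z.
have [_ /(_ s sk x) h] := hC i; apply: (le_trans h).
by rewrite (bigD1 i)//=; apply: ler_wpDl => //; rewrite lerDl sumr_ge0.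
Qed.

Lemma poly_gauss1E : poly_gauss (fun=> 1) = (fun x => expR (- m * dotp (x - y) (x - y))).
Proof.
apply/funext => x; rewrite /poly_gauss; under eq_bigr => i _ do rewrite hornerC mul1r.
rewrite -expR_sum; congr expR; rewrite /dotp mulr_sumr.
by apply: eq_bigr => i _; rewrite !mxE expr2.
Qed.

Lemma partial_cst0 (s : seq 'I_d) : partial s (fun _ : Rd => 0 : R) = (fun=> 0).
Proof.
elim: s => // i s IH; rewrite /partial/= -/(partial s _) IH.
by apply/funext => x; have [_ ->] := is_derive_cst (0 : R) x (delta_mx ord0 i : Rd).
Qed.

Lemma schwartz_gauss :
  schwartz (fun x : Rd => (expR (- m * dotp (x - y) (x - y)))%:C%C).
Proof.
split; [|split].
- by rewrite -poly_gauss1E; exact: smooth_poly_gauss.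
- move=> s; rewrite partial_cst0; split; first exact: cst_continuous.
  by move=> i x; have [] := is_derive_cst (0 : R) x (delta_mx ord0 i : Rd).
move=> N; have [C C0 hC] := poly_gauss_bound N N (fun=> 1).
apply: (@le_lt_trans _ _ C%:E); last exact: ltry.
apply: ub_ereal_sup => _ [x [s [sN ->]]]; rewrite lee_fin.
have := hC s sN x; rewrite poly_gauss1E.
rewrite /cpartial /= partial_cst0 /ComplexField.Normc.normc /= expr0n/= addr0 sqrtr_sqr.
by [].
Qed.

End gaussian_schwartz.

Section schwartz_regularity.
Context {R : realType} (d : nat).
Local Notation Rd := 'rV[R]_d.

(** The sigma-algebra is generated by the coordinates, the topology by the sup norm; they meet
    because an open set is a countable union of boxes with rational centre and radius 1/(k+1). *)
Lemma open_measurable_rV (U : set Rd) : open U -> measurable U.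
Proof.
move=> oU.
pose B (p : 'rV[rat]_d * nat) :=
  [set x : Rd | forall i, `|x ord0 i - ratr (p.1 ord0 i)| < p.2.+1%:R^-1].
have mB p : measurable (B p).
  rewrite (_ : B p = \bigcap_(i in [set: 'I_d])
      ((fun x : Rd => x ord0 i) @^-1` ball (ratr (p.1 ord0 i) : R) p.2.+1%:R^-1)).
    apply: fin_bigcap_measurable => // i _; rewrite -[X in measurable X]setTI.
    by apply: measurable_coord => //; exact: measurable_ball.
  apply/seteqP; split => x /= h i => [_|]; first by rewrite /ball/= distrC; exact: h.
  by have := h i I; rewrite /ball/= distrC.
have -> : U = \bigcup_p (if `[< B p `<=` U >] then B p else set0).
  apply/seteqP; split => x; last first.
    by move=> [p _]; case: ifPn => // /asboolP; apply.
  move=> Ux; have /nbhs_ballP[e /= e0 he] := oU x Ux.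
  (* Chosen so that 2/(k+1) <= e: the given point and any other point of the box each lie within
     1/(k+1) of the rational centre. *)
  pose k := Num.truncn (2 / e).
  have k0 : 0 < k.+1%:R :> R by rewrite ltr0n.
  have ke : 2 * k.+1%:R^-1 <= e.
    by rewrite ler_pdivrMr// mulrC -ler_pdivrMr//; apply/ltW/truncnS_gt.
  have /choice[q hq] : forall i : 'I_d, exists q : rat, `|x ord0 i - ratr q| < k.+1%:R^-1.
    move=> i; have [|q] := @rat_in_itvoo R (x ord0 i - k.+1%:R^-1) (x ord0 i + k.+1%:R^-1).
      by rewrite ltrBlDr -addrA ltrDl addr_gt0 ?invr_gt0.
    by rewrite in_itv/= => h; exists q; rewrite distrC ltr_distl.
  exists (\row_i q i, k) => //; rewrite ifT; last first.
    apply/asboolP => z hz; apply: he; split => // i j.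
    rewrite (ord1 i) /ball/=; apply: lt_le_trans ke.
    have := hz j; rewrite /= mxE => h1; have h2 := hq j.
    rewrite -(subrKA (ratr (q j))); apply: (le_lt_trans (ler_normD _ _)).
    by rewrite mulr2n mulrDl mul1r ltrD// distrC.
  by move=> i; rewrite /= mxE.
apply: countable_bigcupT_measurable; first exact: (@countableP ('rV[rat]_d * nat)%type).
move=> p; case: ifPn => _; [exact: mB|exact: measurable0].
Qed.

Lemma continuous_measurable_rV (f : Rd -> R) : continuous f -> measurable_fun setT f.
Proof.
move=> /continuousP cf; apply: (measurability _ (RGenOpens.measurableE R)).
move=> _ [_ [a [b ->] <-]]; rewrite setTI.
by apply: open_measurable_rV; apply: cf; exact: interval_open.
Qed.

Lemma normc_real (a b : R) : ComplexField.Normc.normc (a +i* b)%C = Num.sqrt (a ^+ 2 + b ^+ 2).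
Proof. by []. Qed.

Lemma normc_nneg (z : R[i]) : 0 <= ComplexField.Normc.normc z.
Proof. by case: z => a b; exact: sqrtr_ge0. Qed.

Lemma Re_le_normc (z : R[i]) : `|complex.Re z| <= ComplexField.Normc.normc z.
Proof.
by case: z => a b; rewrite normc_real/= -sqrtr_sqr ler_wsqrtr// lerDl sqr_ge0.
Qed.

Lemma Im_le_normc (z : R[i]) : `|complex.Im z| <= ComplexField.Normc.normc z.
Proof.
by case: z => a b; rewrite normc_real/= -sqrtr_sqr ler_wsqrtr// lerDr sqr_ge0.
Qed.

Lemma normc_le_sum (z : R[i]) :
  ComplexField.Normc.normc z <= `|complex.Re z| + `|complex.Im z|.
Proof.
case: z => a b; rewrite normc_real/=.
rewrite -[leRHS]ger0_norm ?addr_ge0// -sqrtr_sqr ler_wsqrtr// sqrrD !real_normK ?num_real//.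
by rewrite -addrA lerD2l lerDr mulrn_wge0// mulr_ge0.
Qed.

Lemma schwartz_measurable_Re (phi : Rd -> R[i]) : schwartz phi ->
  measurable_fun setT (fun x => complex.Re (phi x)).
Proof. by move=> [/(_ [::])[h _] _]; exact: continuous_measurable_rV. Qed.

Lemma schwartz_measurable_Im (phi : Rd -> R[i]) : schwartz phi ->
  measurable_fun setT (fun x => complex.Im (phi x)).
Proof. by move=> [_ [/(_ [::])[h _] _]]; exact: continuous_measurable_rV. Qed.

Lemma normc_le_seminorm (N : nat) (phi : Rd -> R[i]) (x : Rd) :
  (((1 + enorm x) ^+ N * ComplexField.Normc.normc (phi x))%:E <= schwartz_seminorm N phi)%E.
Proof.
apply: ereal_sup_ubound; exists x, [::]; split => //.
by rewrite /cpartial/=; case: (phi x).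
Qed.

Lemma schwartz_decay (N : nat) (phi : Rd -> R[i]) : schwartz phi -> exists2 C, 0 <= C &
  forall x, (1 + enorm x) ^+ N * ComplexField.Normc.normc (phi x) <= C.
Proof.
move=> [_ [_ /(_ N)]]; have := normc_le_seminorm N phi.
case: schwartz_seminorm => [C|//|] h _.
- exists C => [|x]; last by rewrite -lee_fin.
  rewrite -lee_fin; apply: le_trans (h 0); rewrite lee_fin mulr_ge0 ?exprn_ge0 ?addr_ge0 ?sqrtr_ge0//.
  exact: normc_nneg.
- by have := h 0; rewrite leeNy_eq.
Qed.

End schwartz_regularity.

(** * The Bessel potential *)

Section bessel_potential_profile.
Context {R : realType}.
Local Notation leb := (@lebesgue_measure R).
Variables (d : nat) (n : R).
Hypothesis hn : d%:R / 2 < n.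

Lemma dim_lt_n0 : 0 < n.
Proof. by apply: le_lt_trans hn; rewrite divr_ge0. Qed.

(** The Gamma integral for (1+q)^(-n) has weight e^(ns - e^s) / Gamma(n). The unitary transform of
    exp(-e^(-s) |x|^2 / 4) is 2^(d/2) e^(ds/2) exp(-e^s |k|^2); dividing by this prefactor gives the
    formula. *)
Definition mixture_weight (s : R) : R :=
  Num.sqrt 2 ^- d / Gamma n * expR ((n - d%:R / 2) * s - expR s).

(* Gaussian mixture chosen so that its value at t^2 is 2^(1-n) / Gamma n * t^nu * K_nu t,
   where nu = n - d/2. *)
Definition mixture (t : R) : R :=
  \int[leb]_s (mixture_weight s * expR (- (expR (- s) / 4) * t)).

Lemma mixture_weight_ge0 s : 0 <= mixture_weight s.
Proof.
rewrite mulr_ge0 ?expR_ge0// divr_ge0 ?invr_ge0 ?exprn_ge0 ?sqrtr_ge0//.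
exact/ltW/Gamma_gt0/dim_lt_n0.
Qed.

Lemma measurable_log_gamma (a : R) : measurable_fun setT (fun s : R => expR (a * s - expR s)).
Proof.
by apply: (measurableT_comp (@measurable_expR R)); apply: measurable_funB.
Qed.

Lemma measurable_mixture_weight : measurable_fun setT mixture_weight.
Proof. by apply: measurable_funM => //; exact: measurable_log_gamma. Qed.

Lemma measurable_expRN (disp : measure_display) (T : measurableType disp) (g : T -> R) :
  measurable_fun setT g -> measurable_fun setT (fun z => expR (- g z)).
Proof.
move=> mg; apply: (measurableT_comp (@measurable_expR R)).
exact: measurable_funN.
Qed.

Lemma measurable_mixture_rate (disp : measure_display) (T : measurableType disp) (g : T -> R) :
  measurable_fun setT g -> measurable_fun setT (fun z => expR (- g z) / 4).
Proof. by move=> mg; apply: measurable_funM => //; exact: measurable_expRN. Qed.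

Let E (t s : R) : R := mixture_weight s * expR (- (expR (- s) / 4) * t).

Let E_ge0 t s : 0 <= E t s.
Proof. by rewrite mulr_ge0 ?expR_ge0// mixture_weight_ge0. Qed.

Let mE : measurable_fun setT (fun z : R * R => E z.1 z.2).
Proof.
apply: measurable_funM.
  by apply: (measurableT_comp measurable_mixture_weight); exact: measurable_snd.
apply: (measurableT_comp (@measurable_expR R)); apply: measurable_funM; last exact: measurable_fst.
by apply: measurable_funN; apply: measurable_mixture_rate; exact: measurable_snd.
Qed.

Let mE1 t : measurable_fun setT (E t).
Proof. exact: (measurableT_comp mE (measurable_pair1 t)). Qed.

Lemma mixture_integrand_measurable t :
  measurable_fun setT (fun s : R => mixture_weight s * expR (- (expR (- s) / 4) * t)).
Proof. exact: mE1. Qed.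

Lemma measurable_mixture : measurable_fun setT mixture.
Proof.
apply: measurableT_comp => //.
apply: (@measurable_fun_fubini_tonelli_F _ _ _ _ _ leb (fun z : R * R => (E z.1 z.2)%:E)) => //.
  exact/measurable_EFinP.
by move=> z; rewrite lee_fin.
Qed.

(** The integral is a multiple of Gamma(n - d/2), finite because n > d/2. *)
Lemma mixture_weight_integral_lty : (\int[leb]_s (mixture_weight s)%:E < +oo)%E.
Proof.
under eq_integral => s _ do rewrite EFinM.
rewrite ge0_integralZl//; last 2 first.
- by apply/measurable_EFinP; exact: measurable_log_gamma.
- rewrite lee_fin divr_ge0 ?invr_ge0 ?exprn_ge0 ?sqrtr_ge0//.
  exact/ltW/Gamma_gt0/dim_lt_n0.
by rewrite -/(log_gamma_integral _) log_gamma_integralE ?subr_gt0// -EFinM ltry.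
Qed.

Lemma mixture_integral t : 0 <= t ->
  (\int[leb]_s (mixture_weight s * expR (- (expR (- s) / 4) * t))%:E = (mixture t)%:E)%E.
Proof.
move=> t0; rewrite /mixture /Rintegral fineK// ge0_fin_numE; last first.
  by apply: integral_ge0 => s _; rewrite lee_fin; exact: E_ge0.
apply: le_lt_trans mixture_weight_integral_lty.
apply: ge0_le_integral => //.
- by move=> s _; rewrite lee_fin; exact: E_ge0.
- by apply/measurable_EFinP; exact: mE1.
- by apply/measurable_EFinP; exact: measurable_mixture_weight.
move=> s _; rewrite lee_fin ler_piMr ?mixture_weight_ge0// expR_le1.
by rewrite mulNr oppr_le0 mulr_ge0// divr_ge0 ?expR_ge0.
Qed.

Lemma mixture_ge0 t : 0 <= mixture t.
Proof. by apply: Rintegral_ge0 => s _; exact: E_ge0. Qed.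

(** For infinite [x] both sides are 0. Constants can thus be moved through the integral defining
    [besselK] without showing that it converges. *)
Lemma fineMl_gt0 (c : R) (x : \bar R) : 0 < c -> fine (c%:E * x) = c * fine x.
Proof.
by move=> c0; case: x => [x| |] //=; rewrite ?gt0_muley ?gt0_muleNy ?lte_fin//= mulr0.
Qed.

Lemma powR_expR_ln (a x : R) : 0 < a -> a `^ x = expR (x * ln a).
Proof. by move=> a0; rewrite /powR gt_eqF. Qed.

Lemma measurable_cosh : measurable_fun setT (@cosh R).
Proof.
apply: measurable_funM => //; apply: measurable_funD; first exact: measurable_expR.
exact: measurable_expRN.
Qed.

Lemma cosh_ge0 (x : R) : 0 <= cosh x.
Proof. by rewrite divr_ge0// addr_ge0 ?expR_ge0. Qed.

Lemma coshN (x : R) : cosh (- x) = cosh x.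
Proof. by rewrite /cosh opprK addrC. Qed.

Lemma continuous_cosh : continuous (@cosh R).
Proof.
move=> x; apply: (@continuousM R R (fun x => expR x + expR (- x)) (cst 2^-1) x); last exact: cst_continuous.
apply: (@continuousD R R R expR (expR \o -%R)); first exact: continuous_expR.
apply: continuous_comp; last exact: continuous_expR.
exact: opp_continuous.
Qed.

(** Reflection shows that [nu] and [- nu] give the same integral; their average replaces e^(nu s) by
    cosh(nu s), and the integrand is then even. *)
Lemma integral_exp_cosh (nu t : R) :
  (\int[leb]_s (expR (nu * s - t * cosh s))%:E =
   2%:E * \int[leb]_(s in `]0%R, +oo[) (expR (- t * cosh s) * cosh (nu * s))%:E)%E.
Proof.
pose g (nu s : R) := expR (nu * s - t * cosh s).
have mg a : measurable_fun setT (g a).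
  apply: (measurableT_comp (@measurable_expR R)); apply: measurable_funB => //.
  by apply: measurable_funM => //; exact: measurable_cosh.
pose k (s : R) := expR (- t * cosh s) * cosh (nu * s).
have k0 s : 0 <= k s by rewrite mulr_ge0 ?expR_ge0// cosh_ge0.
have mk : measurable_fun setT k.
  apply: measurable_funM; last by apply: (measurableT_comp measurable_cosh).
  apply: (measurableT_comp (@measurable_expR R)); apply: measurable_funM => //.
  exact: measurable_cosh.
have ck : continuous k.
  have cmul (a : R) : continuous ( *%R a) by exact: mulrl_continuous.
  move=> s; apply: (@continuousM R R (expR \o (fun s => - t * cosh s)) (cosh \o ( *%R nu)) s).
    apply: continuous_comp; last exact: continuous_expR.
    by apply: (@continuous_comp _ _ _ (@cosh R) ( *%R (- t))); [exact: continuous_cosh|exact: cmul].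
  by apply: continuous_comp; [exact: cmul|exact: continuous_cosh].
transitivity (\int[leb]_s (k s)%:E)%E; last first.
  rewrite ge0_symfun_integralT//; last by move=> s; rewrite /k/= coshN mulrN coshN.
  rewrite -set_itvcy integral_itv_obnd_cbnd//.
  by apply/measurable_EFinP; exact: measurable_funTS.
have symg : (\int[leb]_s (g nu s)%:E = \int[leb]_s (g (- nu) s)%:E)%E.
  rewrite -(@ge0_integral_opp _ (fun s => (g nu s)%:E)).
  - by apply: eq_integral => s _; rewrite /g coshN mulrN mulNr.
  - by apply/measurable_EFinP; exact: mg.
  - by move=> s; rewrite lee_fin expR_ge0.
transitivity ((2^-1)%:E * (\int[leb]_s (g nu s)%:E + \int[leb]_s (g (- nu) s)%:E))%E.
  by rewrite -symg -mule2n -mule_natl muleA -EFinM mulVf// mul1e.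
rewrite -ge0_integralD//; last 4 first.
- by move=> s _; rewrite lee_fin expR_ge0.
- by apply/measurable_EFinP; exact: mg.
- by move=> s _; rewrite lee_fin expR_ge0.
- by apply/measurable_EFinP; exact: mg.
rewrite -ge0_integralZl//; last 2 first.
- by apply/measurable_EFinP; apply: measurable_funD; exact: mg.
- by move=> s _; rewrite -EFinD lee_fin addr_ge0 ?expR_ge0.
apply: eq_integral => s _; rewrite -EFinD -EFinM; congr EFin.
rewrite /g /k /cosh !expRD -!mulNr; set a := expR (- t * _).
by rewrite mulNr; set b := expR _; set c := expR _; ring.
Qed.

(** Translating s by ln(t/2) turns e^s + e^(-s) t^2/4 into t cosh s and releases the factor
    (t/2)^nu. The powers of 2 combine to 2^(1-n) since nu + d/2 = n. *)
Lemma mixtureE t : 0 < t ->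
  mixture (t ^+ 2) = t `^ (n - d%:R / 2) * besselK (n - d%:R / 2) t / (2 `^ (n - 1) * Gamma n).
Proof.
move=> t0; set nu := n - d%:R / 2.
have t2 : 0 < t / 2 by rewrite divr_gt0.
have G0 := Gamma_gt0 dim_lt_n0.
rewrite /mixture /Rintegral.
rewrite -(@ge0_integral_shift _ (ln (t / 2)) (fun s => (E (t ^+ 2) s)%:E)); last 2 first.
- by apply/measurable_EFinP; exact: mE1.
- by move=> s; rewrite lee_fin; exact: E_ge0.
pose c := Num.sqrt 2 ^- d / Gamma n * (t / 2) `^ nu.
have c0 : 0 < c.
  by rewrite !mulr_gt0 ?invr_gt0 ?exprn_gt0 ?sqrtr_gt0 ?powR_gt0.
transitivity (fine (c%:E * \int[leb]_s (expR (nu * s - t * cosh s))%:E)%E).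
  congr fine; rewrite -ge0_integralZl//; last 2 first.
  - apply/measurable_EFinP; apply: (measurableT_comp (@measurable_expR R)).
    apply: measurable_funB => //; apply: measurable_funM => //; exact: measurable_cosh.
  - by rewrite lee_fin ltW.
  apply: eq_integral => s _; rewrite -EFinM; congr EFin.
  rewrite /E /mixture_weight /c powR_expR_ln// -!mulrA; congr (_ * (_ * _)).
  rewrite -!expRD; congr expR.
  rewrite opprD !expRD expRN (expRN (ln _)) lnK ?posrE// -/nu /cosh expRN.
  by field; rewrite !gt_eqF ?expR_gt0.
rewrite fineMl_gt0// integral_exp_cosh fineMl_gt0//.
rewrite (_ : fine (\int[leb]_(s in _) _) = besselK nu t)//.
have tE : t `^ nu = (t / 2) `^ nu * 2 `^ nu.
  by rewrite -powRM ?ltW//; congr (_ `^ _); field.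
have two_n : 2 `^ (n - 1) * 2 = 2 `^ (d%:R / 2) * 2 `^ nu :> R.
  rewrite -[X in _ * X = _](@powRr1 R 2)// -!powRD ?pnatr_eq0 ?implybT//.
  by congr (_ `^ _); rewrite /nu; ring.
rewrite /c tE sqrt_expr_powR//.
have p1 : 0 < 2 `^ (n - 1) :> R by rewrite powR_gt0.
have p2 : 0 < 2 `^ (d%:R / 2) :> R by rewrite powR_gt0.
apply: (@mulIf _ (2 `^ (n - 1) * 2 `^ (d%:R / 2))); first by rewrite mulf_neq0 ?gt_eqF.
transitivity ((2 `^ (n - 1) * 2) * ((t / 2) `^ nu / Gamma n * besselK nu t)).
  by field; rewrite !gt_eqF.
by rewrite two_n; field; rewrite !gt_eqF.
Qed.

End bessel_potential_profile.

Section bessel_potential.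
Context {R : realType}.
Local Notation leb := (@lebesgue_measure R).
Local Notation mu d := (@lebesgue_rV R d).
Variables (d : nat) (n l : R).
Hypothesis hn : d%:R / 2 < n.
Hypothesis l0 : 0 < l.

Let n0 : 0 < n := dim_lt_n0 hn.

Lemma dotpr0 (x : 'rV[R]_d) : dotp x 0 = 0.
Proof. by rewrite /dotp big1// => i _; rewrite mxE mulr0. Qed.

Definition bessel_potential (x : 'rV[R]_d) : R := mixture d n (l ^+ 2 * dotp x x).

Definition bessel_symbol (k : 'rV[R]_d) : R := l ^- d * (1 + dotp k k / l ^+ 2) `^ (- n).

(** Scaling in the Gamma integral, which in the variable s is the translation by -ln A. *)
Lemma integral_log_gamma_scaled (A : R) : 0 < A ->
  (\int[leb]_s (expR (n * s - A * expR s))%:E = (A `^ (- n) * Gamma n)%:E)%E.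
Proof.
move=> A0.
have mF : measurable_fun setT (fun s : R => expR (n * s - A * expR s)).
  apply: (measurableT_comp (@measurable_expR R)); apply: measurable_funB => //.
  by apply: measurable_funM => //; exact: measurable_expR.
rewrite -(@ge0_integral_shift _ (- ln A) (fun s => (expR (n * s - A * expR s))%:E))//; last first.
  exact/measurable_EFinP.
rewrite EFinM -log_gamma_integralE// -ge0_integralZl//; last 2 first.
- by apply/measurable_EFinP; exact: measurable_log_gamma.
- by rewrite lee_fin powR_ge0.
apply: eq_integral => s _; rewrite -EFinM powR_expR_ln// -expRD; congr (expR _)%:E.
by rewrite expRD expRN lnK ?posrE//; field; rewrite gt_eqF.
Qed.

Lemma integral_log_gamma_cos (q th : R) : 0 <= q ->
  (\int[leb]_s (expR (n * s - expR s) * (1 + expR (- (q * expR s)) * cos th))%:E =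
   (Gamma n * (1 + (1 + q) `^ (- n) * cos th))%:E)%E.
Proof.
move=> q0.
have mF A : measurable_fun setT (fun s : R => expR (n * s - A * expR s)).
  apply: (measurableT_comp (@measurable_expR R)); apply: measurable_funB => //.
  by apply: measurable_funM => //; exact: measurable_expR.
have iF A : 0 < A -> leb.-integrable setT (EFin \o (fun s : R => expR (n * s - A * expR s))).
  move=> A0; apply/integrableP; split; first by apply/measurable_EFinP; exact: mF.
  under eq_integral => s _ do rewrite gee0_abs ?lee_fin ?expR_ge0//.
  by rewrite integral_log_gamma_scaled// ltry.
have q1 : 0 < 1 + q by rewrite ltr_wpDr.
transitivity (\int[leb]_s ((expR (n * s - 1 * expR s))%:E +
    (cos th)%:E * (expR (n * s - (1 + q) * expR s))%:E))%E.
  apply: eq_integral => s _; rewrite -EFinM -EFinD; congr EFin.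
  rewrite mulrDr mulr1 mul1r mulrA -expRD; congr (_ + _).
  by rewrite mulrC; congr (_ * expR _); ring.
rewrite integralD//; last 2 first.
- exact: iF.
- by apply: integrableZl => //; exact: iF.
rewrite integralZl//; last exact: iF.
rewrite !integral_log_gamma_scaled// powR1 mul1r -EFinM -EFinD; congr EFin; ring.
Qed.

Lemma measurable_bessel_potential : measurable_fun setT bessel_potential.
Proof.
apply: (measurableT_comp (@measurable_mixture R d n hn)); apply: measurable_funM => //.
exact: measurable_dotp.
Qed.

Lemma bessel_potential_ge0 x : 0 <= bessel_potential x.
Proof. exact: mixture_ge0. Qed.

Lemma bessel_potential_integral (x : 'rV[R]_d) : (bessel_potential x)%:E =
  (\int[leb]_s (mixture_weight d n s * expR (- (expR (- s) / 4) * (l ^+ 2 * dotp x x)))%:E)%E.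
Proof. by rewrite mixture_integral// mulr_ge0 ?sqr_ge0// dotp_ge0. Qed.

Lemma measurable_potential_kernel : measurable_fun setT (fun z : 'rV[R]_d * R =>
  mixture_weight d n z.2 * expR (- (expR (- z.2) / 4) * (l ^+ 2 * dotp z.1 z.1))).
Proof.
apply: measurable_funM.
  by apply: (measurableT_comp (measurable_mixture_weight d n)); exact: measurable_snd.
apply: (measurableT_comp (@measurable_expR R)); apply: measurable_funM.
  by apply: measurable_funN; apply: measurable_mixture_rate; exact: measurable_snd.
by apply: measurable_funM => //; apply: measurable_dotp; exact: measurable_fst.
Qed.

Lemma integral_bessel_potential (g : 'rV[R]_d -> R) :
  measurable_fun setT g -> (forall x, 0 <= g x) ->
  (\int[mu d]_x (bessel_potential x * g x)%:E = \int[leb]_s ((mixture_weight d n s)%:E *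
    \int[mu d]_x (expR (- (l ^+ 2 * expR (- s) / 4) * dotp x x) * g x)%:E))%E.
Proof.
move=> mg g0; have wge0 s : 0 <= mixture_weight d n s by exact: mixture_weight_ge0.
pose K (z : 'rV[R]_d * R) := (mixture_weight d n z.2 *
  expR (- (expR (- z.2) / 4) * (l ^+ 2 * dotp z.1 z.1)) * g z.1)%:E.
have mK : measurable_fun setT K.
  apply/measurable_EFinP; apply: measurable_funM; first exact: measurable_potential_kernel.
  by apply: (measurableT_comp mg); exact: measurable_fst.
have K0 z : (0 <= K z)%E by rewrite lee_fin mulr_ge0// mulr_ge0 ?expR_ge0.
transitivity (\int[mu d]_x \int[leb]_s K (x, s))%E.
  apply: eq_integral => x _; rewrite EFinM bessel_potential_integral -ge0_integralZr//.
  - by apply/measurable_EFinP; exact: mixture_integrand_measurable.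
  - by move=> s _; rewrite lee_fin mulr_ge0 ?expR_ge0.
  - by rewrite lee_fin.
rewrite fubini_tonelli//; apply: eq_integral => s _.
rewrite -ge0_integralZl//; last 3 first.
- by apply/measurable_EFinP; apply: measurable_funM => //; exact: measurable_gauss_rV.
- by move=> x _; rewrite lee_fin mulr_ge0 ?expR_ge0.
- by rewrite lee_fin.
apply: eq_integral => x _; rewrite -EFinM /K/= -mulrA; congr (_ * (expR _ * _))%:E.
by ring.
Qed.

Let rate_gt0 (s : R) : 0 < l ^+ 2 * expR (- s) / 4.
Proof. by rewrite divr_gt0// mulr_gt0 ?exprn_gt0 ?expR_gt0. Qed.

Lemma integral_bessel_potential_cos (k : 'rV[R]_d) (th : R) :
  (\int[mu d]_x (bessel_potential x * (1 + cos (dotp x k + th)))%:E =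
   (Num.sqrt (2 * pi) ^+ d * (bessel_symbol 0 + bessel_symbol k * cos th))%:E)%E.
Proof.
have one01 : 0 <= (1 : R) <= 1 by rewrite ler01 lexx.
have cos0 x : 0 <= 1 + cos x :> R by have := one_plus_cos_ge0 x one01; rewrite mul1r.
rewrite integral_bessel_potential//; last first.
  by apply: measurable_funD => //; exact: measurable_cos_dotp.
have q0 : 0 <= dotp k k / l ^+ 2 by rewrite divr_ge0 ?dotp_ge0 ?sqr_ge0.
have G0 := Gamma_gt0 n0.
pose C := Num.sqrt (2 * pi) ^+ d * l ^- d / Gamma n.
transitivity (\int[leb]_s (C%:E *
    (expR (n * s - expR s) * (1 + expR (- (dotp k k / l ^+ 2 * expR s)) * cos th))%:E))%E.
  apply: eq_integral => s _.
  under eq_integral => x _ do rewrite -(mul1r (cos _)).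
  rewrite (@integral_gauss_cos_rV _ _ _ 1)// -!EFinM; congr EFin.
  rewrite mul1r [LHS](mulrA (mixture_weight _ _ _)) [RHS](mulrA C); congr (_ * _); last first.
    congr (1 + expR (- _) * _).
    by rewrite expRN; field; rewrite !gt_eqF ?expR_gt0.
  (* In the d-th power of this factor, 2^(d/2) and e^(ds/2) cancel the corresponding factors of
     [mixture_weight]; a pure Gamma integrand of order n remains. *)
  have sq : Num.sqrt (pi / (l ^+ 2 * expR (- s) / 4)) =
      Num.sqrt 2 * (Num.sqrt (2 * pi) * l^-1 * expR (s / 2)).
    have pos : 0 <= Num.sqrt 2 * (Num.sqrt (2 * pi) * l^-1 * expR (s / 2)).
      by rewrite !mulr_ge0 ?sqrtr_ge0 ?expR_ge0// invr_ge0 ltW.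
    rewrite -[RHS]ger0_norm// -sqrtr_sqr; congr Num.sqrt.
    rewrite !exprMn !sqr_sqrtr ?mulr_ge0 ?pi_ge0// -expRM_natl.
    rewrite (_ : 2%:R * (s / 2) = s); last by field.
    by rewrite expRN; field; rewrite !gt_eqF ?expR_gt0.
  rewrite sq /mixture_weight /C !exprMn -expRM_natl.
  rewrite (_ : (n - d%:R / 2) * s - expR s = (n * s - expR s) - d%:R * (s / 2)); last by field.
  rewrite expRB exprVn; field.
  by rewrite !gt_eqF ?expR_gt0 ?exprn_gt0 ?sqrtr_gt0.
have C0 : 0 <= C.
  by rewrite divr_ge0 ?mulr_ge0 ?exprn_ge0 ?sqrtr_ge0 ?invr_ge0 ?exprn_ge0// ltW.
rewrite ge0_integralZl//; last 2 first.
- apply/measurable_EFinP; apply: measurable_funM; first exact: measurable_log_gamma.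
  apply: measurable_funD => //; apply: measurable_funM => //; apply: measurable_expRN.
  by apply: measurable_funM => //; exact: measurable_expR.
- move=> s _; rewrite lee_fin mulr_ge0 ?expR_ge0// one_plus_cos_ge0// expR_ge0/= expR_le1.
  by rewrite oppr_le0 mulr_ge0 ?expR_ge0.
rewrite integral_log_gamma_cos// -EFinM; congr EFin.
rewrite /C /bessel_symbol dotpr0.
by rewrite mul0r addr0 powR1; field; rewrite !gt_eqF ?exprn_gt0.
Qed.

Lemma bessel_symbol_ge0 k : 0 <= bessel_symbol k.
Proof. by rewrite mulr_ge0 ?powR_ge0// invr_ge0 exprn_ge0// ltW. Qed.

Lemma bessel_symbol_le k : bessel_symbol k <= l ^- d.
Proof.
have p0 : 0 <= l ^- d by rewrite invr_ge0 exprn_ge0// ltW.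
rewrite /bessel_symbol ler_piMr// -[leRHS](powRr0 (1 + dotp k k / l ^+ 2)).
by apply: ler_powR; [rewrite lerDl divr_ge0 ?dotp_ge0 ?sqr_ge0|rewrite oppr_le0 ltW].
Qed.

Lemma integral_bessel_potential_lty : (\int[mu d]_x (bessel_potential x)%:E < +oo)%E.
Proof.
(* At k = 0 with phase pi/2 the cosine vanishes and only the integral of the potential is left. *)
have := integral_bessel_potential_cos 0 (pi / 2).
rewrite cos_pihalf mulr0 addr0 => h.
rewrite (eq_integral (fun x => (bessel_potential x * (1 + cos (dotp x 0 + pi / 2)))%:E)).
  by rewrite h ltry.
by move=> x _; rewrite dotpr0 add0r cos_pihalf addr0 mulr1.
Qed.

Lemma integrable_bessel_potential : (mu d).-integrable setT (EFin \o bessel_potential).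
Proof.
apply/integrableP; split; first by apply/measurable_EFinP; exact: measurable_bessel_potential.
under eq_integral => x _ do rewrite gee0_abs ?lee_fin ?bessel_potential_ge0//.
exact: integral_bessel_potential_lty.
Qed.

Lemma integrable_bessel_potentialM (g : 'rV[R]_d -> R) (C : R) :
  measurable_fun setT g -> (forall x, `|g x| <= C) ->
  (mu d).-integrable setT (EFin \o (fun x => bessel_potential x * g x)).
Proof.
move=> mg gC; have := integrableZl_EFin C integrable_bessel_potential.
apply: le_integrable => //.
  apply/measurable_EFinP; apply: measurable_funM => //; exact: measurable_bessel_potential.
move=> x _; rewrite /= lee_fin !normrM mulrC ler_wpM2r//.
exact: le_trans (ler_norm _).
Qed.

Lemma Rintegral_bessel_potential_cos (k : 'rV[R]_d) (th : R) :
  \int[mu d]_x (bessel_potential x * cos (dotp x k + th)) =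
  Num.sqrt (2 * pi) ^+ d * (bessel_symbol k * cos th).
Proof.
have icos a : (mu d).-integrable setT (EFin \o (fun x => bessel_potential x * cos (dotp x k + a))).
  by apply: (@integrable_bessel_potentialM _ 1) => [|x]; [exact: measurable_cos_dotp|exact: cos_max].
have h a : \int[mu d]_x bessel_potential x + \int[mu d]_x (bessel_potential x * cos (dotp x k + a)) =
    Num.sqrt (2 * pi) ^+ d * (bessel_symbol 0 + bessel_symbol k * cos a).
  rewrite -RintegralD//; last exact: integrable_bessel_potential.
  rewrite /Rintegral (eq_integral (fun x => (bessel_potential x * (1 + cos (dotp x k + a)))%:E)).
    by rewrite integral_bessel_potential_cos.
  by move=> x _; rewrite mulrDr mulr1.
(* Adding pi to the phase changes the sign of the cosine integral, so subtracting the two instances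
   of [h] eliminates the nonnegative part. *)
have hpi : \int[mu d]_x (bessel_potential x * cos (dotp x k + (th + pi))) =
    - \int[mu d]_x (bessel_potential x * cos (dotp x k + th)).
  rewrite -[RHS]mulN1r -RintegralZl//; apply: eq_Rintegral => x _.
  by rewrite addrA cosDpi mulN1r mulrN.
have := h th; have := h (th + pi); rewrite hpi cosDpi; set A := Num.sqrt _ ^+ d; lra.
Qed.

Lemma measurable_invr_ge0 (disp : measure_display) (T : measurableType disp) (g : T -> R) :
  measurable_fun setT g -> (forall z, 0 <= g z) -> measurable_fun setT (fun z => (g z)^-1).
Proof.
move=> mg g0; rewrite (_ : (fun z => _) = (@powR R ^~ (-1)) \o g).
  by apply: measurableT_comp mg; exact: measurable_powR.
by apply/funext => z; rewrite /= powR_inv1.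
Qed.

Lemma measurable_shifted_gauss (m : R) :
  measurable_fun setT (fun z : 'rV[R]_d * 'rV[R]_d => expR (- m * dotp (z.1 - z.2) (z.1 - z.2))).
Proof.
apply: (measurableT_comp (@measurable_expR R)); apply: measurable_funM => //.
have ms : measurable_fun setT (fun z : 'rV[R]_d * 'rV[R]_d => z.1 - z.2).
  apply: measurable_fun_rV => i; rewrite (_ : (fun z => _) =
    (fun z : 'rV[R]_d * 'rV[R]_d => z.1 ord0 i - z.2 ord0 i)); last first.
    by apply/funext => z; rewrite !mxE.
  by apply: measurable_funB; apply: (measurableT_comp (measurable_coord i));
    [exact: measurable_fst|exact: measurable_snd].
exact: measurable_dotp.
Qed.

(** Convolving a Gaussian of rate a with the normalized one of rate m gives (m/(m+a))^(d/2)
    exp(-(am/(a+m)) |y|^2). The prefactor increases with m but the exponential decreases; with the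
    rate am/(a+m) replaced by its limit a, the product is monotone in m. *)
Definition damped_kernel (m : R) (z : 'rV[R]_d * R) : R := mixture_weight d n z.2 *
  (Num.sqrt (m / (m + l ^+ 2 * expR (- z.2) / 4)) ^+ d *
     expR (- (l ^+ 2 * expR (- z.2) / 4) * dotp z.1 z.1)).

(* Lower bound of the convolution of the potential with the normalized Gaussian
   of rate m; it increases to the potential as m tends to infinity. *)
Definition damped_potential (m : R) (y : 'rV[R]_d) : \bar R :=
  (\int[leb]_s (damped_kernel m (y, s))%:E)%E.

Let rate (s : R) : R := l ^+ 2 * expR (- s) / 4.

Let measurable_rate : measurable_fun setT rate.
Proof.
by apply: measurable_funM => //; apply: measurable_funM => //; exact: measurable_expRN.
Qed.

Let damping (m s : R) : R := Num.sqrt (m / (m + rate s)) ^+ d.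

Let measurable_damping m : 0 < m -> measurable_fun setT (damping m).
Proof.
move=> m0; apply: measurable_funX.
apply: (measurableT_comp (continuous_measurable_fun (@sqrt_continuous R))).
apply: measurable_funM => //; apply: measurable_invr_ge0; first exact: measurable_funD.
by move=> s; rewrite addr_ge0// ltW// rate_gt0.
Qed.

Let damping_ge0 m s : 0 <= damping m s.
Proof. by rewrite exprn_ge0 ?sqrtr_ge0. Qed.

Let wge0 s : 0 <= mixture_weight d n s.
Proof. exact: mixture_weight_ge0. Qed.

Lemma measurable_damped_kernel m : 0 < m -> measurable_fun setT (damped_kernel m).
Proof.
move=> m0; apply: measurable_funM.
  by apply: (measurableT_comp (measurable_mixture_weight d n)); exact: measurable_snd.
apply: measurable_funM; first by apply: (measurableT_comp (measurable_damping m0)); exact: measurable_snd.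
apply: (measurableT_comp (@measurable_expR R)); apply: measurable_funM.
  by apply: measurable_funN; apply: (measurableT_comp measurable_rate); exact: measurable_snd.
by apply: measurable_dotp; exact: measurable_fst.
Qed.

Lemma damped_kernel_ge0 m z : 0 <= damped_kernel m z.
Proof. by rewrite mulr_ge0// mulr_ge0 ?expR_ge0// damping_ge0. Qed.

Lemma measurable_damped_kernel1 m y : 0 < m -> measurable_fun setT (fun s => damped_kernel m (y, s)).
Proof. by move=> m0; exact: (measurableT_comp (measurable_damped_kernel m0) (measurable_pair1 y)). Qed.

Lemma measurable_damped_potential m : 0 < m -> measurable_fun setT (damped_potential m).
Proof.
move=> m0; apply: (@measurable_fun_fubini_tonelli_F _ _ _ _ _ leb (EFin \o damped_kernel m)).
  by apply/measurable_EFinP; exact: measurable_damped_kernel.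
by move=> z; rewrite lee_fin damped_kernel_ge0.
Qed.

Lemma damped_potential_ge0 m y : (0 <= damped_potential m y)%E.
Proof. by apply: integral_ge0 => s _; rewrite lee_fin damped_kernel_ge0. Qed.

Let damping_le1 m s : 0 < m -> damping m s <= 1.
Proof.
move=> m0; have r0 := rate_gt0 s; rewrite exprn_ile1 ?sqrtr_ge0//.
rewrite -[leRHS]sqrtr1 ler_wsqrtr// ler_pdivrMr ?addr_gt0// mul1r lerDl.
exact: ltW.
Qed.

Lemma damped_potential_le m y : 0 < m -> (damped_potential m y <= (bessel_potential y)%:E)%E.
Proof.
move=> m0; rewrite bessel_potential_integral; apply: ge0_le_integral => //.
- by move=> s _; rewrite lee_fin damped_kernel_ge0.
- by apply/measurable_EFinP; exact: measurable_damped_kernel1.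
- by apply/measurable_EFinP; exact: mixture_integrand_measurable.
move=> s _; rewrite lee_fin ler_wpM2l// -[leRHS]mul1r ler_pM ?expR_ge0//.
  exact: damping_le1.
by rewrite ler_expR le_eqVlt; apply/orP; left; apply/eqP; ring.
Qed.

(** For each s the exact convolution has the rate am/(a+m), which is at most the rate a used in the
    damped kernel. *)
Lemma damped_potential_le_convolution (m : R) (y : 'rV[R]_d) : 0 < m ->
  (damped_potential m y <= \int[mu d]_x (bessel_potential x *
     (Num.sqrt (m / pi) ^+ d * expR (- m * dotp (x - y) (x - y))))%:E)%E.
Proof.
move=> m0.
have mgy : measurable_fun setT (fun x : 'rV[R]_d =>
    Num.sqrt (m / pi) ^+ d * expR (- m * dotp (x - y) (x - y))).
  apply: measurable_funM => //.
  exact: (measurableT_comp (measurable_shifted_gauss m) (measurable_pair2 y)).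
have c0 : 0 <= Num.sqrt (m / pi) ^+ d by rewrite exprn_ge0 ?sqrtr_ge0.
rewrite integral_bessel_potential//.
pose H s := (mixture_weight d n s * (damping m s * expR (- (rate s * m / (rate s + m)) * dotp y y)))%:E.
rewrite [leRHS](_ : _ = \int[leb]_s H s)%E; last first.
  apply: eq_integral => s _; rewrite /H [RHS]EFinM; congr (_ * _)%E.
  have r0 := rate_gt0 s.
  transitivity ((Num.sqrt (m / pi) ^+ d)%:E * \int[mu d]_x (expR (- rate s * dotp x x) *
      expR (- m * dotp (x - y) (x - y)))%:E)%E.
    rewrite -ge0_integralZl//.
    - by apply: eq_integral => x _; rewrite -EFinM mulrCA.
    - apply/measurable_EFinP; apply: measurable_funM; first exact: measurable_gauss_rV.
      exact: (measurableT_comp (measurable_shifted_gauss m) (measurable_pair2 y)).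
  rewrite integral_gauss_convolution ?ltW// -EFinM mulrA; congr (_ * _)%:E.
  rewrite /damping -exprMn -sqrtrM ?divr_ge0 ?pi_ge0 ?ltW//; congr (Num.sqrt _ ^+ _).
  by rewrite (addrC m) mulrA divfK// gt_eqF// pi_gt0.
apply: ge0_le_integral => //.
- by move=> s _; rewrite lee_fin damped_kernel_ge0.
- by apply/measurable_EFinP; exact: measurable_damped_kernel1.
- apply/measurable_EFinP; apply: measurable_funM; first exact: measurable_mixture_weight.
  apply: measurable_funM; first exact: measurable_damping.
  apply: (measurableT_comp (@measurable_expR R)); apply: measurable_funM => //.
  apply: measurable_funN; apply: measurable_funM; first exact: measurable_funM.
  apply: measurable_invr_ge0; first exact: measurable_funD.
  by move=> s; rewrite addr_ge0// ltW// rate_gt0.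
move=> s _; have r0 := rate_gt0 s.
rewrite lee_fin ler_wpM2l// ler_wpM2l ?damping_ge0// ler_expR !mulNr lerN2.
rewrite ler_wpM2r ?dotp_ge0// ler_pdivrMr ?addr_gt0// ler_wpM2l ?ltW//.
by rewrite ltrDr.
Qed.

End bessel_potential.

(** * Lower bound for the L^r norm *)

Section lower_bound_Lp.
Context {R : realType}.
Local Notation leb := (@lebesgue_measure R).
Local Notation mu d := (@lebesgue_rV R d).
Variables (d : nat) (n l : R).
Hypothesis hn : d%:R / 2 < n.
Hypothesis l0 : 0 < l.
Local Notation potential := (@bessel_potential R d n l).
Local Notation damped := (@damped_potential R d n l).
Local Notation kernel := (@damped_kernel R d n l).

Lemma damped_kernel_nondecreasing y s :
  nondecreasing_seq (fun k : nat => kernel k.+1%:R (y, s)).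
Proof.
move=> i j ij; rewrite /damped_kernel/= ler_wpM2l ?mixture_weight_ge0// ler_wpM2r ?expR_ge0//.
rewrite lerXn2r ?nnegrE ?sqrtr_ge0// ler_wsqrtr//.
have a0 : 0 < l ^+ 2 * expR (- s) / 4 by rewrite divr_gt0// mulr_gt0 ?exprn_gt0 ?expR_gt0.
rewrite ler_pdivrMr ?addr_gt0// mulrAC ler_pdivlMr ?addr_gt0//.
rewrite !mulrDr mulrC lerD2l ler_wpM2r ?ler_nat//.
exact: ltW.
Qed.

Lemma damped_kernel_cvg (y : 'rV[R]_d) s : kernel k.+1%:R (y, s) @[k --> \oo] -->
  mixture_weight d n s * expR (- (expR (- s) / 4) * (l ^+ 2 * dotp y y)).
Proof.
rewrite /damped_kernel/=; set a := l ^+ 2 * expR (- s) / 4.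
have a0 : 0 < a by rewrite divr_gt0// mulr_gt0 ?exprn_gt0 ?expR_gt0.
have -> : - (expR (- s) / 4) * (l ^+ 2 * dotp y y) = - a * dotp y y by rewrite /a; ring.
apply: cvgMl_tmp; rewrite -[X in _ --> X]mul1r; apply: cvgMr_tmp.
have h : (1 + a * harmonic k)^-1 @[k --> \oo] --> (1 : R).
  rewrite -[X in _ --> X]invr1; apply: cvgV; first exact: oner_neq0.
  rewrite -[X in _ --> X]addr0; apply: cvgD; first exact: cvg_cst.
  by rewrite -[X in _ --> X](mulr0 a); apply: cvgMl_tmp; exact: cvg_harmonic.
have -> : (fun k : nat => Num.sqrt (k.+1%:R / (k.+1%:R + a)) ^+ d) =
    (fun x => Num.sqrt x ^+ d) \o (fun k : nat => (1 + a * harmonic k)^-1).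
  apply/funext => k; congr (Num.sqrt _ ^+ _); rewrite /harmonic/=.
  have k0 : 0 < k.+1%:R :> R by rewrite ltr0n.
  by rewrite -invf_div mulrDl mulfV// gt_eqF.
have c1 : {for (1 : R), continuous (fun x : R => Num.sqrt x ^+ d)}.
  apply: (@continuous_comp _ _ _ (@Num.sqrt R) (fun x => x ^+ d)).
    exact: sqrt_continuous.
  exact: exprn_continuous.
by have := continuous_cvg _ c1 h; rewrite sqrtr1 expr1n; apply.
Qed.

Lemma damped_potential_cvg (y : 'rV[R]_d) :
  damped k.+1%:R y @[k --> \oo] --> (potential y)%:E.
Proof.
rewrite bessel_potential_integral//.
rewrite [X in _ --> X](_ : _ = \int[leb]_s limn (fun k => (kernel k.+1%:R (y, s))%:E))%E.
  apply: cvg_monotone_convergence => //.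
  - by move=> k; apply/measurable_EFinP; exact: measurable_damped_kernel1.
  - by move=> k s _; rewrite lee_fin damped_kernel_ge0.
  - by move=> s _ i j ij; rewrite lee_fin damped_kernel_nondecreasing.
apply: eq_integral => s _; apply/esym/cvg_lim => //.
apply: cvg_EFin; first exact: nearW.
exact: damped_kernel_cvg.
Qed.

Lemma continuous_powRl (r a : R) : 0 < a -> {for a, continuous (@powR R ^~ r)}.
Proof.
move=> a0; apply/differentiable_continuous/derivable1_diffP.
by apply: derivable_powR; rewrite in_itv/= a0.
Qed.

Let damped_fin k (y : 'rV[R]_d) : damped k.+1%:R y = (fine (damped k.+1%:R y))%:E.
Proof.
rewrite fineK// ge0_fin_numE ?damped_potential_ge0//.
by apply: le_lt_trans (ltry (potential y)); exact: damped_potential_le.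
Qed.

Lemma damped_potential_nondecreasing (y : 'rV[R]_d) :
  nondecreasing_seq (fun k : nat => fine (damped k.+1%:R y)).
Proof.
move=> i j ij; rewrite -lee_fin -!damped_fin; apply: ge0_le_integral => //.
- by move=> s _; rewrite lee_fin damped_kernel_ge0.
- by apply/measurable_EFinP; exact: measurable_damped_kernel1.
- by apply/measurable_EFinP; exact: measurable_damped_kernel1.
by move=> s _; rewrite lee_fin damped_kernel_nondecreasing.
Qed.

Lemma damped_powR_cvg (r : R) (y : 'rV[R]_d) : 0 < r ->
  fine (damped k.+1%:R y) `^ r @[k --> \oo] --> potential y `^ r.
Proof.
move=> r0; have /fine_cvgP[_ h] := @damped_potential_cvg y.
have : 0 <= potential y by exact: bessel_potential_ge0.
(* Continuity of the power is used at positive bases only. If the potential vanishes at [y], the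
   damped potentials lie between 0 and 0. *)
rewrite le_eqVlt => /predU1P[p0|p0].
  rewrite -p0 (_ : (fun k => _) = cst (0 `^ r)); first exact: cvg_cst.
  apply/funext => k /=; congr (_ `^ _); apply/eqP; rewrite eq_le fine_ge0 ?damped_potential_ge0//.
  by rewrite andbT p0 -lee_fin -damped_fin damped_potential_le.
have hp := @continuous_powRl r _ p0.
by apply: (@continuous_cvg _ _ _ _ _ _ (@powR R ^~ r)); [exact: hp|exact: h].
Qed.

(* Jensen's inequality for the Gaussian probability measure, in the form of
   Young's inequality r c^(r-1) a <= a^r + (r-1) c^r. *)
Lemma powR_le_of_mean (disp : measure_display) (T : measurableType disp)
    (m : {measure set T -> \bar R}) (a G : T -> R) (r c : R) : 1 < r -> 0 <= c ->
  measurable_fun setT a -> measurable_fun setT G ->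
  (forall x, 0 <= a x) -> (forall x, 0 <= G x) ->
  (\int[m]_x (G x)%:E = 1)%E -> (c%:E <= \int[m]_x (a x * G x)%:E)%E ->
  ((c `^ r)%:E <= \int[m]_x (a x `^ r * G x)%:E)%E.
Proof.
move=> r1 c0 ma mG a0 G0 G1 ca; have r0 : 0 < r by lra.
have mar : measurable_fun setT (fun x => a x `^ r).
  by apply: (measurableT_comp (@measurable_powR R r)).
have [->|cn0] := eqVneq c 0.
  rewrite powR0 ?gt_eqF//; apply: integral_ge0 => x _.
  by rewrite lee_fin mulr_ge0 ?powR_ge0.
have cp : 0 < c by rewrite lt_neqAle eq_sym cn0.
have cr : c `^ (r - 1) * c = c `^ r by rewrite mulrC mulr_powRB1.
(* Young's inequality for a(x) and c^(r-1) with the conjugate exponents r and r/(r-1), multiplied by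
   r. *)
have young x : r * c `^ (r - 1) * a x <= a x `^ r + (r - 1) * c `^ r.
  have := @conjugate_powR R (a x) (c `^ (r - 1)) r (r / (r - 1)) (a0 x) (powR_ge0 _ _) r0.
  rewrite -powRrM divr_gt0 ?subr_gt0// => /(_ isT).
  have -> : (r - 1) * (r / (r - 1)) = r by field; lra.
  have -> : r^-1 + (r / (r - 1))^-1 = 1 by field; apply/andP; split; lra.
  move=> /(_ erefl) h; have := ler_wpM2l (ltW r0) h.
  have -> : r * (a x `^ r / r + c `^ r / (r / (r - 1))) = a x `^ r + (r - 1) * c `^ r.
    by field; apply/andP; split; lra.
  by rewrite (mulrCA r) (mulrC (a x)).
have K0 : 0 <= r * c `^ (r - 1) by rewrite mulr_ge0 ?powR_ge0// ltW.
have h1 : ((r * c `^ (r - 1))%:E * c%:E <=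
    \int[m]_x (a x `^ r * G x)%:E + ((r - 1) * c `^ r)%:E)%E.
  apply: (@le_trans _ _ ((r * c `^ (r - 1))%:E * \int[m]_x (a x * G x)%:E)%E).
    by apply: lee_wpmul2l; rewrite ?lee_fin.
  rewrite -ge0_integralZl//; last 2 first.
  - by apply/measurable_EFinP; exact: measurable_funM.
  - by move=> x _; rewrite lee_fin mulr_ge0.
  rewrite [in leRHS](_ : ((r - 1) * c `^ r)%:E = ((r - 1) * c `^ r)%:E * \int[m]_x (G x)%:E)%E; last first.
    by rewrite G1 mule1.
  have k2 : 0 <= (r - 1) * c `^ r by rewrite mulr_ge0 ?powR_ge0// subr_ge0 ltW.
  rewrite -ge0_integralZl//; last 2 first.
  - exact/measurable_EFinP.
  - by move=> x _; rewrite lee_fin.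
  rewrite -ge0_integralD//; last 4 first.
  - by move=> x _; rewrite lee_fin mulr_ge0 ?powR_ge0.
  - by apply/measurable_EFinP; exact: measurable_funM.
  - by move=> x _; rewrite -EFinM lee_fin mulr_ge0.
  - by apply/measurable_EFinP; exact: measurable_funM.
  apply: ge0_le_integral => //.
  - by move=> x _; rewrite -EFinM lee_fin mulr_ge0// mulr_ge0.
  - by apply/measurable_EFinP; apply: measurable_funM => //; exact: measurable_funM.
  - by apply/measurable_EFinP; apply: measurable_funD; exact: measurable_funM.
  move=> x _; rewrite -!EFinM -EFinD lee_fin mulrA -mulrDl.
  exact: ler_wpM2r.
(* If the mean of a^r is infinite the claim is immediate; otherwise r c^r <= z + (r-1) c^r, which
   cancels to the claim. *)
move: h1; case: (\int[m]_x _)%E => [z| |]; rewrite ?leey//.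
by rewrite -EFinM -EFinD !lee_fin -mulrA cr; lra.
Qed.

Lemma integral_shifted_gauss (m : R) (x : 'rV[R]_d) : 0 < m ->
  (\int[mu d]_y (Num.sqrt (m / pi) ^+ d * expR (- m * dotp (y - x) (y - x)))%:E = 1)%E.
Proof.
move=> m0; have c0 : 0 <= Num.sqrt (m / pi) ^+ d by rewrite exprn_ge0 ?sqrtr_ge0.
transitivity ((Num.sqrt (m / pi) ^+ d)%:E * \int[mu d]_y
    (expR (- 0 * dotp y y) * expR (- m * dotp (y - x) (y - x)))%:E)%E.
  rewrite -ge0_integralZl//.
    by apply: eq_integral => y _; rewrite -EFinM oppr0 mul0r expR0 mul1r.
  apply/measurable_EFinP; apply: measurable_funM; first exact: measurable_gauss_rV.
  exact: (measurableT_comp (measurable_shifted_gauss m) (measurable_pair2 x)).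
rewrite integral_gauss_convolution// !mul0r oppr0 !mul0r expR0 mulr1 add0r -EFinM.
rewrite -exprMn -sqrtrM ?divr_ge0 ?pi_ge0 ?ltW//.
have -> : m / pi * (pi / m) = 1 :> R by rewrite mulrA divfK ?divff ?gt_eqF ?pi_gt0.
by rewrite sqrtr1 expr1n.
Qed.

Lemma dotp_subC (x y : 'rV[R]_d) : dotp (x - y) (x - y) = dotp (y - x) (y - x).
Proof. by apply: eq_bigr => i _; rewrite !mxE; ring. Qed.

Lemma integral_potential_powR_le (a : 'rV[R]_d -> R) (r : R) : 1 < r ->
  measurable_fun setT a -> (forall x, 0 <= a x) ->
  (forall (m : R) (y : 'rV[R]_d), 0 < m ->
    (\int[mu d]_x (potential x * (Num.sqrt (m / pi) ^+ d * expR (- m * dotp (x - y) (x - y))))%:E <=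
    \int[mu d]_x (a x * (Num.sqrt (m / pi) ^+ d * expR (- m * dotp (x - y) (x - y))))%:E)%E) ->
  (\int[mu d]_x (potential x `^ r)%:E <= \int[mu d]_x (a x `^ r)%:E)%E.
Proof.
move=> r1 ma a0 hconv; have r0 : 0 < r by lra.
have mar : measurable_fun setT (fun x => a x `^ r).
  by apply: (measurableT_comp (@measurable_powR R r)).
pose G m (z : 'rV[R]_d * 'rV[R]_d) := Num.sqrt (m / pi) ^+ d * expR (- m * dotp (z.1 - z.2) (z.1 - z.2)).
have G0 m z : 0 <= G m z by rewrite mulr_ge0 ?expR_ge0 ?exprn_ge0 ?sqrtr_ge0.
have mG m : measurable_fun setT (G m).
  by apply: measurable_funM => //; exact: measurable_shifted_gauss.
have mG2 m y : measurable_fun setT (fun x => G m (x, y)).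
  exact: (measurableT_comp (mG m) (measurable_pair2 y)).
have mG1 m x : measurable_fun setT (fun y => G m (x, y)).
  exact: (measurableT_comp (mG m) (measurable_pair1 x)).
have step k : (\int[mu d]_y (fine (damped k.+1%:R y) `^ r)%:E <= \int[mu d]_x (a x `^ r)%:E)%E.
  have m0 : 0 < k.+1%:R :> R by rewrite ltr0n.
  pose F (z : 'rV[R]_d * 'rV[R]_d) := (a z.1 `^ r * G k.+1%:R z)%:E.
  have mF : measurable_fun setT F.
    apply/measurable_EFinP; apply: measurable_funM => //.
    by apply: (measurableT_comp mar); exact: measurable_fst.
  have F0 z : (0 <= F z)%E by rewrite lee_fin mulr_ge0 ?powR_ge0.
  apply: (@le_trans _ _ (\int[mu d]_y \int[mu d]_x F (x, y))%E).
    apply: ge0_le_integral => //.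
    - by move=> y _; rewrite lee_fin powR_ge0.
    - apply/measurable_EFinP; apply: (measurableT_comp (@measurable_powR R r)).
      by apply: measurableT_comp => //; exact: measurable_damped_potential.
    - exact: (measurable_fun_fubini_tonelli_G F).
    move=> y _; apply: powR_le_of_mean => //.
    - by rewrite fine_ge0 ?damped_potential_ge0.
    - exact: integral_shifted_gauss.
    rewrite -damped_fin; apply: (le_trans _ (hconv _ y m0)).
    exact: damped_potential_le_convolution.
  rewrite -fubini_tonelli//; apply: ge0_le_integral => //.
  - by move=> x _; exact: integral_ge0.
  - exact: (measurable_fun_fubini_tonelli_F F).
  - by apply/measurable_EFinP; exact: mar.
  move=> x _; rewrite /F/=; under eq_integral => y _ do rewrite EFinM.
  rewrite ge0_integralZl//; last 3 first.
  - by apply/measurable_EFinP; exact: mG1.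
  - by move=> y _; rewrite lee_fin.
  - by rewrite lee_fin powR_ge0.
  (* The Gaussian is symmetric in its two points, so it also has mass one as a function of its
     centre, and the average of a^r has the same integral as a^r. *)
  rewrite (_ : \int[mu d]_y (G k.+1%:R (x, y))%:E = 1)%E ?mule1//.
  apply: etrans (@integral_shifted_gauss k.+1%:R x m0).
  by apply: eq_integral => y _; rewrite /G/= dotp_subC.
have lim : (\int[mu d]_y (fine (damped k.+1%:R y) `^ r)%:E @[k --> \oo] -->
    \int[mu d]_x (potential x `^ r)%:E)%E.
  rewrite [X in _ --> X](_ : _ = \int[mu d]_y limn (fun k => (fine (damped k.+1%:R y) `^ r)%:E))%E.
    apply: cvg_monotone_convergence => //.
    - move=> k; apply/measurable_EFinP; apply: (measurableT_comp (@measurable_powR R r)).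
      by apply: measurableT_comp => //; exact: measurable_damped_potential.
    - by move=> k y _; rewrite lee_fin powR_ge0.
    - move=> y _ i j ij; rewrite lee_fin ge0_ler_powR ?nnegrE ?fine_ge0 ?damped_potential_ge0 ?(ltW r0)//.
      exact: damped_potential_nondecreasing.
  apply: eq_integral => y _; apply/esym/cvg_lim => //.
  by apply: cvg_EFin; [exact: nearW|exact: damped_powR_cvg].
rewrite -(cvg_lim _ lim)//; apply: lime_le; first by apply/cvg_ex; eexists; exact: lim.
exact: nearW.
Qed.

End lower_bound_Lp.

Lemma EFin_Rintegral (R : realType) (disp : measure_display) (T : measurableType disp)
    (m : {measure set T -> \bar R}) (f : T -> R) : m.-integrable setT (EFin \o f) ->
  (\int[m]_x f x)%:E = (\int[m]_x (f x)%:E)%E.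
Proof. by move=> fi; rewrite /Rintegral fineK//; exact: integrable_fin_num fi. Qed.

(** * Duality between the potential and its symbol *)

Section bessel_distribution.
Context {R : realType}.
Local Notation leb := (@lebesgue_measure R).
Local Notation mu d := (@lebesgue_rV R d).
Variables (d : nat) (n l : R).
Hypothesis hn : d%:R / 2 < n.
Hypothesis l0 : 0 < l.
Local Notation Rd := 'rV[R]_d.
Local Notation potential := (@bessel_potential R d n l).
Local Notation symbol := (@bessel_symbol R d n l).

Let n0 : 0 < n := dim_lt_n0 hn.

Lemma measurable_japanese (a p : R) :
  measurable_fun setT (fun k : Rd => (1 + dotp k k * a) `^ p).
Proof.
apply: (measurableT_comp (@measurable_powR R p)); apply: measurable_funD => //.
by apply: measurable_funM => //; exact: measurable_dotp.
Qed.

(** Writing (1+|k|^2)^(-n) as a Gamma integral of Gaussians and exchanging, the integral over k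
    contributes pi^(d/2) e^(-ds/2), which leaves a multiple of Gamma(n - d/2). *)
Lemma integrable_japanese :
  (mu d).-integrable setT (EFin \o (fun k => (1 + dotp k k) `^ (- n))).
Proof.
have mj : measurable_fun setT (fun k : Rd => (1 + dotp k k) `^ (- n)).
  have := @measurable_japanese 1 (- n); congr (measurable_fun _ _).
  by apply/funext => k; rewrite mulr1.
apply/integrableP; split; first exact/measurable_EFinP.
under eq_integral => k _ do rewrite gee0_abs ?lee_fin ?powR_ge0//.
have G0 := Gamma_gt0 n0.
pose K (z : Rd * R) := (expR (n * z.2 - expR z.2) * expR (- (expR z.2) * dotp z.1 z.1))%:E.
have mK : measurable_fun setT K.
  apply/measurable_EFinP; apply: measurable_funM.
    by apply: (measurableT_comp (measurable_log_gamma n)); exact: measurable_snd.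
  apply: (measurableT_comp (@measurable_expR R)); apply: measurable_funM.
    apply: measurable_funN; apply: (measurableT_comp (@measurable_expR R)).
    exact: measurable_snd.
  by apply: measurable_dotp; exact: measurable_fst.
have K0 z : (0 <= K z)%E by rewrite lee_fin mulr_ge0 ?expR_ge0.
have -> : (\int[mu d]_k ((1 + dotp k k) `^ (- n))%:E =
    (Gamma n)^-1%:E * \int[mu d]_k \int[leb]_s K (k, s))%E.
  rewrite -ge0_integralZl//; last 3 first.
  - by apply: (@measurable_fun_fubini_tonelli_F _ _ _ _ _ leb K).
  - by move=> k _; exact: integral_ge0.
  - by rewrite lee_fin invr_ge0 ltW.
  apply: eq_integral => k _.
  rewrite (_ : \int[leb]_s K (k, s) = ((1 + dotp k k) `^ (- n) * Gamma n)%:E)%E.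
    by rewrite -EFinM mulrCA mulVf ?mulr1// gt_eqF.
  rewrite -(integral_log_gamma_scaled hn) ?ltr_wpDr ?dotp_ge0//.
  by apply: eq_integral => s _; rewrite /K/= -expRD; congr (expR _)%:E; ring.
rewrite fubini_tonelli//.
have -> : (\int[leb]_s \int[mu d]_k K (k, s) =
    \int[leb]_s ((Num.sqrt pi ^+ d)%:E * (expR ((n - d%:R / 2) * s - expR s))%:E))%E.
  apply: eq_integral => s _; transitivity ((expR (n * s - expR s))%:E *
      \int[mu d]_k (expR (- (expR s) * dotp k k))%:E)%E.
    rewrite -ge0_integralZl//; first by apply/measurable_EFinP; exact: measurable_gauss_rV.
  rewrite integral_gauss_rV ?expR_gt0// -!EFinM; congr EFin.
  rewrite sqrtrM ?pi_ge0// exprMn mulrCA; congr (_ * _).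
  have -> : Num.sqrt (expR s)^-1 = expR (- (s / 2)).
    rewrite -[RHS]ger0_norm ?expR_ge0// -sqrtr_sqr; congr Num.sqrt.
    by rewrite -expRM_natl -expRN; congr expR; field.
  by rewrite -expRM_natl -expRD; congr expR; field.
rewrite ge0_integralZl//; last by apply/measurable_EFinP; exact: measurable_log_gamma.
by rewrite -/(log_gamma_integral _) log_gamma_integralE ?subr_gt0// -!EFinM ltry.
Qed.

Lemma integrable_normr (f : Rd -> R) : (mu d).-integrable setT (EFin \o f) ->
  (\int[mu d]_x (`|f x|)%:E < +oo)%E.
Proof. by move=> /integrableP[]. Qed.

Lemma integrable_measurable (f : Rd -> R) : (mu d).-integrable setT (EFin \o f) ->
  measurable_fun setT f.
Proof. by move=> /integrableP[/measurable_EFinP]. Qed.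

Lemma measurable_bessel_symbol : measurable_fun setT symbol.
Proof. by apply: measurable_funM => //; exact: measurable_japanese. Qed.

Lemma integrable_symbolM (a : Rd -> R) : (mu d).-integrable setT (EFin \o a) ->
  (mu d).-integrable setT (EFin \o (fun k => symbol k * a k)).
Proof.
move=> ia; have := integrableZl_EFin (l ^- d) ia; apply: le_integrable => //.
  apply/measurable_EFinP; apply: measurable_funM; first exact: measurable_bessel_symbol.
  exact: integrable_measurable.
move=> k _; rewrite /= lee_fin normrM [leRHS]normrM; apply: ler_wpM2r => //.
by rewrite ger0_norm ?bessel_symbol_ge0// (le_trans _ (ler_norm _))// bessel_symbol_le.
Qed.

Section parseval.
Variables (a : Rd -> R) (th : R).
Hypothesis ia : (mu d).-integrable setT (EFin \o a).

Let F (z : Rd * Rd) : \bar R := (potential z.1 * (a z.2 * cos (dotp z.1 z.2 + th)))%:E.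

Let ma : measurable_fun setT a := integrable_measurable ia.

Let mF : measurable_fun setT F.
Proof.
apply/measurable_EFinP; apply: measurable_funM.
  by apply: (measurableT_comp (measurable_bessel_potential l hn)); exact: measurable_fst.
apply: measurable_funM; first by apply: (measurableT_comp ma); exact: measurable_snd.
apply: (measurableT_comp (continuous_measurable_fun (@continuous_cos R))).
apply: measurable_funD => //.
by apply: measurable_dotp; [exact: measurable_fst|exact: measurable_snd].
Qed.

Let iF : (mu d \x mu d)%E.-integrable setT F.
Proof.
apply/integrable12ltyP => //.
(* As |cos| <= 1, the kernel is dominated by potential(x) |a(k)|, a product of integrable functions
   of separate variables. *)
apply: (@le_lt_trans _ _ (\int[mu d]_x ((potential x)%:E * \int[mu d]_k (`|a k|)%:E))%E).
  apply: ge0_le_integral => //.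
  - by move=> x _; exact: integral_ge0.
  - apply: (@measurable_fun_fubini_tonelli_F _ _ _ _ _ (mu d) (abse \o F)).
      exact: measurableT_comp.
    by move=> z; exact: abse_ge0.
  - by apply: emeasurable_funM => //; apply/measurable_EFinP; exact: measurable_bessel_potential.
  move=> x _; rewrite -ge0_integralZl//; last 2 first.
  - by apply/measurable_EFinP; exact: measurableT_comp.
  - by rewrite lee_fin bessel_potential_ge0.
  apply: ge0_le_integral => //.
  - by apply: measurableT_comp => //; exact: (measurableT_comp mF (measurable_pair1 x)).
  - by apply/measurable_EFinP; apply: measurable_funM => //; exact: measurableT_comp.
  move=> k _; rewrite -EFinM lee_fin normrM ger0_norm ?bessel_potential_ge0//.
  by rewrite ler_wpM2l ?bessel_potential_ge0// normrM ler_piMr// cos_max.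
have Ia0 : (0 <= \int[mu d]_k (`|a k|)%:E)%E by apply: integral_ge0 => k _; rewrite lee_fin.
have Ia : (\int[mu d]_k (`|a k|)%:E)%E \is a fin_num.
  by rewrite ge0_fin_numE//; exact: integrable_normr.
rewrite ge0_integralZr//; last 2 first.
- by apply/measurable_EFinP; exact: measurable_bessel_potential.
- by move=> x _; rewrite lee_fin bessel_potential_ge0.
rewrite lte_mul_pinfty//.
- by apply: integral_ge0 => x _; rewrite lee_fin bessel_potential_ge0.
- rewrite ge0_fin_numE; last by apply: integral_ge0 => x _; rewrite lee_fin bessel_potential_ge0.
  exact: integral_bessel_potential_lty.
by rewrite -ge0_fin_numE.
Qed.

Lemma integrable_mul_cos (x : Rd) : (mu d).-integrable setT (EFin \o (fun k => a k * cos (dotp x k + th))).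
Proof.
apply: (le_integrable measurableT _ _ ia).
  apply/measurable_EFinP; apply: measurable_funM => //.
  apply: (measurableT_comp (continuous_measurable_fun (@continuous_cos R))).
  by apply: measurable_funD => //; apply: measurable_dotp.
by move=> k _; rewrite /= lee_fin normrM ler_piMr// cos_max.
Qed.

Let transformE (x : Rd) :
  (potential x * \int[mu d]_k (a k * cos (dotp x k + th)))%:E = (\int[mu d]_k F (x, k))%E.
Proof.
rewrite EFinM (EFin_Rintegral (integrable_mul_cos x)).
by rewrite -integralZl//; exact: integrable_mul_cos.
Qed.

Lemma integrable_potential_transform : (mu d).-integrable setT
  (EFin \o (fun x => potential x * \int[mu d]_k (a k * cos (dotp x k + th)))).
Proof.
have := integrable_fubini_F iF; apply: eq_integrable => // x _.
exact/esym/transformE.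
Qed.

(** Fubini moves the cosine transform from [a] to the potential, where it is known. The phase 0
    gives the cosine part; the phase -pi/2 gives the sine part, which is 0 since the potential is
    even. *)
Lemma Rintegral_potential_transform :
  \int[mu d]_x (potential x * \int[mu d]_k (a k * cos (dotp x k + th))) =
  Num.sqrt (2 * pi) ^+ d * (cos th * \int[mu d]_k (symbol k * a k)).
Proof.
have isa := integrable_symbolM ia.
have ics := integrableZl_EFin (cos th) isa.
apply: EFin_inj; rewrite (EFin_Rintegral integrable_potential_transform).
rewrite -RintegralZl// -RintegralZl// (EFin_Rintegral (integrableZl_EFin _ ics)).
transitivity (\int[mu d]_x \int[mu d]_k F (x, k))%E.
  by apply: eq_integral => x _; rewrite -transformE.
rewrite Fubini//; apply: eq_integral => k _.
have ipc : (mu d).-integrable setT (EFin \o (fun x => potential x * cos (dotp x k + th))).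
  apply: (integrable_bessel_potentialM hn l0 (C := 1)); first exact: measurable_cos_dotp.
  by move=> x; exact: cos_max.
rewrite (_ : Num.sqrt (2 * pi) ^+ d * (cos th * (symbol k * a k)) =
   a k * (Num.sqrt (2 * pi) ^+ d * (symbol k * cos th))); last by ring.
rewrite -(Rintegral_bessel_potential_cos hn l0) EFinM (EFin_Rintegral ipc) -integralZl//.
by apply: eq_integral => x _; rewrite /F/= -EFinM; congr EFin; ring.
Qed.

End parseval.
End bessel_distribution.

(** * The distribution of the Bessel potential *)

Section complex_real_factor.
Context {R : realType}.
Implicit Types (a : R) (z : R[i]).

Lemma Re_realM a z : complex.Re (a%:C%C * z) = a * complex.Re z.
Proof. by case: z => x y /=; rewrite mul0r subr0. Qed.

Lemma Im_realM a z : complex.Im (a%:C%C * z) = a * complex.Im z.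
Proof. by case: z => x y /=; rewrite mul0r addr0. Qed.

Lemma normc_nneg_real a : 0 <= a -> ComplexField.Normc.normc a%:C%C = a.
Proof. by move=> a0; rewrite normc_real expr0n addr0 sqrtr_sqr ger0_norm. Qed.

Lemma measurable_normc (disp : measure_display) (T : measurableType disp) (g : T -> R[i]) :
  measurable_fun setT (fun x => complex.Re (g x)) ->
  measurable_fun setT (fun x => complex.Im (g x)) ->
  measurable_fun setT (fun x => ComplexField.Normc.normc (g x)).
Proof.
move=> mRe mIm; rewrite (_ : (fun _ => _) =
    (fun x => Num.sqrt (complex.Re (g x) ^+ 2 + complex.Im (g x) ^+ 2))); last first.
  by apply/funext => x; case: (g x) => a b; rewrite normc_real.
apply: (measurableT_comp (continuous_measurable_fun (@sqrt_continuous R))).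
by apply: measurable_funD; exact: measurable_funX.
Qed.

End complex_real_factor.

Lemma Rintegral_lincomb (R : realType) (disp : measure_display) (T : measurableType disp)
    (m : {measure set T -> \bar R}) (f g h : T -> R) (s t : R) :
  m.-integrable setT (EFin \o f) -> m.-integrable setT (EFin \o g) ->
  m.-integrable setT (EFin \o h) ->
  \int[m]_x (s * f x + t * g x + h x) =
  s * (\int[m]_x f x) + t * (\int[m]_x g x) + \int[m]_x h x.
Proof.
move=> fi gi hi; have sf := integrableZl_EFin s fi; have tg := integrableZl_EFin t gi.
have stfg : m.-integrable setT (EFin \o (fun x => s * f x + t * g x)).
  by have := integrableD measurableT sf tg; apply: eq_integrable.
by rewrite RintegralD// RintegralD// !RintegralZl.
Qed.

Lemma Rintegral0 (R : realType) (disp : measure_display) (T : measurableType disp)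
    (m : {measure set T -> \bar R}) : \int[m]_x (0 : R) = 0.
Proof. by rewrite /Rintegral integral0. Qed.

Section potential_distribution.
Context {R : realType}.
Local Notation mu d := (@lebesgue_rV R d).
Variables (d : nat) (n l : R).
Hypothesis hn : d%:R / 2 < n.
Hypothesis l0 : 0 < l.
Local Notation Rd := 'rV[R]_d.
Local Notation potential := (@bessel_potential R d n l).
Local Notation symbol := (@bessel_symbol R d n l).
Local Notation cmod := ComplexField.Normc.normc.

Definition potential_distribution (phi : Rd -> R[i]) : R[i] :=
  cintegral (fun x => (potential x)%:C%C * phi x).

Lemma potential_distributionE phi : potential_distribution phi =
  (\int[mu d]_x (potential x * complex.Re (phi x)) +i*
   \int[mu d]_x (potential x * complex.Im (phi x)))%C.
Proof.
rewrite /potential_distribution /cintegral; congr (_ +i* _)%C.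
  by apply: eq_Rintegral => x _; rewrite Re_realM.
by apply: eq_Rintegral => x _; rewrite Im_realM.
Qed.

Lemma schwartz_bounded (phi : Rd -> R[i]) : schwartz phi -> exists2 C, 0 <= C &
  C%:E = schwartz_seminorm 0 phi /\ forall x, cmod (phi x) <= C.
Proof.
move=> sphi; have [_ [_ /(_ 0%N)]] := sphi; have := normc_le_seminorm 0 phi.
case: schwartz_seminorm => [C|//|] h _; last by have := h 0; rewrite leeNy_eq.
have hC x : cmod (phi x) <= C by have := h x; rewrite expr0 mul1r lee_fin.
by exists C; [exact: le_trans (normc_nneg _) (hC 0)|].
Qed.

Lemma potential_integral_le (g : Rd -> R) (C : R) : measurable_fun setT g ->
  (forall x, `|g x| <= C) ->
  `|\int[mu d]_x (potential x * g x)| <= C * \int[mu d]_x potential x.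
Proof.
move=> mg gC; have ip := integrable_bessel_potential hn l0.
apply: le_trans (le_normr_Rintegral _ _) _ => //.
  exact: (integrable_bessel_potentialM hn l0 mg gC).
rewrite -RintegralZl//; apply: le_Rintegral => //.
- exact: (integrable_abse (integrable_bessel_potentialM hn l0 mg gC)).
- exact: integrableZl_EFin.
move=> x _; rewrite normrM ger0_norm ?bessel_potential_ge0// mulrC.
by rewrite ler_wpM2r ?bessel_potential_ge0.
Qed.

Lemma integrable_potential_schwartz (phi : Rd -> R[i]) : schwartz phi ->
  (mu d).-integrable setT (EFin \o (fun x => potential x * complex.Re (phi x))) /\
  (mu d).-integrable setT (EFin \o (fun x => potential x * complex.Im (phi x))).
Proof.
move=> sphi; have [C C0 [_ hC]] := schwartz_bounded sphi; split.
  apply: (integrable_bessel_potentialM hn l0 (C := C)); first exact: schwartz_measurable_Re.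
  by move=> x; exact: le_trans (Re_le_normc _) _.
apply: (integrable_bessel_potentialM hn l0 (C := C)); first exact: schwartz_measurable_Im.
by move=> x; exact: le_trans (Im_le_normc _) _.
Qed.

Lemma tempered_potential : tempered potential_distribution.
Proof.
split.
  move=> [s t] phi psi sphi spsi.
  have [Rphi Iphi] := integrable_potential_schwartz sphi.
  have [Rpsi Ipsi] := integrable_potential_schwartz spsi.
  rewrite !potential_distributionE; congr (_ +i* _)%C.
    transitivity (\int[mu d]_x (s * (potential x * complex.Re (phi x)) +
        (- t) * (potential x * complex.Im (phi x)) + potential x * complex.Re (psi x))).
      apply: eq_Rintegral => x _; case: (phi x) (psi x) => [a b] [a' b'] /=; ring.
    by rewrite Rintegral_lincomb// mulNr.
  transitivity (\int[mu d]_x (s * (potential x * complex.Im (phi x)) +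
      t * (potential x * complex.Re (phi x)) + potential x * complex.Im (psi x))).
    apply: eq_Rintegral => x _; case: (phi x) (psi x) => [a b] [a' b'] /=; ring.
  by rewrite Rintegral_lincomb.
(* The seminorm of order 0 bounds |phi|; the real and the imaginary part each contribute one
   integral of the potential, hence the 2. *)
exists (2 * \int[mu d]_x potential x), 0%N => phi sphi.
have [C C0 [<- hC]] := schwartz_bounded sphi.
rewrite -EFinM lee_fin potential_distributionE (le_trans (normc_le_sum _))//=.
rewrite -mulrA mulr_natl mulr2n mulrC lerD//; apply: potential_integral_le => [|x].
- exact: schwartz_measurable_Re.
- exact: le_trans (Re_le_normc _) _.
- exact: schwartz_measurable_Im.
- exact: le_trans (Im_le_normc _) _.
Qed.

(** Gaussians are real Schwartz functions, so they may test [g]. The real part of the identity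
    compares the potential with Re g, and |Re g| <= |g| brings in the modulus. *)
Lemma represents_potential_powR_le (g : Rd -> R[i]) (r : R) : 1 < r ->
  represents potential_distribution g ->
  (\int[mu d]_x (potential x `^ r)%:E <= \int[mu d]_x (cmod (g x) `^ r)%:E)%E.
Proof.
move=> r1 [mRe [mIm hg]].
have mg : measurable_fun setT (fun x => cmod (g x)).
  exact: measurable_normc.
apply: (integral_potential_powR_le hn l0) => // [x|m y m0]; first exact: normc_nneg.
have c0 : 0 <= Num.sqrt (m / pi) ^+ d by rewrite exprn_ge0.
pose e x := expR (- m * dotp (x - y) (x - y)).
have me : measurable_fun setT e.
  have := measurableT_comp (@measurable_shifted_gauss R d m) (@measurable_pair2 _ _ Rd Rd y).
  exact.
have mp := measurable_bessel_potential l hn.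
suff : (\int[mu d]_x (potential x * e x)%:E <= \int[mu d]_x (cmod (g x) * e x)%:E)%E.
  move=> h; have := lee_wpmul2l _ h; move=> /(_ (Num.sqrt (m / pi) ^+ d)%:E).
  rewrite lee_fin c0 => /(_ isT).
  rewrite -!ge0_integralZl//; last 4 first.
  - by apply/measurable_EFinP; exact: measurable_funM.
  - by move=> x _; rewrite lee_fin mulr_ge0 ?normc_nneg ?expR_ge0.
  - by apply/measurable_EFinP; exact: measurable_funM.
  - by move=> x _; rewrite lee_fin mulr_ge0 ?bessel_potential_ge0 ?expR_ge0.
  under eq_integral do rewrite -EFinM mulrCA.
  by under [leRHS]eq_integral do rewrite -EFinM mulrCA.
have [[iRe iIm] ug] := hg _ (schwartz_gauss y m0).
have : (\int[mu d]_x (potential x * e x)%:E = \int[mu d]_x (complex.Re (g x) * e x)%:E)%E.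
  have [ipe _] := integrable_potential_schwartz (schwartz_gauss y m0).
  rewrite /= in ipe; rewrite -EFin_Rintegral//.
  have ige : (mu d).-integrable setT (EFin \o (fun x => complex.Re (g x) * e x)).
    by move: iRe; apply: eq_integrable => // x _; rewrite /= mulrC Re_realM mulrC.
  rewrite -(EFin_Rintegral ige); congr EFin.
  move/(congr1 (@complex.Re R)): ug; rewrite potential_distributionE /= => ->.
  by apply: eq_Rintegral => x _; rewrite mulrC Re_realM mulrC.
move=> ->.
have ige : (mu d).-integrable setT (EFin \o (fun x => complex.Re (g x) * e x)).
  by move: iRe; apply: eq_integrable => // x _; rewrite /= mulrC Re_realM mulrC.
apply: le_trans (lee_abs _) _; apply: le_trans (le_abse_integral _ _ _) _ => //.
  exact: (measurable_int _ ige).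
apply: ge0_le_integral => //.
- exact: (measurable_int _ (integrable_abse ige)).
- by apply/measurable_EFinP; exact: measurable_funM.
move=> x _; rewrite lee_fin normrM (ger0_norm (expR_ge0 _)).
by rewrite ler_wpM2r ?expR_ge0 ?Re_le_normc.
Qed.

Definition japanese_weight (k : Rd) : R := (1 + enorm k ^+ 2) `^ (n / 2).

Local Notation weight := japanese_weight.

Definition potential_bessel_transform (k : Rd) : R := weight k * symbol k.

Lemma japanese_weight_ge0 k : 0 <= weight k. Proof. exact: powR_ge0. Qed.

Lemma measurable_japanese_weight : measurable_fun setT weight.
Proof.
rewrite (_ : weight = fun k => (1 + dotp k k * 1) `^ (n / 2)).
  exact: measurable_japanese.
by apply/funext => k; rewrite /japanese_weight enorm_sqr mulr1.
Qed.

Lemma integrable_weight_decay (f : Rd -> R) (phi : Rd -> R[i]) : schwartz phi ->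
  measurable_fun setT f -> (forall k, `|f k| <= cmod (phi k)) ->
  (mu d).-integrable setT (EFin \o (fun k => weight k * f k)).
Proof.
(* Domination by C (1+|k|^2)^(-n) needs (1+|k|^2)^(3n/2) |f| bounded: n/2 comes from the weight and
   n from the majorant. Since 1+|k|^2 <= (1+|k|)^2, decay of any integer order above 3n is
   enough. *)
move=> sphi mf fphi; pose N := (Num.truncn (3 * n)).+1.
have [C C0 hC] := schwartz_decay N sphi.
have := integrableZl_EFin C (@integrable_japanese R d n hn); apply: le_integrable => //.
  by apply/measurable_EFinP; apply: measurable_funM => //; exact: measurable_japanese_weight.
move=> k _; rewrite /= lee_fin normrM (ger0_norm (japanese_weight_ge0 k)).
rewrite [leRHS]ger0_norm; last by apply: mulr_ge0 => //; exact: powR_ge0.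
have n0 := dim_lt_n0 hn.
have k0 : 0 <= enorm k by exact: enorm_ge0.
have q1 : 1 <= 1 + enorm k ^+ 2 by rewrite lerDl exprn_ge0.
have qN : (1 + enorm k ^+ 2) `^ (3 * n / 2) <= (1 + enorm k) ^+ N.
  have : (1 + enorm k ^+ 2) `^ (3 * n / 2) <= (1 + enorm k) `^ (3 * n).
    rewrite [leRHS](_ : _ = ((1 + enorm k) ^+ 2) `^ (3 * n / 2)); last first.
      by rewrite -powR_mulrn ?addr_ge0// -powRrM; congr (_ `^ _); field.
    apply: ge0_ler_powR; rewrite ?nnegrE ?exprn_ge0 ?addr_ge0//.
    - by rewrite divr_ge0// mulr_ge0// ltW.
    - by rewrite exprn_ge0.
    by rewrite sqrrD expr1n mul1r lerD2r lerDl mulrn_wge0.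
  move=> /le_trans; apply; rewrite -powR_mulrn ?addr_ge0// ler_powR ?lerDl//.
  by rewrite ltW// truncnS_gt.
rewrite -enorm_sqr powRN ler_pdivlMr ?powR_gt0 ?(lt_le_trans ltr01)//.
have -> : weight k * `|f k| * (1 + enorm k ^+ 2) `^ n =
    (1 + enorm k ^+ 2) `^ (3 * n / 2) * `|f k|.
  rewrite mulrAC -powRD ?(gt_eqF (lt_le_trans ltr01 q1)) ?implybT//.
  by congr (_ `^ _ * _); field.
apply: le_trans (hC k); apply: ler_pM => //; exact: powR_ge0.
Qed.

(** The potential distribution is an integral functional defined on all functions, so the duality
    applies to the Fourier transform of weight times phi once the real and imaginary parts of this
    product are integrable. *)
Lemma represents_bessel_fourier :
  represents (bessel_fourier n potential_distribution)
    (fun k => (potential_bessel_transform k)%:C%C).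
Proof.
have mw := measurable_japanese_weight.
have msym : measurable_fun setT symbol by exact: measurable_bessel_symbol.
split; first exact: measurable_funM.
split; first exact: measurable_cst.
move=> phi sphi; pose a k := weight k * complex.Re (phi k).
pose b k := weight k * complex.Im (phi k).
have ia : (mu d).-integrable setT (EFin \o a).
  apply: (integrable_weight_decay sphi); first exact: schwartz_measurable_Re.
  by move=> k; exact: Re_le_normc.
have ib : (mu d).-integrable setT (EFin \o b).
  apply: (integrable_weight_decay sphi); first exact: schwartz_measurable_Im.
  by move=> k; exact: Im_le_normc.
have isa := integrable_symbolM hn l0 ia; have isb := integrable_symbolM hn l0 ib.
have aE k : complex.Re ((potential_bessel_transform k)%:C%C * phi k) = symbol k * a k.
  by rewrite Re_realM /a mulrCA mulrA.
have bE k : complex.Im ((potential_bessel_transform k)%:C%C * phi k) = symbol k * b k.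
  by rewrite Im_realM /b mulrCA mulrA.
split.
  split; [move: isa|move: isb]; apply: eq_integrable => // k _; by rewrite /= ?aE ?bE.
pose T (f : Rd -> R) (th : R) (x : Rd) := \int[mu d]_k (f k * cos (dotp x k + th)).
pose c : R := (2 * pi) `^ (- (d%:R / 2)).
(* With sin t = cos(t - pi/2), the real and imaginary parts of (cos - i sin)(a + i b) become
   combinations of the cosine transforms [T]. *)
have fE x : fourier (fun k => (weight k)%:C%C * phi k) x =
    (c * (T a 0 x + T b (- (pi / 2)) x) +i* (c * (T b 0 x - T a (- (pi / 2)) x)))%C.
  have phalf t : cos (t + - (pi / 2)) = sin t :> R.
    by rewrite cosB cos_pihalf sin_pihalf mulr0 add0r mulr1.
  rewrite /fourier /cintegral /T.
  transitivity (c%:C%C * ((\int[mu d]_k (1 * (a k * cos (dotp x k + 0)) +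
      1 * (b k * cos (dotp x k + - (pi / 2))) + 0)) +i*
      (\int[mu d]_k (1 * (b k * cos (dotp x k + 0)) +
      (- 1) * (a k * cos (dotp x k + - (pi / 2))) + 0)))%C).
    congr (_ * (_ +i* _)%C); apply: eq_Rintegral => k _.
      by rewrite phalf !addr0 /a /b /cis cosN sinN; case: (phi k) => u v /=; ring.
    by rewrite phalf !addr0 /a /b /cis cosN sinN; case: (phi k) => u v /=; ring.
  rewrite !Rintegral_lincomb//; try exact: integrable_mul_cos; try exact: integrable0.
  by rewrite Rintegral0 /=; congr (_ +i* _)%C; ring.
rewrite /bessel_fourier /dist_mul /dist_fourier potential_distributionE.
(* The unitary normalization of the transform cancels the factor (2 pi)^(d/2) of the duality
   formula. *)
have c1 : c * Num.sqrt (2 * pi) ^+ d = 1.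
  rewrite sqrt_expr_powR ?mulr_ge0 ?pi_ge0// /c powRN mulVf// gt_eqF// powR_gt0//.
  by rewrite mulr_gt0// pi_gt0.
have cospi2N : cos (- (pi / 2)) = 0 :> R by rewrite cosN cos_pihalf.
have iT f th : (mu d).-integrable setT (EFin \o f) ->
  (mu d).-integrable setT (EFin \o (fun x => potential x * T f th x)).
  exact: integrable_potential_transform.
have TE f : (mu d).-integrable setT (EFin \o f) ->
  \int[mu d]_x (potential x * T f 0 x) = Num.sqrt (2 * pi) ^+ d * \int[mu d]_k (symbol k * f k) /\
  \int[mu d]_x (potential x * T f (- (pi / 2)) x) = 0.
  move=> fi; rewrite !Rintegral_potential_transform// cos0 mul1r; split => //.
  by rewrite cospi2N mul0r mulr0.
have [Ta0 Ta1] := TE _ ia; have [Tb0 Tb1] := TE _ ib.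
congr (_ +i* _)%C.
  transitivity (\int[mu d]_x (c * (potential x * T a 0 x) +
      c * (potential x * T b (- (pi / 2)) x) + 0)).
    by apply: eq_Rintegral => x _; rewrite fE/=; ring.
  rewrite Rintegral_lincomb//; [|exact: iT|exact: iT|exact: integrable0].
  rewrite Ta0 Tb1 Rintegral0 mulr0 !addr0 mulrA c1 mul1r.
  by apply: eq_Rintegral => k _; rewrite aE.
transitivity (\int[mu d]_x (c * (potential x * T b 0 x) +
    (- c) * (potential x * T a (- (pi / 2)) x) + 0)).
  by apply: eq_Rintegral => x _; rewrite fE/=; ring.
rewrite Rintegral_lincomb//; [|exact: iT|exact: iT|exact: integrable0].
rewrite Tb0 Ta1 Rintegral0 mulr0 !addr0 mulrA c1 mul1r.
by apply: eq_Rintegral => k _; rewrite bE.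
Qed.

End potential_distribution.

(** * Norms of the Bessel potential *)

Section radial_norms.
Context {R : realType}.
Local Notation leb := (@lebesgue_measure R).
Local Notation mu d := (@lebesgue_rV R d).

Definition sphere_area (d : nat) : R := 2 * pi `^ (d%:R / 2) / Gamma (d%:R / 2).

Lemma sphere_area_gt0 d : (0 < d)%N -> 0 < sphere_area d.
Proof.
move=> d0; rewrite divr_gt0 ?mulr_gt0 ?powR_gt0 ?pi_gt0//.
by rewrite Gamma_gt0 ?divr_gt0// ltr0n.
Qed.

(** In the logarithmic radius the dilation by [l] is a translation by ln l, which turns e^(ds) into
    l^(-d) e^(ds). *)
Lemma ge0_integral_radial d (l : R) (F : R -> R) : (0 < d)%N -> 0 < l ->
  measurable_fun setT F -> (forall t, 0 <= F t) ->
  (\int[mu d]_x (F (l * enorm x))%:E =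
   (sphere_area d * l ^- d)%:E * \int[leb]_(t in `]0%R, +oo[) (t ^+ d.-1 * F t)%:E)%E.
Proof.
move=> d0 l0 mF F0.
have mFl : measurable_fun setT (fun t => F (l * t)).
  by apply: (measurableT_comp mF); exact: measurable_funM.
rewrite (@ge0_integral_polar R d (fun t => F (l * t)))// ge0_integral_expR; last 2 first.
- by apply: measurable_funM => //; exact: measurable_funX.
- by move=> t t0; rewrite mulr_ge0// exprn_ge0// ltW.
pose G s := (F (expR s) * expR (d%:R * s))%:E.
have mG : measurable_fun setT G.
  apply/measurable_EFinP; apply: measurable_funM.
    exact: (measurableT_comp mF (@measurable_expR R)).
  by apply: (measurableT_comp (@measurable_expR R)); exact: measurable_funM.
have G0 s : (0 <= G s)%E by rewrite lee_fin mulr_ge0// expR_ge0.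
have -> : (\int[leb]_s (expR s ^+ d.-1 * F (expR s) * expR s)%:E = \int[leb]_s G s)%E.
  apply: eq_integral => s _; rewrite /G mulrAC -exprSr prednK// mulrC.
  by rewrite expRM_natl.
rewrite -/(sphere_area d) [in RHS]EFinM -muleA; congr (_ * _)%E.
rewrite -(ge0_integral_shift (ln l) mG G0) -ge0_integralZl//; last 2 first.
- by apply: (measurableT_comp mG); exact: measurable_funD.
- by rewrite lee_fin invr_ge0 exprn_ge0// ltW.
apply: eq_integral => s _; rewrite /G -EFinM; congr EFin.
rewrite expRD lnK ?posrE// (mulrC l) mulrDr expRD [expR (d%:R * ln l)]expRM_natl lnK ?posrE//.
by rewrite mulrCA (mulrCA (l ^- d)) mulVf ?mulr1// expf_neq0// gt_eqF.
Qed.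

End radial_norms.

Section bessel_norms.
Context {R : realType}.
Local Notation leb := (@lebesgue_measure R).
Local Notation mu d := (@lebesgue_rV R d).
Variables (d : nat) (n l : R).
Hypothesis d0 : (0 < d)%N.
Hypothesis hn : d%:R / 2 < n.
Hypothesis l0 : 0 < l.

(** Extended-real counterpart of [I_const], which is its [fine]; a divergent integral stays visible
    here. [symbol_integral] plays the same part for the integral inside [phi_fun]. *)
Definition bessel_integral (r : R) : \bar R :=
  (\int[leb]_(t in `]0%R, +oo[)
    (t ^+ d.-1 * (t `^ (n - d%:R / 2) * besselK (n - d%:R / 2) t) `^ r)%:E)%E.

Definition symbol_integral : \bar R :=
  (\int[leb]_(s in `]0%R, +oo[)
    (s ^+ d.-1 * ((1 + l ^+ 2 * s ^+ 2) `^ n / (1 + s ^+ 2) `^ (2 * n)))%:E)%E.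

Let G0 : 0 < 2 `^ (n - 1) * Gamma n.
Proof. by rewrite mulr_gt0 ?powR_gt0 ?Gamma_gt0 ?(dim_lt_n0 hn). Qed.

Lemma integral_bessel_potential_powR (r : R) :
  (\int[mu d]_x (bessel_potential n l x `^ r)%:E =
   (sphere_area d * l ^- d * (2 `^ (n - 1) * Gamma n) `^ (- r))%:E * bessel_integral r)%E.
Proof.
pose F t := mixture d n (t ^+ 2) `^ r.
have mF : measurable_fun setT F.
  apply: (measurableT_comp (@measurable_powR R r)).
  by apply: (measurableT_comp (measurable_mixture hn)); exact: measurable_funX.
have F0 t : 0 <= F t by exact: powR_ge0.
have -> : (\int[mu d]_x (bessel_potential n l x `^ r)%:E =
    \int[mu d]_x (F (l * enorm x))%:E)%E.
  by apply: eq_integral => x _; rewrite /F /bessel_potential exprMn enorm_sqr.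
rewrite (ge0_integral_radial d0 l0 mF F0).
set c := 2 `^ (n - 1) * Gamma n.
have -> : bessel_integral r =
    ((c `^ r)%:E * \int[leb]_(t in `]0%R, +oo[) (t ^+ d.-1 * F t)%:E)%E.
  rewrite -ge0_integralZl//; last 3 first.
  - apply/measurable_EFinP; apply: measurable_funTS; apply: measurable_funM => //.
  - move=> t; rewrite /= in_itv/= andbT => t0.
    by rewrite lee_fin mulr_ge0 ?powR_ge0// exprn_ge0// ltW.
  - by rewrite lee_fin powR_ge0.
  apply: eq_integral => t; rewrite inE/= in_itv/= andbT => t0.
  rewrite -EFinM; congr EFin; rewrite mulrCA /F mixtureE//; congr (_ * _).
  rewrite -powRM ?(ltW G0)//.
    by rewrite mulrCA mulfV ?mulr1// gt_eqF.
  by rewrite -mixtureE// mixture_ge0.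
by rewrite muleA -EFinM powRN divfK// gt_eqF// powR_gt0.
Qed.

(** With s = |k|/l the squared symbol contributes l^(-2d) and the Jacobian l^d. *)
Lemma integral_weight_symbol :
  (\int[mu d]_k (potential_bessel_transform n l k ^+ 2)%:E =
   (sphere_area d * l ^- d)%:E * symbol_integral)%E.
Proof.
pose Q s := (1 + l ^+ 2 * s ^+ 2) `^ n / (1 + s ^+ 2) `^ (2 * n).
pose F s := l ^- d * l ^- d * Q s.
have mQ : measurable_fun setT Q.
  have mp (a p : R) : measurable_fun setT (fun s : R => (1 + a * s ^+ 2) `^ p).
    apply: (measurableT_comp (@measurable_powR R p)); apply: measurable_funD => //.
    by apply: measurable_funM => //; exact: measurable_funX.
  apply: measurable_funM => //.
  rewrite (_ : (fun _ => _) = fun s => (1 + 1 * s ^+ 2) `^ (- (2 * n)))//.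
  by apply/funext => s; rewrite mul1r powRN.
have mF : measurable_fun setT F by exact: measurable_funM.
have Q0 s : 0 <= Q s by rewrite divr_ge0 ?powR_ge0.
have ld0 : 0 <= l ^- d by rewrite invr_ge0 exprn_ge0// ltW.
have F0 s : 0 <= F s.
  by rewrite /F; apply: mulr_ge0 => //; exact: mulr_ge0.
have li0 : 0 < l^-1 by rewrite invr_gt0.
have -> : (\int[mu d]_k (potential_bessel_transform n l k ^+ 2)%:E =
    \int[mu d]_k (F (l^-1 * enorm k))%:E)%E.
  apply: eq_integral => k _; congr EFin.
  rewrite /F /Q /potential_bessel_transform /bessel_symbol /japanese_weight.
  have q0 : 0 <= dotp k k := dotp_ge0 k.
  have l2 : l ^+ 2 != 0 by rewrite expf_neq0// gt_eqF.
  rewrite (_ : l ^+ 2 * (l^-1 * enorm k) ^+ 2 = dotp k k); last first.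
    by rewrite exprMn enorm_sqr mulrA exprVn mulfV// mul1r.
  rewrite (_ : (l^-1 * enorm k) ^+ 2 = dotp k k / l ^+ 2); last first.
    by rewrite exprMn enorm_sqr exprVn mulrC.
  rewrite enorm_sqr !exprMn -(powR_mulrn 2 (powR_ge0 (1 + dotp k k) (n / 2))) -powRrM divfK//.
  rewrite -(powR_mulrn 2 (powR_ge0 _ (- n))) -powRrM -powRN mulNr (mulrC n) expr2; ring.
rewrite (ge0_integral_radial d0 li0 mF F0) -exprVn invrK.
have -> : (\int[leb]_(t in `]0%R, +oo[) (t ^+ d.-1 * F t)%:E =
    (l ^- d * l ^- d)%:E * symbol_integral)%E.
  rewrite -ge0_integralZl//; last 3 first.
  - apply/measurable_EFinP; apply: measurable_funTS; apply: measurable_funM => //.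
  - move=> t; rewrite /= in_itv/= andbT => t0.
    by rewrite lee_fin; apply: mulr_ge0; [rewrite exprn_ge0// ltW|exact: Q0].
  - by rewrite lee_fin mulr_ge0.
  by apply: eq_integral => t _; rewrite -EFinM mulrCA.
rewrite muleA -EFinM; congr (_%:E * _)%E.
by rewrite -mulrA; congr (_ * _); rewrite mulrA mulfV ?mul1r// expf_neq0// gt_eqF.
Qed.

Lemma dist_Lpnorm_potential_ge (r : R) : 1 < r ->
  ((\int[mu d]_x (bessel_potential n l x `^ r)%:E) `^ r^-1 <=
   dist_Lpnorm r (@potential_distribution R d n l))%E.
Proof.
move=> r1; apply: le_ereal_inf_tmp => _ [g rg <-].
rewrite /Lpnorm unlock; apply: gt0_ler_poweR.
- by rewrite invr_ge0 (le_trans ler01)// ltW.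
- rewrite in_itv/= leey andbT; apply: integral_ge0 => x _.
  by rewrite lee_fin powR_ge0.
- by rewrite in_itv/= leey andbT; apply: integral_ge0 => x _; rewrite lee_fin powR_ge0.
apply: le_trans (represents_potential_powR_le hn l0 r1 rg) _.
rewrite le_eqVlt; apply/orP; left; apply/eqP; apply: eq_integral => x _.
by rewrite /= ger0_norm ?normc_nneg.
Qed.

Lemma Lpnorm_transform :
  Lpnorm 2 (fun k => (@potential_bessel_transform R d n l k)%:C%C) =
  ((\int[mu d]_k (potential_bessel_transform n l k ^+ 2)%:E) `^ 2^-1)%E.
Proof.
rewrite /Lpnorm unlock; congr (_ `^ _)%E; apply: eq_integral => k _.
have t0 : 0 <= potential_bessel_transform n l k.
  by rewrite mulr_ge0 ?japanese_weight_ge0// bessel_symbol_ge0.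
by rewrite normc_nneg_real//= ger0_norm// powR_mulrn.
Qed.

Lemma sobolev_norm_potential_le : (sobolev_norm n (@potential_distribution R d n l) <=
  ((\int[mu d]_k (potential_bessel_transform n l k ^+ 2)%:E) `^ 2^-1))%E.
Proof.
rewrite -Lpnorm_transform; apply: ereal_inf_lbound.
by exists (fun k => (potential_bessel_transform n l k)%:C%C) => //; exact: represents_bessel_fourier.
Qed.

Lemma sobolev_potential : (symbol_integral < +oo)%E ->
  sobolev n (@potential_distribution R d n l).
Proof.
move=> J; split; first exact: tempered_potential.
exists (fun k => (potential_bessel_transform n l k)%:C%C); split.
  exact: represents_bessel_fourier.
rewrite Lpnorm_transform poweR_lty// integral_weight_symbol lte_mul_pinfty//.
by rewrite lee_fin mulr_ge0 ?invr_ge0 ?exprn_ge0 ?(ltW l0)// ltW// sphere_area_gt0.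
Qed.

End bessel_norms.

(** * Comparison of the norms and infimum over the dilations *)

Section sharp_constant_bound.
Context {R : realType}.

(** Multiplying the hypothesis by A^(-1/2) l^(d/r) frees its left side of [l] and leaves l^(d/r -
    d/2) on the right, whose square is the prefactor of [phi_fun]. Here [A] is the area of the
    sphere and [c] the normalization of the potential. *)
Lemma scaled_ratio_le (A l c I J S r : R) (d : nat) : 0 < A -> 0 < l -> 0 < c -> 0 <= I ->
  0 <= J -> 0 < r ->
  (A * l ^- d * c `^ (- r) * I) `^ r^-1 <= S * (A * l ^- d * J) `^ 2^-1 ->
  A^-1 `^ (1 / 2 - 1 / r) * (I `^ (1 / r) / c) <=
  S * Num.sqrt ((l `^ (d%:R - 2 * d%:R / r))^-1 * J).
Proof.
move=> A0 l0 c0 I0 J0 r0 h; have rN0 : r != 0 by rewrite gt_eqF.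
have ld : l ^- d = l `^ (- d%:R) by rewrite powRN powR_mulrn ?ltW.
have K0 : 0 < A `^ (- 2^-1) * l `^ (d%:R / r) by rewrite mulr_gt0 ?powR_gt0.
have lK x y : l `^ x * l `^ y = l `^ (x + y) by rewrite powRD// (gt_eqF l0) implybT.
have AK x y : A `^ x * A `^ y = A `^ (x + y) by rewrite powRD// (gt_eqF A0) implybT.
have := ler_wpM2l (ltW K0) h; rewrite ld.
rewrite !powRM ?mulr_ge0 ?powR_ge0 ?(ltW A0)// -!powRrM.
rewrite (_ : _ * _ * (_ * _ * _ * _) = A `^ (- 2^-1) * A `^ r^-1 *
  (l `^ (d%:R / r) * l `^ (- d%:R / r)) * c `^ (- r / r) * I `^ r^-1); last by ring.
rewrite (_ : _ * _ * (S * _) = S * (A `^ (- 2^-1) * A `^ 2^-1 *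
  (l `^ (d%:R / r) * l `^ (- d%:R / 2)) * J `^ 2^-1)); last by ring.
rewrite !AK !lK addNr powRr0 mul1r.
rewrite [- d%:R / r]mulNr subrr powRr0 mulr1 [- r / r]mulNr divff// powR_inv1 ?(ltW c0)//.
rewrite -(powR_inv1 (ltW A0)) -powRrM -powR12_sqrt ?mulr_ge0 ?invr_ge0 ?powR_ge0//.
rewrite powRM ?invr_ge0 ?powR_ge0// -powRN -powRrM !div1r.
rewrite (_ : -1 * (2^-1 - r^-1) = - 2^-1 + r^-1); last by ring.
rewrite (_ : d%:R / r + - d%:R / 2 = - (d%:R - 2 * d%:R / r) * 2^-1); last by field.
by rewrite -mulrA [c^-1 * _]mulrC.
Qed.

Lemma lower_constant_le (d : nat) (n r S : R) : (0 < d)%N -> d%:R / 2 < n -> 2 < r -> 0 <= S ->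
  (forall f : ('rV[R]_d -> R[i]) -> R[i], sobolev n f ->
      (dist_Lpnorm r f <= S%:E * sobolev_norm n f)%E) ->
  lower_constant r n d <= S.
Proof.
move=> d0 hn hr S0 HS.
have r0 : 0 < r by exact: lt_trans hr.
have r1 : 1 < r by apply: lt_trans hr; rewrite ltr1n.
(* In this case the square root is 0 and so is its inverse by convention, which makes the constant
   0. *)
have [Phi0|Phi0] := leP (Phi_const r n d) 0.
  by rewrite /lower_constant (eqP (_ : Num.sqrt _ == 0)) ?sqrtr_eq0// mulr0 invr0 !mulr0.
have [I0|I0] := eqVneq (I_const r n d) 0.
  by rewrite /lower_constant I0 powR0 ?mul0r ?mulr0// div1r invr_neq0// gt_eqF.
(* An infinite integral would have [fine] equal to 0, so a nonzero [I_const] is the true value of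
   the integral. *)
have Iint : bessel_integral d n r = (I_const r n d)%:E.
  have bE : I_const r n d = fine (bessel_integral d n r) by [].
  rewrite bE fineK//; apply: contraTT isT => bfin; move: I0; rewrite bE.
  by case: (bessel_integral d n r) bfin => //=; rewrite eqxx.
have phi_ge0 l : 0 < l -> 0 <= phi_fun r n d l.
  move=> l0; rewrite mulr_ge0 ?invr_ge0 ?powR_ge0//; apply: Rintegral_ge0 => s.
  rewrite /= in_itv/= andbT => s0; apply: mulr_ge0; first by rewrite exprn_ge0// ltW.
  by rewrite divr_ge0 ?powR_ge0.
have phi_ge l : 0 < l -> Phi_const r n d <= phi_fun r n d l.
  move=> l0; apply: ge_inf; last by exists l.
  by exists 0 => _ [k /= k0 <-]; exact: phi_ge0.
set c := 2 `^ (n - 1) * Gamma n.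
have c0 : 0 < c by rewrite mulr_gt0 ?powR_gt0 ?Gamma_gt0 ?(dim_lt_n0 hn).
pose X := (@sphere_area R d)^-1 `^ (1 / 2 - 1 / r) * (I_const r n d `^ (1 / r) / c).
have X0 : 0 <= X by rewrite mulr_ge0 ?divr_ge0 ?powR_ge0 ?ltW.
have key l : 0 < l -> X <= S * Num.sqrt (phi_fun r n d l).
  move=> l0; have phi0 := lt_le_trans Phi0 (phi_ge _ l0).
  pose J := symbol_integral d n l.
  (* A positive infimum makes [phi_fun] positive at [l], which rules out an infinite integral. The
     trial distribution therefore lies in the Sobolev space. *)
  have JE : J = (fine J)%:E.
    rewrite fineK//; apply: contraTT isT => Jfin; move: phi0.
    have -> : phi_fun r n d l = (l `^ (d%:R - 2 * d%:R / r))^-1 * fine J by [].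
    by case: J Jfin => //=; rewrite mulr0 ltxx.
  have J0 : 0 <= fine J.
    move: phi0; rewrite [phi_fun _ _ _ _]/((l `^ (d%:R - 2 * d%:R / r))^-1 * fine J).
    by rewrite pmulr_rgt0 ?invr_gt0 ?powR_gt0// => /ltW.
  apply: (@scaled_ratio_le _ l c _ _ _ _ _ (sphere_area_gt0 d0)) => //.
    rewrite -lee_fin -Iint; apply: integral_ge0 => t; rewrite /= in_itv/= andbT => t0.
    by rewrite lee_fin mulr_ge0 ?powR_ge0// exprn_ge0// ltW.
  rewrite -lee_fin.
  have := HS _ (sobolev_potential d0 hn l0 _); rewrite -/J JE ltry => /(_ isT).
  move=> /(le_trans (dist_Lpnorm_potential_ge hn l0 r1)).
  rewrite integral_bessel_potential_powR// Iint -EFinM => /le_trans; apply.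
  rewrite [leRHS]EFinM; apply: lee_wpmul2l; first by rewrite lee_fin.
  apply: le_trans (sobolev_norm_potential_le hn l0) _.
  by rewrite integral_weight_symbol// -/J JE -EFinM.
have SX : X <= S * Num.sqrt (Phi_const r n d).
  (* Passing to the infimum divides by [S]. For S = 0 the bound at the single dilation l = 1 already
     gives X <= 0. *)
  have [S_eq0|SN0] := eqVneq S 0.
    by have := key 1 ltr01; rewrite S_eq0 !mul0r.
  have Sgt0 : 0 < S by rewrite lt_neqAle eq_sym SN0.
  rewrite mulrC -ler_pdivrMr// -[leLHS]ger0_norm ?divr_ge0// -sqrtr_sqr ler_wsqrtr//.
  (* After squaring, (X/S)^2 has to be a lower bound of all values of [phi_fun], which is [key]. *)
  apply: lb_le_inf; first by exists (phi_fun r n d 1), 1 => //=.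
  move=> _ [l /= l0 <-]; rewrite -[leRHS]sqr_sqrtr ?phi_ge0//.
  by rewrite ler_pXn2r ?nnegrE ?sqrtr_ge0 ?divr_ge0// ler_pdivrMr// mulrC key.
have -> : lower_constant r n d = X / Num.sqrt (Phi_const r n d).
  rewrite /X /lower_constant -/c /sphere_area invf_div -[RHS]mulrA; congr (_ * _).
  by rewrite invfM mulrA.
by rewrite ler_pdivrMr ?sqrtr_gt0.
Qed.

End sharp_constant_bound.

Theorem proposition3p2 (R : realType) (d : nat) (n r : R)
    (hd : (1 <= d)%N) (hn : d%:R / 2 < n) (hr : 2 < r) :
  ((lower_constant r n d)%:E <= sharp_constant r n d)%E.
Proof.
apply: le_ereal_inf_tmp => _ [S [S0 HS] <-]; rewrite lee_fin.
exact: lower_constant_le.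
Qed.
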